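(* Let $X=\{x_j\}_{j=1}^n$ and $X'=\{x'_k\}_{k=1}^m$ be two disjoint finite sets of distinct points on the real line. Let $g$ be analytic on the upper half-plane $\mathbb{C}_+=\{\operatorname{Im} w>0\}$ with $|g(i)|=1$, satisfying for some $K>0$ and $a,b,c_j,d_k\ge0$ $$\log|g(w)|\le K\frac{(1+|w|)^{2b}}{(\operatorname{Im} w)^a}\,\frac{\prod_{j=1}^n|w-x_j|^{c_j}}{\prod_{k=1}^m|w-x'_k|^{d_k}}, \qquad w\in\mathbb{C}_+.$$ Let $l:=2a-2b-\sum_{j=1}^n c_j+\sum_{k=1}^m d_k$. Then for each $\varepsilon>0$ there exists a positive number $C_9=C_9(X,X',a,b,c_j,d_k,\varepsilon)$ such that $$\sum_{\zeta\in Z(g)}\frac{(\operatorname{Im}\zeta)^{a+1+\varepsilon}}{(1+|\zeta|)^{l_1}}\,\frac{\prod_{k=1}^m|\zeta-x'_k|^{(d_k-1+\varepsilon)_+}}{\prod_{j=1}^n|\zeta-x_j|^{\min(a,c_j)}}\le C_9\cdot K,$$ where $$l_1:=2(a+1+\varepsilon)+\{l\}_{a,\varepsilon}-\sum_{j=1}^n\min(a,c_j)+\sum_{k=1}^m(d_k-1+\varepsilon)_+.$$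
   Context: $Z(g)$ denotes the zero set of $g$ in $\mathbb{C}_+$, counted with multiplicities; $a_+:=\max(a,0)$. For real $u$ write $u=u_+-u_-$ with $u_\pm\ge0$ the positive and negative parts, and for $c\ge0$, $\varepsilon>0$ set $\{u\}_{c,\varepsilon}:=(u_--1+\varepsilon)_+-\min(c,u_+)$. *)

(* Defs.v *)
From Stdlib Require Import Reals List.
From Coquelicot Require Import Coquelicot.
Open Scope R_scope.

Definition upper (w : C) : Prop := 0 < Im w.

Fixpoint rsum (n : nat) (f : nat -> R) : R :=
  match n with O => 0 | S k => rsum k f + f k end.
Fixpoint rprod (n : nat) (f : nat -> R) : R :=
  match n with O => 1 | S k => rprod k f * f k end.

Definition pos_part (u : R) : R := Rmax u 0.
Definition neg_part (u : R) : R := Rmax (- u) 0.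
Definition brace (u c eps : R) : R :=
  pos_part (neg_part u - 1 + eps) - Rmin c (pos_part u).

Definition local_expansion (g : C -> C) (w0 : C) (a : nat -> C) : Prop :=
  exists r : R, 0 < r /\ r <= Im w0 /\
    forall w : C, Cmod (w - w0) < r ->
      is_series (fun k => (a k * (w - w0) ^ k)%C) (g w).

Definition analytic_upper (g : C -> C) : Prop :=
  forall w0 : C, upper w0 -> exists a : nat -> C, local_expansion g w0 a.

Definition zero_order_ge (g : C -> C) (z : C) (m : nat) : Prop :=
  upper z /\ exists a : nat -> C, local_expansion g z a /\
    forall k : nat, (k < m)%nat -> a k = 0%C.

(* sum over a finite list of (point, multiplicity) pairs *)
Definition zsum (zs : list (C * nat)) (F : C -> R) : R :=
  fold_right (fun p acc => INR (snd p) * F (fst p) + acc) 0 zs.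

(* Main.v *)
Require Import Defs.
From Stdlib Require Import Reals List Lra Lia Psatz Classical ClassicalEpsilon.
From Coquelicot Require Import Coquelicot.
Open Scope R_scope.

(* Near a real point x0 write r = |w - x0|, y = Im w, and let V be the strictly superharmonic function
   of size r^-gam, gam < 1 close to 1. For a dyadic box {s <= r <= 2s, t <= y} take the region Om bounded
   below by y = t/2 and, away from the scale r ~ s, by 10 y = (r^2 + s^2) eta V. On its boundary the Green
   function of {y > t/2} with pole z in the box is at most Im z * eta V, and log|g| <= K U <= K A V with
   A = C t^-a s^-(sigma + nu) when U <= C y^-a r^-(sigma + gam) near x0. The maximum principle for
   log|g| + (sum of m_z (Green - Im z eta V)) / 2 - K A V, evaluated at i, bounds the sum of m_z Im z over
   the box by C A K, and the slack eps makes the dyadic sums of the weights y^(a+1+eps) r^sigma converge.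
   The substitution w |-> -1/w fixes i and turns the point at infinity into 0, and compactness patches
   finitely many local bounds. *)

(** * Complex second-order expansions *)

(** All exponents of the theorem come from one local criterion: if U <= C y^-a r^-e near a boundary
    point, the weight y^(a+1+eps) r^sigma is summable as soon as sigma >= -a and e < sigma + 1. The
    pair (e, sigma) is (-c_j, -min(a, c_j)) at x_j, (d_k, (d_k - 1 + eps)_+) at x'_k, (0, 0) at
    other real points and, in the coordinate -1/w, (-l, {l}_{a,eps}) at infinity. The strict
    inequality leaves room for gam < 1 with e <= sigma + gam. The obstacle is that for a > 0 the
    majorant blows up along the whole real line, so no domain may reach the axis: the height t
    becomes a second dyadic parameter, and the region has to contain i while being low only near the
    scale s. Beyond that scale it lies in the cusp 10 y >= eta r^(2-gam). There gam < 1 keeps it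
    bounded, and gam near 1 makes it almost a cone, at a cost s^-nu with nu about (1 - gam)(a +
    |sigma|). *)

Definition near (w : C) (P : C -> Prop) : Prop :=
  exists r : R, 0 < r /\ forall z : C, Cmod (z - w) < r -> P z.

Lemma near_and (w : C) (P Q : C -> Prop) :
  near w P -> near w Q -> near w (fun z => P z /\ Q z).
Proof.
  intros [r [hr HP]] [s [hs HQ]]. exists (Rmin r s). split.
  - now apply Rmin_glb_lt.
  - intros z hz. split; [apply HP | apply HQ]; eapply Rlt_le_trans; eauto;
      [apply Rmin_l | apply Rmin_r].
Qed.

Lemma near_imp (w : C) (P Q : C -> Prop) :
  (forall z, P z -> Q z) -> near w P -> near w Q.
Proof. intros H [r [hr HP]]. exists r. split; auto. Qed.

Lemma near_self (w : C) (P : C -> Prop) : near w P -> P w.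
Proof.
  intros [r [hr HP]]. apply HP.
  replace (w - w)%C with (RtoC 0) by ring. now rewrite Cmod_0.
Qed.

(* Unlike power series expansions, this form of analyticity composes with [w |-> -1/w] by a short
   computation, and it is all that the maximum principle needs. *)
Definition hol2 (g : C -> C) (w : C) : Prop :=
  exists c1 c2 : C, forall eta : R, 0 < eta -> exists r : R, 0 < r /\
    forall h : C, Cmod h < r ->
      Cmod (g (w + h) - g w - c1 * h - c2 * h ^ 2)%C <= eta * Cmod h ^ 2.

Fixpoint csum (n : nat) (f : nat -> C) : C :=
  match n with O => 0%C | S k => (csum k f + f k)%C end.

Lemma csum_zero (n : nat) (f : nat -> C) :
  (forall k, (k < n)%nat -> f k = 0%C) -> csum n f = 0%C.
Proof.
  induction n as [|n IH]; intros H; simpl; [reflexivity|].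
  rewrite IH, (H n); auto; ring.
Qed.

Lemma is_series_sum_n_near (a : nat -> C) (l : C) (eta : R) :
  0 < eta -> is_series a l ->
  exists N : nat, forall n, (N <= n)%nat -> Cmod (sum_n a n - l) < eta.
Proof.
  intros he H.
  destruct (H (ball_norm l (mkposreal eta he))) as [N HN].
  { apply (locally_ball_norm (V := C_NormedModule) l (mkposreal eta he)). }
  exists N. intros n hn. specialize (HN n hn). exact HN.
Qed.

Lemma sum_n_csum (a : nat -> C) (n : nat) : sum_n a n = csum (S n) a.
Proof.
  induction n as [|n IH].
  - rewrite sum_O. simpl. ring.
  - rewrite sum_Sn, IH. reflexivity.
Qed.

Lemma is_series_terms_bounded (a : nat -> C) (l : C) :
  is_series a l -> exists M, 0 <= M /\ forall k, Cmod (a k) <= M.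
Proof.
  intros H. destruct (is_series_sum_n_near a l 1 ltac:(lra) H) as [N HN].
  assert (Hf : forall n, exists M, 0 <= M /\ forall k, (k < n)%nat -> Cmod (a k) <= M).
  { induction n as [|n [M [hM IH]]].
    - exists 0. split; [lra|]. intros; lia.
    - exists (Rmax M (Cmod (a n))). split.
      + eapply Rle_trans; [exact hM | apply Rmax_l].
      + intros k hk. destruct (Nat.eq_dec k n) as [->|hne]; [apply Rmax_r|].
        eapply Rle_trans; [apply IH; lia | apply Rmax_l]. }
  destruct (Hf (S N)) as [M [hM HM]].
  (* Past [N] a term is the difference of two partial sums, each within 1 of the limit. *)
  exists (M + 2). split; [lra|]. intros k.
  destruct (Nat.lt_ge_cases k (S N)) as [hk|hk].
  - specialize (HM k hk). lra.
  - destruct k as [|k]; [lia|].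
    pose proof (HN (S k) ltac:(lia)) as H1. pose proof (HN k ltac:(lia)) as H2.
    replace (a (S k)) with ((sum_n a (S k) - l) + - (sum_n a k - l))%C.
    + eapply Rle_trans; [apply Cmod_triangle|]. rewrite Cmod_opp. lra.
    + rewrite sum_Sn. change (plus (sum_n a k) (a (S k))) with (sum_n a k + a (S k))%C. ring.
Qed.

(** Convergence at the single point [rho = r / 2] bounds |a_k| rho^k by M, and for |h| < rho / 2 the
    tail is compared with a geometric series of ratio q = |h| / rho <= 1/2, whose sum from m on is
    at most 2 M q^m. *)
Lemma power_series_remainder (a : nat -> C) (f : C -> C) (r : R) (m : nat) :
  0 < r ->
  (forall h, Cmod h < r -> is_series (fun k => (a k * h ^ k)%C) (f h)) ->
  exists B d : R, 0 <= B /\ 0 < d /\ forall h, Cmod h < d ->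
    Cmod (f h - csum m (fun k => a k * h ^ k))%C <= B * Cmod h ^ m.
Proof.
  intros hr H.
  set (rho := r / 2). assert (hrho : 0 < rho < r) by (unfold rho; lra).
  destruct (is_series_terms_bounded _ _ (H (RtoC rho)
     ltac:(rewrite Cmod_R, Rabs_pos_eq; lra))) as [M [hM HM]].
  assert (Hak : forall k, Cmod (a k) * rho ^ k <= M).
  { intros k. specialize (HM k). rewrite Cmod_mult, Cmod_pow, Cmod_R, Rabs_pos_eq in HM; lra. }
  exists (2 * M / rho ^ m), (rho / 2).
  assert (hrm : 0 < rho ^ m) by (apply pow_lt; lra).
  split; [apply Rmult_le_pos; [lra | left; now apply Rinv_0_lt_compat]|].
  split; [lra|]. intros h hh.
  pose proof (Cmod_ge_0 h) as h0.
  set (q := Cmod h / rho). assert (hq : 0 <= q <= / 2).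
  { unfold q, Rdiv. split.
    - apply Rmult_le_pos; [lra|left; apply Rinv_0_lt_compat; lra].
    - apply Rmult_le_reg_r with rho; [lra|]. rewrite Rmult_assoc, Rinv_l; lra. }
  assert (Hterm : forall k, Cmod (a k * h ^ k)%C <= M * q ^ k).
  { intros k. rewrite Cmod_mult, Cmod_pow. unfold q, Rdiv.
    rewrite Rpow_mult_distr, pow_inv.
    assert (hp : 0 < rho ^ k) by (apply pow_lt; lra).
    replace (Cmod (a k) * Cmod h ^ k) with
      (Cmod (a k) * rho ^ k * (Cmod h ^ k * / rho ^ k)) by (field; lra).
    apply Rmult_le_compat_r; [|apply Hak].
    apply Rmult_le_pos; [apply pow_le; lra | left; now apply Rinv_0_lt_compat]. }
  (* The factor 1 - q^j is there for the induction: one more term costs M q^(m+j), and q <= 1/2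
     gives q^j <= 2 (q^j - q^(j+1)). *)
  assert (Hpart : forall j, Cmod (csum (m + j) (fun k => a k * h ^ k)
                   - csum m (fun k => a k * h ^ k))%C <= 2 * M * q ^ m * (1 - q ^ j)).
  { induction j as [|j IH].
    - rewrite Nat.add_0_r. replace (_ - _)%C with (RtoC 0) by ring. rewrite Cmod_0. simpl. lra.
    - rewrite Nat.add_succ_r. simpl csum.
      replace (csum (m + j) (fun k => a k * h ^ k) + a (m + j)%nat * h ^ (m + j) - csum m (fun k => a k * h ^ k))%C
        with ((csum (m + j) (fun k => a k * h ^ k) - csum m (fun k => a k * h ^ k)) + a (m + j)%nat * h ^ (m + j))%C by ring.
      eapply Rle_trans; [apply Cmod_triangle|].
      pose proof (Hterm (m + j)%nat) as Ht. rewrite pow_add in Ht.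
      assert (0 <= q ^ m) by (apply pow_le; lra). assert (0 <= q ^ j) by (apply pow_le; lra).
      assert (0 <= M * q ^ m * q ^ j) by (repeat apply Rmult_le_pos; auto).
      simpl pow. nra. }
  assert (E : 2 * M / rho ^ m * Cmod h ^ m = 2 * M * q ^ m).
  { unfold q, Rdiv. rewrite Rpow_mult_distr, pow_inv. ring. }
  rewrite E. apply le_epsilon. intros eta heta.
  destruct (is_series_sum_n_near _ _ eta heta (H h ltac:(lra))) as [N HN].
  specialize (HN (m + N)%nat ltac:(lia)). rewrite sum_n_csum in HN.
  replace (S (m + N)) with (m + S N)%nat in HN by lia.
  specialize (Hpart (S N)).
  replace (f h - csum m (fun k => a k * h ^ k))%C with
    (- (csum (m + S N) (fun k => a k * h ^ k) - f h) +
     (csum (m + S N) (fun k => a k * h ^ k) - csum m (fun k => a k * h ^ k)))%C by ring.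
  eapply Rle_trans; [apply Cmod_triangle|]. rewrite Cmod_opp.
  assert (0 <= q ^ S N) by (apply pow_le; lra). assert (0 <= q ^ m) by (apply pow_le; lra).
  assert (0 <= M * q ^ m * q ^ S N) by (apply Rmult_le_pos; [apply Rmult_le_pos|]; assumption).
  nra.
Qed.

Lemma local_expansion_shift (g : C -> C) (w0 : C) (a : nat -> C) :
  local_expansion g w0 a -> exists r, 0 < r /\
   forall h, Cmod h < r -> is_series (fun k => (a k * h ^ k)%C) (g (w0 + h)%C).
Proof.
  intros [r [hr [_ H]]]. exists r. split; [easy|]. intros h hh.
  specialize (H (w0 + h)%C).
  replace (w0 + h - w0)%C with h in H by ring. now apply H.
Qed.

(** The remainder of order 3 is at most B |h|^3, which is below eta |h|^2 once |h| <= eta / (B +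
    1). *)
Lemma analytic_upper_hol2 (g : C -> C) (w : C) :
  analytic_upper g -> upper w -> hol2 g w.
Proof.
  intros Hg hw. destruct (Hg w hw) as [a Ha].
  destruct (local_expansion_shift _ _ _ Ha) as [r [hr H]].
  destruct (power_series_remainder a (fun h => g (w + h)%C) r 3 hr H) as [B [d [hB [hd Hd]]]].
  assert (Hc : forall h, csum 3 (fun k => a k * h ^ k)%C = (a 0%nat + a 1%nat * h + a 2%nat * h ^ 2)%C)
    by (intros h; simpl; ring).
  assert (E0 : g w = a 0%nat).
  { specialize (Hd (RtoC 0) ltac:(rewrite Cmod_0; lra)). rewrite Hc, Cmod_0 in Hd.
    replace (w + 0)%C with w in Hd by ring.
    assert (Hz : (g w - (a 0%nat + a 1%nat * 0 + a 2%nat * 0 ^ 2))%C = 0%C).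
    { apply Cmod_eq_0. apply Rle_antisym; [|apply Cmod_ge_0].
      eapply Rle_trans; [exact Hd|]. simpl. lra. }
    replace (g w) with (g w - (a 0%nat + a 1%nat * 0 + a 2%nat * 0 ^ 2) + a 0%nat)%C by (simpl; ring).
    rewrite Hz. ring. }
  exists (a 1%nat), (a 2%nat). intros eta heta.
  exists (Rmin d (eta / (B + 1))). split.
  { apply Rmin_glb_lt; [lra|]. apply Rdiv_lt_0_compat; lra. }
  intros h hh. pose proof (Cmod_ge_0 h) as h0.
  specialize (Hd h ltac:(eapply Rlt_le_trans; [exact hh | apply Rmin_l])).
  rewrite Hc in Hd. rewrite E0.
  replace (g (w + h) - a 0%nat - a 1%nat * h - a 2%nat * h ^ 2)%C with
    (g (w + h) - (a 0%nat + a 1%nat * h + a 2%nat * h ^ 2))%C by ring.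
  eapply Rle_trans; [exact Hd|].
  assert (h1 : Cmod h <= eta / (B + 1)) by (left; eapply Rlt_le_trans; [exact hh | apply Rmin_r]).
  assert (h2 : Cmod h * (B + 1) <= eta).
  { apply Rmult_le_compat_r with (r := B + 1) in h1; [|lra].
    unfold Rdiv in h1. rewrite Rmult_assoc, Rinv_l in h1; lra. }
  assert (0 <= Cmod h ^ 2) by (apply pow_le; lra).
  replace (B * Cmod h ^ 3) with (B * Cmod h * Cmod h ^ 2) by ring.
  apply Rmult_le_compat_r; nra.
Qed.

(** The order of vanishing kept only as an upper bound: this suffices to cancel a logarithmic pole
    and passes through w |-> -1/w without power series. *)
Definition zero_bd (g : C -> C) (z : C) (m : nat) : Prop :=
  exists B, 0 <= B /\ near z (fun w => Cmod (g w) <= B * Cmod (w - z) ^ m).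

Lemma zero_order_zero_bd (g : C -> C) (z : C) (m : nat) :
  zero_order_ge g z m -> zero_bd g z m.
Proof.
  intros [_ [a [Ha H0]]].
  destruct (local_expansion_shift _ _ _ Ha) as [r [hr H]].
  destruct (power_series_remainder a (fun h => g (z + h)%C) r m hr H) as [B [d [hB [hd Hd]]]].
  exists B. split; [easy|]. exists d. split; [easy|]. intros w hw.
  specialize (Hd (w - z)%C hw). rewrite csum_zero in Hd.
  - replace (z + (w - z))%C with w in Hd by ring.
    replace (g w - 0)%C with (g w) in Hd by ring. exact Hd.
  - intros k hk. rewrite (H0 k hk). ring.
Qed.

(** * The four-point inequality *)

Lemma exp_le (x y : R) : x <= y -> exp x <= exp y.
Proof. intros [h| ->]; [left; now apply exp_increasing | apply Rle_refl]. Qed.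

Lemma ln_le_sub_1 (x : R) : 0 < x -> ln x <= x - 1.
Proof.
  intros hx. pose proof (exp_ineq1_le (ln x)) as H. rewrite exp_ln in H; lra.
Qed.

Lemma ln_ge_1_sub_inv (x : R) : 0 < x -> 1 - / x <= ln x.
Proof.
  intros hx. pose proof (ln_le_sub_1 (/ x) (Rinv_0_lt_compat _ hx)) as H.
  rewrite ln_Rinv in H; lra.
Qed.

Lemma Rabs_ln_Cmod_le (z : C) :
  Cmod (z - 1)%C <= / 2 -> Rabs (ln (Cmod z)) <= 2 * Cmod (z - 1)%C.
Proof.
  intros hu. set (u := Cmod (z - 1)%C) in *. pose proof (Cmod_ge_0 (z - 1)%C) as h0.
  fold u in h0.
  assert (h1 : Cmod z <= 1 + u).
  { replace z with (1 + (z - 1))%C at 1 by ring.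
    eapply Rle_trans; [apply Cmod_triangle|]. rewrite Cmod_1. unfold u; lra. }
  assert (h2 : 1 - u <= Cmod z).
  { pose proof (Cmod_triangle z (- (z - 1))%C) as H.
    replace (z + - (z - 1))%C with (RtoC 1) in H by ring.
    rewrite Cmod_1, Cmod_opp in H. unfold u; lra. }
  assert (hz : 0 < Cmod z) by lra.
  pose proof (ln_le_sub_1 _ hz). pose proof (ln_ge_1_sub_inv _ hz) as hl.
  assert (/ Cmod z <= 1 + 2 * u).
  { apply Rmult_le_reg_l with (Cmod z); [lra|]. rewrite Rinv_r; nra. }
  apply Rabs_le. lra.
Qed.

(** The five-point discrete Laplacian times r^2: for smooth [L] it equals r^2 times the Laplacian,
    up to o(r^2). *)
Definition four (L : C -> R) (w : C) (r : R) : R :=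
  L (w + RtoC r)%C + L (w + - RtoC r)%C + L (w + Ci * RtoC r)%C
  + L (w + - (Ci * RtoC r))%C - 4 * L w.

(* A four-point substitute for "the Laplacian of [L] at [w] is at least [lam]". *)
Definition sub4 (L : C -> R) (w : C) (lam : R) : Prop :=
  forall eta, 0 < eta -> exists d, 0 < d /\
    forall r, 0 < r < d -> (lam - eta) * r ^ 2 <= four L w r.

Lemma sub4_plus (L1 L2 : C -> R) (w : C) (l1 l2 : R) :
  sub4 L1 w l1 -> sub4 L2 w l2 -> sub4 (fun z => L1 z + L2 z) w (l1 + l2).
Proof.
  intros H1 H2 eta he.
  destruct (H1 (eta / 2) ltac:(lra)) as [d1 [hd1 K1]].
  destruct (H2 (eta / 2) ltac:(lra)) as [d2 [hd2 K2]].
  exists (Rmin d1 d2). split; [now apply Rmin_glb_lt|].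
  intros r hr. pose proof (Rmin_l d1 d2). pose proof (Rmin_r d1 d2).
  specialize (K1 r ltac:(lra)). specialize (K2 r ltac:(lra)).
  unfold four in *. lra.
Qed.

Lemma sub4_scal (L : C -> R) (w : C) (l c : R) :
  0 <= c -> sub4 L w l -> sub4 (fun z => c * L z) w (c * l).
Proof.
  intros hc H eta he.
  destruct (H (eta / (c + 1)) ltac:(apply Rdiv_lt_0_compat; lra)) as [d [hd K]].
  exists d. split; [easy|]. intros r hr. specialize (K r hr).
  assert (c * (eta / (c + 1)) <= eta).
  { apply Rmult_le_reg_r with (c + 1); [lra|]. unfold Rdiv.
    replace (c * (eta * / (c + 1)) * (c + 1)) with (c * eta) by (field; lra). nra. }
  assert (0 <= r ^ 2) by nra.
  apply Rmult_le_compat_l with (r := c) in K; [|lra].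
  unfold four in *. nra.
Qed.

Lemma sub4_ext (L1 L2 : C -> R) (w : C) (l : R) :
  (forall z, L1 z = L2 z) -> sub4 L1 w l -> sub4 L2 w l.
Proof.
  intros E H eta he. destruct (H eta he) as [d [hd K]]. exists d. split; [easy|].
  intros r hr. specialize (K r hr). unfold four in *. rewrite <- !E. exact K.
Qed.

Lemma Cmod_three_le (a b c : C) : Cmod (a + b + c)%C <= Cmod a + Cmod b + Cmod c.
Proof.
  eapply Rle_trans; [apply Cmod_triangle|].
  pose proof (Cmod_triangle a b). lra.
Qed.

(** Multiplying the values at h and -h removes the odd term and leaves (2 c2 - c1^2) h^2. The
    constant 6 is 1 for c2^2 h^4, 2 + 2 for each error times the other factor, and 1 for the product
    of the errors. *)
Lemma hol2_pair (c1 c2 h e1 e2 : C) (eta : R) :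
  let r := Cmod h in
  r <= 1 -> 0 <= eta <= 1 -> Cmod c1 * r + Cmod c2 * r ^ 2 <= 1 ->
  Cmod c2 ^ 2 * r ^ 2 <= eta ->
  Cmod e1 <= eta * r ^ 2 -> Cmod e2 <= eta * r ^ 2 ->
  exists e : C, Cmod e <= 6 * eta * r ^ 2 /\
   ((1 + c1 * h + c2 * h ^ 2 + e1) * (1 + c1 * (- h) + c2 * (- h) ^ 2 + e2)
     = 1 + (2 * c2 - c1 ^ 2) * h ^ 2 + e)%C.
Proof.
  intros r hr he hP h2 k1 k2.
  pose proof (Cmod_ge_0 h) as h0. fold r in h0.
  exists (c2 ^ 2 * h ^ 4 + (e1 * (1 + c1 * (- h) + c2 * (- h) ^ 2) + (1 + c1 * h + c2 * h ^ 2) * e2) + e1 * e2)%C.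
  split; [|simpl; ring].
  assert (hP1 : Cmod (1 + c1 * h + c2 * h ^ 2)%C <= 2).
  { eapply Rle_trans; [apply Cmod_three_le|].
    rewrite Cmod_1, !Cmod_mult, Cmod_pow. fold r. lra. }
  assert (hP2 : Cmod (1 + c1 * (- h) + c2 * (- h) ^ 2)%C <= 2).
  { eapply Rle_trans; [apply Cmod_three_le|].
    rewrite Cmod_1, !Cmod_mult, Cmod_pow, Cmod_opp. fold r. lra. }
  eapply Rle_trans; [apply Cmod_three_le|].
  pose proof (Cmod_triangle (e1 * (1 + c1 * (- h) + c2 * (- h) ^ 2))%C ((1 + c1 * h + c2 * h ^ 2) * e2)%C) as hT.
  rewrite !Cmod_mult in hT. rewrite !Cmod_mult, !Cmod_pow. fold r.
  pose proof (Cmod_ge_0 e1). pose proof (Cmod_ge_0 e2).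
  assert (hr2 : 0 <= r ^ 2 <= 1) by nra.
  assert (Cmod e1 * Cmod (1 + c1 * - h + c2 * (- h) ^ 2) <= eta * r ^ 2 * 2)
    by (apply Rmult_le_compat; auto; apply Cmod_ge_0).
  assert (Cmod (1 + c1 * h + c2 * h ^ 2) * Cmod e2 <= 2 * (eta * r ^ 2))
    by (apply Rmult_le_compat; auto; apply Cmod_ge_0).
  assert (Cmod e1 * Cmod e2 <= (eta * r ^ 2) * 1) by (apply Rmult_le_compat; auto; nra).
  assert (Cmod c2 ^ 2 * r ^ 4 <= eta * r ^ 2).
  { replace (Cmod c2 ^ 2 * r ^ 4) with (Cmod c2 ^ 2 * r ^ 2 * r ^ 2) by ring.
    apply Rmult_le_compat_r; lra. }
  lra.
Qed.

(** Harmonicity of ln|g|: the sum of four logarithms is the logarithm of one product. The pair at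
    +-r contributes 1 + u and the pair at +-ir contributes 1 - u, so the second-order terms cancel
    and 1 - u^2 remains, with u^2 of order r^4. *)
Lemma hol2_four_bound (g : C -> C) (w : C) :
  hol2 g w -> g w <> 0%C -> forall eta, 0 < eta -> exists d, 0 < d /\
    forall r, 0 < r < d -> Rabs (four (fun z => ln (Cmod (g z))) w r) <= eta * r ^ 2.
Proof.
  intros [b1 [b2 Hg]] hg eta heta.
  set (g0 := g w) in *. assert (hg0 : 0 < Cmod g0) by now apply Cmod_gt_0.
  set (c1 := (b1 / g0)%C). set (c2 := (b2 / g0)%C). set (d2 := (2 * c2 - c1 ^ 2)%C).
  (* The errors below add up to at most 30 e r^2 and passing to [ln] doubles this; 60 e <= eta then
     suffices. *)
  set (e := Rmin 1 (eta / 100)).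
  assert (he : 0 < e <= 1 /\ e <= eta / 100).
  { unfold e. split; [split|]; [apply Rmin_glb_lt; lra | apply Rmin_l | apply Rmin_r]. }
  destruct (Hg (e * Cmod g0) ltac:(apply Rmult_lt_0_compat; lra)) as [d [hd Hd]].
  set (M := 2 + Cmod c1 + Cmod c2 + Cmod c2 ^ 2 + Cmod d2 + Cmod d2 ^ 2).
  pose proof (Cmod_ge_0 c1) as q1. pose proof (Cmod_ge_0 c2) as q2. pose proof (Cmod_ge_0 d2) as q3.
  assert (hM : 1 < M) by (unfold M; nra).
  exists (Rmin d (e / (100 * M))). split.
  { apply Rmin_glb_lt; [lra|]. apply Rdiv_lt_0_compat; nra. }
  intros r [hr0 hr].
  assert (hrd : r < d) by (eapply Rlt_le_trans; [exact hr | apply Rmin_l]).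
  assert (hrM : 100 * (M * r) <= e).
  { assert (h1 : r <= e / (100 * M)) by (left; eapply Rlt_le_trans; [exact hr | apply Rmin_r]).
    apply Rmult_le_compat_r with (r := 100 * M) in h1; [|nra].
    unfold Rdiv in h1. rewrite Rmult_assoc, Rinv_l in h1; nra. }
  assert (hr1 : r <= / 100) by nra.
  assert (HG : forall h, Cmod h = r -> exists p : C, Cmod p <= e * r ^ 2 /\
       (g (w + h) = g0 * (1 + c1 * h + c2 * h ^ 2 + p))%C).
  { intros h hh. exists ((g (w + h) - g0 - b1 * h - b2 * h ^ 2) / g0)%C. split.
    - rewrite Cmod_div by exact hg.
      specialize (Hd h ltac:(lra)). rewrite hh in Hd.
      apply Rmult_le_reg_r with (Cmod g0); [lra|].
      unfold Rdiv. rewrite Rmult_assoc, Rinv_l by lra. lra.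
    - unfold c1, c2. field. exact hg. }
  assert (hc1 : Cmod c1 * r + Cmod c2 * r ^ 2 <= 1).
  { assert (Cmod c1 * r <= M * r) by (apply Rmult_le_compat_r; unfold M; nra).
    assert (Cmod c2 * r <= M * r) by (apply Rmult_le_compat_r; unfold M; nra).
    nra. }
  assert (hc2 : Cmod c2 ^ 2 * r ^ 2 <= e).
  { assert (Cmod c2 ^ 2 * r <= M * r) by (apply Rmult_le_compat_r; unfold M; nra). nra. }
  assert (hm1 : Cmod (RtoC r) = r) by (rewrite Cmod_R, Rabs_pos_eq; lra).
  assert (hm3 : Cmod (Ci * RtoC r) = r) by (rewrite Cmod_mult, Cmod_Ci, hm1; ring).
  destruct (HG (RtoC r) hm1) as [p1 [hp1 E1]].
  destruct (HG (- RtoC r)%C ltac:(now rewrite Cmod_opp)) as [p2 [hp2 E2]].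
  destruct (HG (Ci * RtoC r)%C hm3) as [p3 [hp3 E3]].
  destruct (HG (- (Ci * RtoC r))%C ltac:(now rewrite Cmod_opp)) as [p4 [hp4 E4]].
  destruct (hol2_pair c1 c2 (RtoC r) p1 p2 e) as [ea [hea Ea]]; rewrite ?hm1; try lra.
  destruct (hol2_pair c1 c2 (Ci * RtoC r)%C p3 p4 e) as [eb [heb Eb]]; rewrite ?hm3; try lra.
  rewrite hm1 in hea. rewrite hm3 in heb. fold d2 in Ea, Eb.
  set (P1 := (1 + c1 * RtoC r + c2 * RtoC r ^ 2 + p1)%C) in *.
  set (P2 := (1 + c1 * - RtoC r + c2 * (- RtoC r) ^ 2 + p2)%C) in *.
  set (P3 := (1 + c1 * (Ci * RtoC r) + c2 * (Ci * RtoC r) ^ 2 + p3)%C) in *.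
  set (P4 := (1 + c1 * - (Ci * RtoC r) + c2 * (- (Ci * RtoC r)) ^ 2 + p4)%C) in *.
  assert (hci : (Ci * Ci = - (1))%C) by (unfold Ci, Cmult, Copp; simpl; f_equal; ring).
  set (u := (d2 * RtoC r ^ 2)%C).
  (* (i r)^2 = -r^2 reverses the sign of the quadratic term. *)
  assert (Eb' : (P3 * P4 = 1 - u + eb)%C).
  { rewrite Eb. unfold u. simpl.
    replace (d2 * (Ci * r * (Ci * r * 1)))%C with (d2 * ((Ci * Ci) * (r * r)))%C by ring.
    rewrite hci. ring. }
  assert (Eall : ((P1 * P2) * (P3 * P4) - 1 = - (u * u) + (ea * (1 - u) + (1 + u) * eb) + ea * eb)%C).
  { rewrite Ea, Eb'. fold u. ring. }
  assert (hu : Cmod u <= / 2 /\ Cmod u * Cmod u <= e * r ^ 2).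
  { unfold u. rewrite Cmod_mult, Cmod_pow, hm1.
    assert (Cmod d2 * r <= M * r) by (apply Rmult_le_compat_r; unfold M; nra).
    assert (hdd : Cmod d2 ^ 2 * r <= M * r) by (apply Rmult_le_compat_r; unfold M; nra).
    split; [nra|].
    replace (Cmod d2 * r ^ 2 * (Cmod d2 * r ^ 2)) with ((Cmod d2 ^ 2 * r) * r * r ^ 2) by ring.
    apply Rmult_le_compat_r; [nra|]. nra. }
  destruct hu as [hu1 hu2].
  assert (h1u : Cmod (1 - u)%C <= 2).
  { eapply Rle_trans; [apply (Cmod_triangle 1 (- u))|]. rewrite Cmod_opp, Cmod_1. lra. }
  assert (h1u' : Cmod (1 + u)%C <= 2).
  { eapply Rle_trans; [apply Cmod_triangle|]. rewrite Cmod_1. lra. }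
  assert (hr2 : 0 < r ^ 2 <= / 10000) by nra.
  pose proof (Cmod_ge_0 ea) as qa. pose proof (Cmod_ge_0 eb) as qb.
  assert (hAll : Cmod ((P1 * P2) * (P3 * P4) - 1)%C <= 30 * e * r ^ 2).
  { rewrite Eall. eapply Rle_trans; [apply Cmod_three_le|].
    pose proof (Cmod_triangle (ea * (1 - u))%C ((1 + u) * eb)%C) as hT.
    rewrite !Cmod_mult in hT. rewrite Cmod_opp, !Cmod_mult.
    assert (Cmod ea * Cmod (1 - u) <= 6 * e * r ^ 2 * 2) by (apply Rmult_le_compat; auto; apply Cmod_ge_0).
    assert (Cmod (1 + u) * Cmod eb <= 2 * (6 * e * r ^ 2)) by (apply Rmult_le_compat; auto; apply Cmod_ge_0).
    assert (Cmod ea * Cmod eb <= 6 * e * r ^ 2 * (1 / 10)) by (apply Rmult_le_compat; auto; nra).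
    nra. }
  assert (hprod : Cmod (P1 * P2 * (P3 * P4))%C <> 0 /\
     Rabs (ln (Cmod (P1 * P2 * (P3 * P4))%C)) <= 60 * e * r ^ 2).
  { assert (hs : Cmod ((P1 * P2) * (P3 * P4) - 1)%C <= / 2) by nra.
    split.
    - intros E. apply Cmod_eq_0 in E. rewrite E in hs.
      replace (0 - 1)%C with (- (1))%C in hs by ring. rewrite Cmod_opp, Cmod_1 in hs. lra.
    - eapply Rle_trans; [now apply Rabs_ln_Cmod_le|]. lra. }
  destruct hprod as [hne hln].
  rewrite !Cmod_mult in hne.
  assert (n1 : 0 < Cmod P1). { destruct (Cmod_ge_0 P1) as [|z]; [easy|]. rewrite <- z in hne. exfalso; apply hne; ring. }
  assert (n2 : 0 < Cmod P2). { destruct (Cmod_ge_0 P2) as [|z]; [easy|]. rewrite <- z in hne. exfalso; apply hne; ring. }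
  assert (n3 : 0 < Cmod P3). { destruct (Cmod_ge_0 P3) as [|z]; [easy|]. rewrite <- z in hne. exfalso; apply hne; ring. }
  assert (n4 : 0 < Cmod P4). { destruct (Cmod_ge_0 P4) as [|z]; [easy|]. rewrite <- z in hne. exfalso; apply hne; ring. }
  rewrite !Cmod_mult, !ln_mult in hln by (repeat apply Rmult_lt_0_compat; auto).
  unfold four. rewrite E1, E2, E3, E4. fold g0. rewrite !Cmod_mult, !ln_mult by auto.
  replace (_ - 4 * ln (Cmod g0)) with (ln (Cmod P1) + ln (Cmod P2) + (ln (Cmod P3) + ln (Cmod P4))) by ring.
  eapply Rle_trans; [exact hln|]. apply Rmult_le_compat_r; lra.
Qed.

(** The bound behind it is two-sided, so [c] may have either sign; the poles of the Green functions
    enter with a negative one. *)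
Lemma sub4_ln_Cmod (g : C -> C) (w : C) (c : R) :
  hol2 g w -> g w <> 0%C -> sub4 (fun z => c * ln (Cmod (g z))) w 0.
Proof.
  intros H hg eta he.
  pose proof (Rabs_pos c) as hc.
  destruct (hol2_four_bound g w H hg (eta / (Rabs c + 1)) ltac:(apply Rdiv_lt_0_compat; lra)) as [d [hd K]].
  exists d. split; [easy|]. intros r hr. specialize (K r hr).
  replace (four (fun z => c * ln (Cmod (g z))) w r) with (c * four (fun z => ln (Cmod (g z))) w r)
    by (unfold four; ring).
  assert (hE : Rabs (c * four (fun z => ln (Cmod (g z))) w r) <= eta * r ^ 2).
  { rewrite Rabs_mult. assert (0 < r ^ 2) by nra.
    eapply Rle_trans; [apply Rmult_le_compat_l; [lra | exact K]|].
    rewrite <- Rmult_assoc. apply Rmult_le_compat_r; [lra|].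
    apply Rmult_le_reg_r with (Rabs c + 1); [lra|]. unfold Rdiv.
    replace (Rabs c * (eta * / (Rabs c + 1)) * (Rabs c + 1)) with (Rabs c * eta) by (field; lra). nra. }
  apply Rabs_le_between in hE. lra.
Qed.

Lemma hol2_sub_const (p w : C) : hol2 (fun z => (z - p)%C) w.
Proof.
  exists 1%C, 0%C. intros eta he. exists 1. split; [lra|]. intros h _.
  replace (_ - _ - _ - _)%C with (RtoC 0) by ring. rewrite Cmod_0.
  pose proof (Cmod_ge_0 h). nra.
Qed.

Lemma hol2_cont (g : C -> C) (w : C) :
  hol2 g w -> forall eta, 0 < eta -> near w (fun z => Cmod (g z - g w)%C < eta).
Proof.
  intros [c1 [c2 H]] eta he. destruct (H 1 ltac:(lra)) as [d [hd K]].
  pose proof (Cmod_ge_0 c1). pose proof (Cmod_ge_0 c2).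
  set (M := Cmod c1 + Cmod c2 + 2).
  exists (Rmin (Rmin d 1) (eta / M)). unfold M in *. split.
  { repeat apply Rmin_glb_lt; try lra. apply Rdiv_lt_0_compat; lra. }
  intros z hz. set (h := (z - w)%C) in *.
  assert (h1 : Cmod h < d) by (eapply Rlt_le_trans; [exact hz|]; eapply Rle_trans; [apply Rmin_l|apply Rmin_l]).
  assert (h2 : Cmod h < 1) by (eapply Rlt_le_trans; [exact hz|]; eapply Rle_trans; [apply Rmin_l|apply Rmin_r]).
  assert (h3 : Cmod h < eta / (Cmod c1 + Cmod c2 + 2)) by (eapply Rlt_le_trans; [exact hz|apply Rmin_r]).
  assert (h4 : Cmod h * (Cmod c1 + Cmod c2 + 2) < eta).
  { apply Rmult_lt_compat_r with (r := Cmod c1 + Cmod c2 + 2) in h3; [|lra].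
    unfold Rdiv in h3. rewrite Rmult_assoc, Rinv_l in h3; lra. }
  specialize (K h h1). replace (w + h)%C with z in K by (unfold h; ring).
  replace (g z - g w)%C with ((g z - g w - c1 * h - c2 * h ^ 2) + c1 * h + c2 * h ^ 2)%C by ring.
  eapply Rle_lt_trans; [apply Cmod_three_le|]. rewrite !Cmod_mult, Cmod_pow.
  pose proof (Cmod_ge_0 h). assert (Cmod h ^ 2 <= Cmod h) by nra.
  assert (Cmod c2 * Cmod h ^ 2 <= Cmod c2 * Cmod h) by (apply Rmult_le_compat_l; lra). nra.
Qed.

Lemma hol2_nonzero_near (g : C -> C) (w : C) :
  hol2 g w -> g w <> 0%C -> near w (fun z => g z <> 0%C).
Proof.
  intros H hg. assert (h0 : 0 < Cmod (g w)) by now apply Cmod_gt_0.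
  apply near_imp with (2 := hol2_cont g w H _ h0). intros z hz E.
  rewrite E in hz. replace (0 - g w)%C with (- g w)%C in hz by ring.
  rewrite Cmod_opp in hz. lra.
Qed.

(** * A strictly superharmonic function *)

(** The mean value theorem is applied to s |-> f(a+s) + f(a-s) - l s^2, whose derivative f'(a+s) -
    f'(a-s) - 2 l s is at most eta s in modulus because f' is differentiable at a. No second
    derivative away from a is involved. *)
Lemma second_difference (f f' : R -> R) (a l rho : R) :
  0 < rho -> (forall x, Rabs (x - a) < rho -> is_derive f x (f' x)) ->
  is_derive f' a l ->
  forall eta, 0 < eta -> exists d, 0 < d /\
   forall r, 0 < r < d -> Rabs (f (a + r) + f (a - r) - 2 * f a - l * r ^ 2) <= eta * r ^ 2.
Proof.
  intros hrho Hf Hf' eta he.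
  destruct Hf' as [_ Hf'].
  specialize (Hf' a (fun P h => h) (mkposreal (eta / 2) ltac:(lra))).
  destruct Hf' as [d Hd].
  exists (Rmin d rho). split; [apply Rmin_glb_lt; [apply cond_pos|lra]|].
  intros r [hr0 hr].
  assert (hrd : r < d) by (eapply Rlt_le_trans; [exact hr | apply Rmin_l]).
  assert (hrr : r < rho) by (eapply Rlt_le_trans; [exact hr | apply Rmin_r]).
  assert (Hb : forall s, Rabs s <= r -> Rabs (f' (a + s) - f' a - s * l) <= eta / 2 * Rabs s).
  { intros s hs. specialize (Hd (a + s)).
    assert (hball : ball a d (a + s)).
    { change (Rabs ((a + s) - a) < d). replace (a + s - a) with s by ring. lra. }
    specialize (Hd hball). simpl in Hd.
    change (Rabs ((f' (a + s) - f' a) - (a + s - a) * l) <= eta / 2 * Rabs (a + s - a)) in Hd.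
    replace (a + s - a) with s in Hd by ring. exact Hd. }
  destruct (MVT_gen (fun s => f (a + s) + f (a - s) - l * s ^ 2) 0 r
     (fun s => f' (a + s) - f' (a - s) - l * (2 * s))) as [s [hs E]].
  - intros s hs. rewrite Rmin_left, Rmax_right in hs by lra.
    assert (D1 : is_derive f (a + s) (f' (a + s))) by (apply Hf; rewrite Rabs_pos_eq; lra).
    assert (D2 : is_derive f (a - s) (f' (a - s))).
    { apply Hf. replace (a - s - a) with (- s) by ring. rewrite Rabs_Ropp, Rabs_pos_eq; lra. }
    auto_derive.
    + split; [eexists; exact D1|]. split; [eexists; exact D2|]. easy.
    + replace (a + - s) with (a - s) by ring.
      rewrite (is_derive_unique (fun x : R => f x) _ _ D1), (is_derive_unique (fun x : R => f x) _ _ D2). ring.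
  - intros s hs. rewrite Rmin_left, Rmax_right in hs by lra.
    apply continuity_pt_filterlim.
    apply (ex_derive_continuous (fun s => f (a + s) + f (a - s) - l * s ^ 2)).
    assert (D1 : is_derive f (a + s) (f' (a + s))) by (apply Hf; rewrite Rabs_pos_eq; lra).
    assert (D2 : is_derive f (a - s) (f' (a - s))).
    { apply Hf. replace (a - s - a) with (- s) by ring. rewrite Rabs_Ropp, Rabs_pos_eq; lra. }
    auto_derive. split; [eexists; exact D1|]. split; [eexists; exact D2|]. easy.
  - rewrite Rmin_left, Rmax_right in hs by lra.
    replace (f (a + r) + f (a - r) - 2 * f a - l * r ^ 2) with
      (f (a + r) + f (a - r) - l * r ^ 2 - (f (a + 0) + f (a - 0) - l * 0 ^ 2))
      by (rewrite Rplus_0_r, Rminus_0_r; ring).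
    rewrite E.
    pose proof (Hb s ltac:(rewrite Rabs_pos_eq; lra)) as B1.
    pose proof (Hb (- s) ltac:(rewrite Rabs_Ropp, Rabs_pos_eq; lra)) as B2.
    rewrite Rabs_Ropp in B2. rewrite (Rabs_pos_eq s) in B1, B2 by lra.
    replace (a + - s) with (a - s) in B2 by ring.
    apply Rabs_le_between in B1. apply Rabs_le_between in B2.
    rewrite Rabs_mult, (Rabs_pos_eq (r - 0)) by lra.
    assert (B3 : Rabs (f' (a + s) - f' (a - s) - l * (2 * s)) <= eta * r).
    { apply Rabs_le. nra. }
    nra.
Qed.

(** This is |z - x0|^(2q), written through a polynomial in the coordinates so that [auto_derive]
    applies. *)
Definition powS (x0 q : R) (z : C) : R :=
  exp (q * ln ((fst z - x0) ^ 2 + (snd z) ^ 2)).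

Definition quadP (al be de y : R) : R := al + be * y + de * y ^ 2.

(** Two-sided companion of [sub4] for explicit functions, so that it survives the change of sign
    from V to -V. *)
Definition lap4 (L : C -> R) (w : C) (lam : R) : Prop :=
  forall eta, 0 < eta -> exists d, 0 < d /\
    forall r, 0 < r < d -> Rabs (four L w r - lam * r ^ 2) <= eta * r ^ 2.

Lemma four_coord (L : C -> R) (w : C) (r : R) :
  four L w r = L (fst w + r, snd w) + L (fst w - r, snd w)
    + L (fst w, snd w + r) + L (fst w, snd w - r) - 4 * L (fst w, snd w).
Proof.
  unfold four. destruct w as [x y].
  replace ((x, y) + RtoC r)%C with (x + r, y) by (apply injective_projections; simpl; ring).
  replace ((x, y) + - RtoC r)%C with (x - r, y) by (apply injective_projections; simpl; ring).
  replace ((x, y) + Ci * RtoC r)%C with (x, y + r) by (apply injective_projections; simpl; ring).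
  replace ((x, y) + - (Ci * RtoC r))%C with (x, y - r) by (apply injective_projections; simpl; ring).
  reflexivity.
Qed.

(** Refolds the sums of squares that [auto_derive] leaves expanded, so that a single denominator
    remains for [field]. *)
Ltac norm_sq p q :=
  repeat match goal with |- context [?e] =>
    match type of e with R =>
      match e with ?a * ?b + ?c * ?d =>
        progress replace (a * b + c * d) with (p ^ 2 + q ^ 2) by ring end end end.

(** Leibniz rule for P(y) T with T = Sq^q: the Laplacian is P'' T + 2 P' T_y + P (T_xx + T_yy),
    where T_y = 2 q y T / Sq and T_xx + T_yy = 4 q^2 T / Sq. *)
Lemma lap4_quadP_powS (x0 q al be de : R) (w : C) :
  0 < snd w ->
  let T := powS x0 q w in
  let Sq := (fst w - x0) ^ 2 + (snd w) ^ 2 in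
  let y := snd w in
  lap4 (fun z => quadP al be de (snd z) * powS x0 q z) w
   (2 * de * T + 4 * q * (be + 2 * de * y) * y * T / Sq + 4 * q ^ 2 * quadP al be de y * T / Sq).
Proof.
  destruct w as [x y]. intros hy T Sq yy eta he. cbn [fst snd] in hy.
  assert (ET : T = exp (q * ln ((x - x0) ^ 2 + y ^ 2))) by reflexivity.
  assert (ES : Sq = (x - x0) ^ 2 + y ^ 2) by reflexivity.
  assert (EY : yy = y) by reflexivity. clearbody T Sq yy. subst T Sq yy.
  set (Sq := (x - x0) ^ 2 + y ^ 2) in *. set (T := exp (q * ln Sq)) in *.
  assert (hpos : forall u, 0 < (u - x0) ^ 2 + y ^ 2) by
    (intros u; pose proof (pow2_ge_0 (u - x0)); pose proof (pow_lt y 2 hy); lra).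
  destruct (second_difference
    (fun u => quadP al be de y * exp (q * ln ((u - x0) ^ 2 + y ^ 2)))
    (fun u => quadP al be de y * (q * (2 * (u - x0)) / ((u - x0) ^ 2 + y ^ 2) * exp (q * ln ((u - x0) ^ 2 + y ^ 2))))
    x (quadP al be de y * (2 * q / Sq + 4 * q * (q - 1) * (x - x0) ^ 2 / Sq ^ 2) * T) 1 ltac:(lra)) with (eta := eta / 2)
    as [d1 [hd1 K1]].
  - intros u _. specialize (hpos u). auto_derive; [simpl in hpos; lra|].
    norm_sq (u - x0) y. field. lra.
  - specialize (hpos x). auto_derive.
    + assert (hs := hpos). simpl in hs. repeat split; lra.
    + norm_sq (x - x0) y. fold Sq. fold T. change (0 < Sq) in hpos. field. lra.
  - lra.
  - assert (hpos2 : forall v, Rabs (v - y) < y -> 0 < (x - x0) ^ 2 + v ^ 2).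
    { intros v hv. apply Rabs_def2 in hv.
      pose proof (pow2_ge_0 (x - x0)). assert (hv0 : 0 < v) by lra. pose proof (pow_lt v 2 hv0). lra. }
    destruct (second_difference
    (fun v => quadP al be de v * exp (q * ln ((x - x0) ^ 2 + v ^ 2)))
    (fun v => (be + 2 * de * v) * exp (q * ln ((x - x0) ^ 2 + v ^ 2)) +
      quadP al be de v * (q * (2 * v) / ((x - x0) ^ 2 + v ^ 2) * exp (q * ln ((x - x0) ^ 2 + v ^ 2))))
    y (2 * de * T + 2 * (be + 2 * de * y) * (2 * q * y / Sq) * T +
       quadP al be de y * (2 * q / Sq + 4 * q * (q - 1) * y ^ 2 / Sq ^ 2) * T) y ltac:(lra)) with (eta := eta / 2)
    as [d2 [hd2 K2]].
    + intros v hv. specialize (hpos2 v hv). unfold quadP. auto_derive; [simpl in hpos2; lra|].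
      norm_sq (x - x0) v. field. lra.
    + specialize (hpos x). unfold quadP. auto_derive.
      * assert (hs := hpos). simpl in hs. repeat split; lra.
      * norm_sq (x - x0) y. fold Sq. fold T. change (0 < Sq) in hpos. field. lra.
    + lra.
    + exists (Rmin d1 d2). split; [now apply Rmin_glb_lt|]. intros r hr.
      pose proof (Rmin_l d1 d2). pose proof (Rmin_r d1 d2).
      specialize (K1 r ltac:(lra)). specialize (K2 r ltac:(lra)).
      rewrite four_coord. unfold powS. simpl fst; simpl snd. simpl fst in *; simpl snd in *.
      apply Rabs_le_between in K1. apply Rabs_le_between in K2. apply Rabs_le.
      assert (E : (2 * de * T + 4 * q * (be + 2 * de * y) * y * T / Sq + 4 * q ^ 2 * quadP al be de y * T / Sq)
        = (quadP al be de y * (2 * q / Sq + 4 * q * (q - 1) * (x - x0) ^ 2 / Sq ^ 2) * T)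
        + (2 * de * T + 2 * (be + 2 * de * y) * (2 * q * y / Sq) * T +
       quadP al be de y * (2 * q / Sq + 4 * q * (q - 1) * y ^ 2 / Sq ^ 2) * T)).
      { specialize (hpos x). unfold Sq. field. lra. }
      rewrite E. lra.
Qed.

Lemma lap4_plus (L1 L2 : C -> R) (w : C) (l1 l2 : R) :
  lap4 L1 w l1 -> lap4 L2 w l2 -> lap4 (fun z => L1 z + L2 z) w (l1 + l2).
Proof.
  intros H1 H2 eta he.
  destruct (H1 (eta / 2) ltac:(lra)) as [d1 [hd1 K1]].
  destruct (H2 (eta / 2) ltac:(lra)) as [d2 [hd2 K2]].
  exists (Rmin d1 d2). split; [now apply Rmin_glb_lt|].
  intros r hr. pose proof (Rmin_l d1 d2). pose proof (Rmin_r d1 d2).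
  specialize (K1 r ltac:(lra)). specialize (K2 r ltac:(lra)).
  apply Rabs_le_between in K1. apply Rabs_le_between in K2. apply Rabs_le.
  unfold four in *. lra.
Qed.

(** Chosen so that b (1 - gam^2) = 4 - gam^2. With u = sin(theta), minus the Laplacian of V is
    r^(-gam-2) times 2 - gam^2 + b (1 - gam^2) u - (4 - gam^2) u^2, and the last two terms then
    combine to (4 - gam^2)(u - u^2) >= 0. *)
Definition bgam (gam : R) : R := (4 - gam ^ 2) / (1 - gam ^ 2).

(* In polar coordinates about [x0] this is
   [r^-gam (1 + b sin(theta) - sin(theta)^2)], strictly superharmonic and of size [r^-gam]. *)
Definition Vpot (x0 gam : R) (z : C) : R :=
  (quadP 1 0 0 (snd z) * powS x0 (- gam / 2) z
   + quadP 0 (bgam gam) 0 (snd z) * powS x0 (- gam / 2 - / 2) z)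
   + quadP 0 0 (-1) (snd z) * powS x0 (- gam / 2 - 1) z.

Lemma Cmod_sub_R_sqr (z : C) (x0 : R) :
  Cmod (z - RtoC x0)%C ^ 2 = (fst z - x0) ^ 2 + (snd z) ^ 2.
Proof.
  destruct z as [x y]. unfold Cmod. rewrite pow2_sqrt; [simpl; ring|].
  apply Rplus_le_le_0_compat; apply pow2_ge_0.
Qed.

Lemma Im_le_dist (z : C) (x0 : R) : 0 < snd z -> snd z <= Cmod (z - RtoC x0)%C.
Proof.
  intros hy. pose proof (Cmod_ge_0 (z - RtoC x0)%C). pose proof (Cmod_sub_R_sqr z x0).
  pose proof (pow2_ge_0 (fst z - x0)). apply Rnot_lt_le. intros hc. nra.
Qed.

Lemma dist_R_pos (z : C) (x0 : R) : 0 < snd z -> 0 < Cmod (z - RtoC x0)%C.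
Proof. intros hy. pose proof (Im_le_dist z x0 hy). lra. Qed.

Lemma powS_Rpower (x0 q : R) (z : C) :
  0 < snd z -> powS x0 q z = Rpower (Cmod (z - RtoC x0)%C) (2 * q).
Proof.
  intros hy. pose proof (dist_R_pos z x0 hy) as hr.
  unfold powS, Rpower. rewrite <- Cmod_sub_R_sqr. f_equal.
  replace (Cmod (z - RtoC x0)%C ^ 2) with (Cmod (z - RtoC x0)%C * Cmod (z - RtoC x0)%C) by ring.
  rewrite ln_mult by lra. ring.
Qed.

Lemma Rpower_div1 (r q : R) : 0 < r -> Rpower r (q - 1) = Rpower r q / r.
Proof.
  intros hr. unfold Rminus. rewrite Rpower_plus, Rpower_Ropp, Rpower_1; [reflexivity|easy].
Qed.

Lemma Vpot_polar (x0 gam : R) (z : C) : 0 < snd z ->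
  let r := Cmod (z - RtoC x0)%C in
  Vpot x0 gam z = Rpower r (- gam) * (1 + bgam gam * (snd z / r) - (snd z / r) ^ 2).
Proof.
  intros hy r. pose proof (dist_R_pos z x0 hy) as hr. fold r in hr.
  unfold Vpot. rewrite !powS_Rpower by easy. fold r.
  replace (2 * (- gam / 2)) with (- gam) by field.
  replace (2 * (- gam / 2 - / 2)) with (- gam - 1) by field.
  replace (2 * (- gam / 2 - 1)) with (- gam - 1 - 1) by field.
  rewrite !Rpower_div1 by easy. unfold quadP. field. lra.
Qed.

Lemma bgam_bounds (gam : R) : 0 < gam < 1 -> 4 <= bgam gam /\ bgam gam * (1 - gam ^ 2) = 4 - gam ^ 2.
Proof.
  intros hg. unfold bgam. assert (0 < 1 - gam ^ 2) by nra. split; [|field; lra].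
  apply Rmult_le_reg_r with (1 - gam ^ 2); [lra|].
  unfold Rdiv. rewrite Rmult_assoc, Rinv_l by lra. nra.
Qed.

Lemma Vpot_bounds (x0 gam : R) (z : C) : 0 < gam < 1 -> 0 < snd z ->
  let r := Cmod (z - RtoC x0)%C in
  Rpower r (- gam) <= Vpot x0 gam z <= (1 + bgam gam) * Rpower r (- gam).
Proof.
  intros hg hy r. pose proof (dist_R_pos z x0 hy) as hr. fold r in hr.
  rewrite Vpot_polar by easy. fold r.
  destruct (bgam_bounds gam hg) as [hb _].
  pose proof (Im_le_dist z x0 hy) as hyr. fold r in hyr.
  set (u := snd z / r). assert (hu : 0 < u <= 1).
  { unfold u. split; [now apply Rdiv_lt_0_compat|].
    apply Rmult_le_reg_r with r; [easy|]. unfold Rdiv. rewrite Rmult_assoc, Rinv_l; lra. }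
  assert (hp : 0 < Rpower r (- gam)) by apply exp_pos.
  assert (1 <= 1 + bgam gam * u - u ^ 2 <= 1 + bgam gam) by nra.
  nra.
Qed.

Lemma Vpot_strict (x0 gam : R) (w : C) : 0 < gam < 1 -> 0 < snd w ->
  exists lam, 0 < lam /\ lap4 (Vpot x0 gam) w (- lam).
Proof.
  intros hg hy. pose proof (dist_R_pos w x0 hy) as hr.
  set (r := Cmod (w - RtoC x0)%C) in *.
  destruct (bgam_bounds gam hg) as [hb hbe].
  pose proof (lap4_plus _ _ _ _ _ (lap4_plus _ _ _ _ _
    (lap4_quadP_powS x0 (- gam / 2) 1 0 0 w hy)
    (lap4_quadP_powS x0 (- gam / 2 - / 2) 0 (bgam gam) 0 w hy))
    (lap4_quadP_powS x0 (- gam / 2 - 1) 0 0 (-1) w hy)) as H.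
  match type of H with lap4 _ _ ?l => set (lam := - l) end.
  exists lam. split; [|unfold lam; rewrite Ropp_involutive; exact H].
  unfold lam. rewrite !powS_Rpower by easy. rewrite <- Cmod_sub_R_sqr. fold r.
  replace (2 * (- gam / 2)) with (- gam) by field.
  replace (2 * (- gam / 2 - / 2)) with (- gam - 1) by field.
  replace (2 * (- gam / 2 - 1)) with (- gam - 1 - 1) by field.
  rewrite !Rpower_div1 by easy. unfold quadP.
  pose proof (Im_le_dist w x0 hy) as hyr. fold r in hyr.
  assert (hp : 0 < Rpower r (- gam)) by apply exp_pos.
  set (P := Rpower r (- gam)) in *. set (u := snd w / r).
  assert (hu : 0 < u <= 1).
  { unfold u. split; [now apply Rdiv_lt_0_compat|].
    apply Rmult_le_reg_r with r; [easy|]. unfold Rdiv. rewrite Rmult_assoc, Rinv_l; lra. }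
  replace (snd w) with (u * r) by (unfold u; field; lra).
  (* The polar form of minus the Laplacian, with [u] the sine of the polar angle about [x0]. *)
  match goal with |- 0 < ?X => replace X with
    (P / r ^ 2 * (2 - gam ^ 2 + (bgam gam * (1 - gam ^ 2)) * u - (4 - gam ^ 2) * u ^ 2)) by (field; lra) end.
  rewrite hbe. apply Rmult_lt_0_compat; [apply Rdiv_lt_0_compat; [easy|nra]|]. nra.
Qed.

Lemma sub4_neg_Vpot (x0 gam : R) (w : C) : 0 < gam < 1 -> 0 < snd w ->
  exists lam, 0 < lam /\ sub4 (fun z => - Vpot x0 gam z) w lam.
Proof.
  intros hg hy. destruct (Vpot_strict x0 gam w hg hy) as [lam [hl H]].
  exists lam. split; [easy|]. intros eta he. destruct (H eta he) as [d [hd K]].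
  exists d. split; [easy|]. intros r hr. specialize (K r hr). apply Rabs_le_between in K.
  unfold four in *. lra.
Qed.

(** * Compactness and continuity *)

Definition in_rect (a1 b1 a2 b2 : R) (z : C) : Prop :=
  a1 <= fst z <= b1 /\ a2 <= snd z <= b2.

Lemma Cmod_le_abs (z : C) : Cmod z <= Rabs (fst z) + Rabs (snd z).
Proof.
  destruct z as [x y]. cbn [fst snd].
  replace (x, y) with (RtoC x + Ci * RtoC y)%C by (apply injective_projections; simpl; ring).
  eapply Rle_trans; [apply Cmod_triangle|]. rewrite Cmod_mult, Cmod_Ci, !Cmod_R. lra.
Qed.

Lemma rect_finite_cover (a1 b1 a2 b2 : R) (P : C -> C -> Prop) :
  (forall w, in_rect a1 b1 a2 b2 w -> near w (P w)) ->
  exists l : list C, (forall w, In w l -> in_rect a1 b1 a2 b2 w) /\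
    forall z, in_rect a1 b1 a2 b2 z -> exists w, In w l /\ P w z.
Proof.
  intros H.
  assert (Hd : forall w, exists d, 0 < d /\
     (in_rect a1 b1 a2 b2 w -> forall z, Cmod (z - w)%C < d -> P w z)).
  { intros w. destruct (classic (in_rect a1 b1 a2 b2 w)) as [hw|hw].
    - destruct (H w hw) as [d [hd K]]. exists d. auto.
    - exists 1. split; [lra|]. intros; contradiction. }
  destruct (choice _ Hd) as [d Hdd].
  (* The cover obtained below is by squares: both coordinates within d / 2 of the centre keep the
     modulus below d. *)
  assert (hd2 : forall w, 0 < d w / 2) by (intros w; destruct (Hdd w); lra).
  pose (cv := fun q : R * (R * unit) => (fst q, fst (snd q)) : C).
  destruct (NNPP _ (compactness_list 2 (a1, (a2, tt)) (b1, (b2, tt))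
     (fun q => mkposreal _ (hd2 (cv q))))) as [l Hl].
  exists (filter (fun w => if excluded_middle_informative (in_rect a1 b1 a2 b2 w) then true else false)
             (map cv l)).
  split.
  - intros w hw. apply filter_In in hw. destruct hw as [_ hw].
    destruct (excluded_middle_informative (in_rect a1 b1 a2 b2 w)); [easy|discriminate].
  - intros [x y] [hx hy]. destruct (Hl (x, (y, tt))) as [[u [v []]] [hin [hb hc]]].
    + simpl. simpl in hx, hy. auto.
    + exists (u, v). simpl in hb, hc. unfold cv in hc. simpl in hc.
      assert (hr : in_rect a1 b1 a2 b2 (u, v)) by (unfold in_rect; simpl; tauto).
      split.
      * apply filter_In. split.
        -- change (u, v) with (cv (u, (v, tt))). now apply in_map.
        -- destruct (excluded_middle_informative (in_rect a1 b1 a2 b2 (u, v))); tauto.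
      * destruct (Hdd (u, v)) as [_ K]. apply K; [exact hr|].
        eapply Rle_lt_trans; [apply Cmod_le_abs|]. simpl. destruct hc as [h1 [h2 _]].
        unfold Rminus in h1, h2. lra.
Qed.

(** Without a maximum every w of [Om] has a point [nx w] with a larger value, and by semicontinuity
    T (nx w) beats T on a whole neighbourhood of w. Among finitely many such neighbourhoods covering
    [Om], take the largest T (nx w): the point nx w itself is beaten by another of these values. *)
Lemma usc_attains (Om : C -> Prop) (T : C -> R) (B : R) :
  (forall w, Om w -> in_rect (- B) B (- B) B w) ->
  (forall w, ~ Om w -> near w (fun z => ~ Om z)) ->
  (forall w, Om w -> forall eta, 0 < eta -> near w (fun z => Om z -> T z < T w + eta)) ->
  (exists w, Om w) ->
  exists w, Om w /\ forall z, Om z -> T z <= T w.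
Proof.
  intros hB hcl husc [wi hwi]. apply NNPP. intros hn.
  assert (hnext : forall w, Om w -> exists z, Om z /\ T w < T z).
  { intros w hw. apply NNPP. intros h. apply hn. exists w. split; [easy|].
    intros z hz. apply Rnot_lt_le. intros hlt. apply h. eauto. }
  assert (hnx : forall w, exists w', Om w -> Om w' /\ T w < T w').
  { intros w. destruct (classic (Om w)) as [hw|hw].
    - destruct (hnext w hw) as [z [h1 h2]]. exists z. auto.
    - exists w. tauto. }
  destruct (choice _ hnx) as [nx Hnx].
  destruct (rect_finite_cover (- B) B (- B) B
     (fun w z => Om z -> Om w /\ T z < T (nx w))) as [l [_ Hl]].
  { intros w _. destruct (classic (Om w)) as [hw|hw].
    - destruct (Hnx w hw) as [h1 h2].
      apply near_imp with (2 := husc w hw (T (nx w) - T w) ltac:(lra)).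
      intros z hz ho. specialize (hz ho). split; [easy|lra].
    - apply near_imp with (2 := hcl w hw). intros z hz ho. contradiction. }
  assert (hmax : forall l : list C, (exists w, In w l /\ Om w) ->
     exists w, In w l /\ Om w /\ forall w', In w' l -> Om w' -> T (nx w') <= T (nx w)).
  { clear l Hl. induction l as [|q l IH]; intros [w [hin ho]]; [easy|].
    destruct (classic (exists w, In w l /\ Om w)) as [he|he].
    - destruct (IH he) as [w1 [i1 [o1 m1]]].
      destruct (classic (Om q)) as [hq|hq].
      + destruct (Rle_or_lt (T (nx q)) (T (nx w1))) as [hle|hlt].
        * exists w1. split; [now right|]. split; [easy|]. intros w' [<-|h] ho'; auto.
        * exists q. split; [now left|]. split; [easy|]. intros w' [<-|h] ho'; [lra|].
          specialize (m1 w' h ho'). lra.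
      + exists w1. split; [now right|]. split; [easy|]. intros w' [<-|h] ho'; [contradiction|auto].
    - destruct hin as [<-|hin]; [|exfalso; eauto].
      exists q. split; [now left|]. split; [easy|]. intros w' [<-|h] ho'; [lra|exfalso; eauto]. }
  destruct (Hl wi (hB wi hwi)) as [w0 [hin hw0]]. specialize (hw0 hwi).
  destruct (hmax l ltac:(exists w0; tauto)) as [w [h1 [h2 h3]]].
  destruct (Hnx w h2) as [k1 k2].
  destruct (Hl (nx w) (hB _ k1)) as [w' [i1 i2]].
  destruct (i2 k1) as [o' lt']. specialize (h3 w' i1 o'). lra.
Qed.

Definition contR (f : C -> R) (w : C) : Prop :=
  forall eta, 0 < eta -> near w (fun z => Rabs (f z - f w) < eta).

Lemma contR_of_continuous (f : C -> R) (w : C) :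
  continuous (T := prod_UniformSpace R_UniformSpace R_UniformSpace) (U := R_UniformSpace) f w ->
  contR f w.
Proof.
  intros H eta he.
  destruct (H (fun u => Rabs (u - f w) < eta)) as [d Hd].
  { exists (mkposreal eta he). intros u hu. exact hu. }
  exists d. split; [apply cond_pos|]. intros z hz. apply Hd.
  pose proof (Rmax_Cmod (z - w)%C) as hm.
  pose proof (Rmax_l (Rabs (fst (z - w)%C)) (Rabs (snd (z - w)%C))).
  pose proof (Rmax_r (Rabs (fst (z - w)%C)) (Rabs (snd (z - w)%C))).
  split; eapply Rle_lt_trans; [|exact hz| |exact hz].
  - change (Rabs (fst z - fst w) <= Cmod (z - w)%C). simpl fst in *. unfold Rminus. lra.
  - change (Rabs (snd z - snd w) <= Cmod (z - w)%C). simpl snd in *. unfold Rminus. lra.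
Qed.

Lemma contR_plus (f h : C -> R) (w : C) :
  contR f w -> contR h w -> contR (fun z => f z + h z) w.
Proof.
  intros H1 H2 eta he.
  apply near_imp with (2 := near_and _ _ _ (H1 (eta / 2) ltac:(lra)) (H2 (eta / 2) ltac:(lra))).
  intros z [h1 h2]. replace (f z + h z - (f w + h w)) with ((f z - f w) + (h z - h w)) by ring.
  eapply Rle_lt_trans; [apply Rabs_triang|]. lra.
Qed.

Lemma contR_const (c : R) (w : C) : contR (fun _ => c) w.
Proof.
  intros eta he. exists 1. split; [lra|]. intros z _.
  now rewrite Rminus_diag, Rabs_R0.
Qed.

Lemma contR_comp (h : R -> R) (f : C -> R) (w : C) :
  contR f w -> continuity_pt h (f w) -> contR (fun z => h (f z)) w.
Proof.
  intros H1 H2 eta he.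
  destruct (proj1 (continuity_pt_locally h (f w)) H2 (mkposreal eta he)) as [d Hd].
  apply near_imp with (2 := H1 d (cond_pos d)). intros z hz. exact (Hd (f z) hz).
Qed.

Lemma contR_scal (c : R) (f : C -> R) (w : C) :
  contR f w -> contR (fun z => c * f z) w.
Proof.
  intros H. apply (contR_comp (fun u => c * u) f w H).
  apply continuity_pt_scal, continuity_pt_id.
Qed.

Lemma contR_mult (f h : C -> R) (w : C) :
  contR f w -> contR h w -> contR (fun z => f z * h z) w.
Proof.
  intros H1 H2 eta he.
  pose proof (Rabs_pos (f w)). pose proof (Rabs_pos (h w)).
  set (M := Rabs (f w) + Rabs (h w) + 1).
  assert (hM : 0 < M) by (unfold M; lra).
  set (d := Rmin 1 (eta / (2 * M))).
  assert (hd : 0 < d).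
  { apply Rmin_glb_lt; [lra|]. apply Rdiv_lt_0_compat; lra. }
  apply near_imp with (2 := near_and _ _ _ (H1 d hd) (H2 d hd)).
  intros z [h1 h2].
  assert (hd1 : d <= 1) by apply Rmin_l.
  assert (hd2 : d * (2 * M) <= eta).
  { assert (h3 : d <= eta / (2 * M)) by apply Rmin_r.
    apply Rmult_le_compat_r with (r := 2 * M) in h3; [|lra].
    unfold Rdiv in h3. rewrite Rmult_assoc, Rinv_l in h3; lra. }
  replace (f z * h z - f w * h w) with
    ((f z - f w) * (h z - h w) + f w * (h z - h w) + h w * (f z - f w)) by ring.
  eapply Rle_lt_trans; [apply Rabs_triang|].
  eapply Rle_lt_trans; [apply Rplus_le_compat_r; apply Rabs_triang|].
  rewrite !Rabs_mult.
  pose proof (Rabs_pos (f z - f w)). pose proof (Rabs_pos (h z - h w)).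
  assert (Rabs (f z - f w) * Rabs (h z - h w) <= d * 1) by (apply Rmult_le_compat; lra).
  assert (Rabs (f w) * Rabs (h z - h w) <= Rabs (f w) * d) by (apply Rmult_le_compat_l; lra).
  assert (Rabs (h w) * Rabs (f z - f w) <= Rabs (h w) * d) by (apply Rmult_le_compat_l; lra).
  unfold M in *. nra.
Qed.

Lemma contR_lt (f h : C -> R) (w : C) :
  contR f w -> contR h w -> f w < h w -> near w (fun z => f z < h z).
Proof.
  intros H1 H2 hl.
  apply near_imp with (2 := near_and _ _ _ (H1 ((h w - f w) / 2) ltac:(lra)) (H2 ((h w - f w) / 2) ltac:(lra))).
  intros z [h1 h2]. apply Rabs_def2 in h1. apply Rabs_def2 in h2. lra.
Qed.

Lemma contR_Cmod_hol2 (g : C -> C) (w : C) : hol2 g w -> contR (fun z => Cmod (g z)) w.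
Proof.
  intros H eta he. apply near_imp with (2 := hol2_cont g w H eta he).
  intros z hz. eapply Rle_lt_trans; [|exact hz]. apply Rabs_le.
  pose proof (Cmod_triangle (g z - g w)%C (g w)) as h1.
  replace (g z - g w + g w)%C with (g z) in h1 by ring.
  pose proof (Cmod_triangle (- (g z - g w))%C (g z)) as h2.
  replace (- (g z - g w) + g z)%C with (g w) in h2 by ring. rewrite Cmod_opp in h2. lra.
Qed.

Lemma contR_ln_dist (p w : C) : w <> p -> contR (fun z => ln (Cmod (z - p)%C)) w.
Proof.
  intros hne. apply (contR_comp ln (fun z => Cmod (z - p)%C)).
  - apply (contR_Cmod_hol2 (fun z => (z - p)%C)). apply hol2_sub_const.
  - apply derivable_continuous_pt. exists (/ Cmod (w - p)%C). apply derivable_pt_lim_ln.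
    apply Cmod_gt_0. intros E. apply hne.
    replace w with (w - p + p)%C by ring. rewrite E. ring.
Qed.

Lemma contR_snd (w : C) : contR snd w.
Proof. apply contR_of_continuous, continuous_snd. Qed.

Lemma contR_fst (w : C) : contR fst w.
Proof. apply contR_of_continuous, continuous_fst. Qed.

Lemma contR_powS (x0 q : R) (w : C) : 0 < snd w -> contR (powS x0 q) w.
Proof.
  intros hy. unfold powS.
  assert (h1 : contR (fun z => fst z + - x0) w) by (apply contR_plus; [apply contR_fst|apply contR_const]).
  pose proof (contR_snd w) as h2.
  assert (h3 : contR (fun z => (fst z - x0) ^ 2 + snd z ^ 2) w).
  { apply contR_plus.
    - apply (contR_comp (fun u => u ^ 2) _ w h1).
      apply derivable_continuous_pt, derivable_pt_pow.
    - apply (contR_comp (fun u => u ^ 2) _ w h2).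
      apply derivable_continuous_pt, derivable_pt_pow. }
  apply (contR_comp (fun u => exp (q * ln u)) _ w h3).
  apply derivable_continuous_pt.
  assert (hp : 0 < (fst w - x0) ^ 2 + snd w ^ 2)
   by (pose proof (pow2_ge_0 (fst w - x0)); pose proof (pow_lt (snd w) 2 hy); lra).
  apply ex_derive_Reals_0. auto_derive. exact hp.
Qed.

Lemma contR_Vpot (x0 gam : R) (w : C) : 0 < snd w -> contR (Vpot x0 gam) w.
Proof.
  intros hy. unfold Vpot.
  assert (hq : forall al be de, contR (fun z => quadP al be de (snd z)) w).
  { intros al be de. apply (contR_comp (quadP al be de) snd w (contR_snd w)).
    unfold quadP. apply derivable_continuous_pt, ex_derive_Reals_0. auto_derive. easy. }
  repeat apply contR_plus; apply contR_mult; auto using contR_powS.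
Qed.

(** * The maximum principle on a box *)

(** The hypotheses in a form stable under w |-> -1/w and under passing to sublists of [zs]. The
    majorant [U] is a parameter because the substitution changes it. *)
Definition datum (U : C -> R) (g : C -> C) (K : R) (zs : list (C * nat)) : Prop :=
  0 < K /\ (forall w, upper w -> hol2 g w) /\ Cmod (g Ci) = 1 /\
  (forall w, upper w -> g w <> 0%C -> ln (Cmod (g w)) <= K * U w) /\
  NoDup (map fst zs) /\
  (forall p, In p zs -> upper (fst p) /\ (1 <= snd p)%nat /\ zero_bd g (fst p) (snd p)).

Lemma zsum_app (l1 l2 : list (C * nat)) (F : C -> R) :
  zsum (l1 ++ l2) F = zsum l1 F + zsum l2 F.
Proof. induction l1 as [|p l1 IH]; simpl; [|unfold zsum in *; simpl; rewrite IH]; ring. Qed.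

Lemma zsum_le (zs : list (C * nat)) (F G : C -> R) :
  (forall p, In p zs -> F (fst p) <= G (fst p)) -> zsum zs F <= zsum zs G.
Proof.
  induction zs as [|p zs IH]; intros H; simpl; [lra|].
  apply Rplus_le_compat; [|apply IH; intros; apply H; now right].
  apply Rmult_le_compat_l; [apply pos_INR|]. apply H. now left.
Qed.

Lemma zsum_scal (zs : list (C * nat)) (F : C -> R) (c : R) :
  zsum zs (fun z => c * F z) = c * zsum zs F.
Proof. induction zs as [|p zs IH]; simpl; [|unfold zsum in *; rewrite IH]; ring. Qed.

Lemma zsum_zero (zs : list (C * nat)) : zsum zs (fun _ => 0) = 0.
Proof. induction zs as [|p zs IH]; simpl; [|unfold zsum in *; rewrite IH]; ring. Qed.

Definition mirror (t : R) (z : C) : C := (fst z, t - snd z).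

(* Green's function of the half-plane [Im w > t/2] with pole at [z]. *)
Definition Psi (t : R) (z w : C) : R :=
  ln (Cmod (w - mirror t z)%C) - ln (Cmod (w - z)%C).

Definition dist0 (x0 : R) (w : C) : R := Cmod (w - RtoC x0)%C.

(* At height at least [t/2] but off this region, every Green term [Psi t z] with [s <= |z - x0| <= 2 s] is at most
   [Im z * eta * Vpot]. *)
Definition Om (x0 gam eta s t : R) (w : C) : Prop :=
  t / 2 <= snd w /\
  ((dist0 x0 w ^ 2 + s ^ 2) * (eta * Vpot x0 gam w) <= 10 * snd w \/
   s / 2 <= dist0 x0 w <= 4 * s).

Lemma Cmod_pair_sqr (w : C) (u v : R) :
  Cmod (w - (u, v))%C ^ 2 = (fst w - u) ^ 2 + (snd w - v) ^ 2.
Proof.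
  destruct w as [x y]. unfold Cmod. rewrite pow2_sqrt; [simpl; ring|].
  apply Rplus_le_le_0_compat; apply pow2_ge_0.
Qed.

Lemma Cmod_sub_pos (w z : C) : w <> z -> 0 < Cmod (w - z)%C.
Proof.
  intros h. apply Cmod_gt_0. intros E. apply h.
  replace w with (w - z + z)%C by ring. rewrite E. ring.
Qed.

(** The squared distances from w to the mirror image of z and to z differ by (2 Im w - t)(2 Im z -
    t). In this form [Psi] is seen to vanish on Im w = t/2. *)
Lemma Psi_formula (t : R) (z w : C) :
  w <> z -> t / 2 <= snd w -> t / 2 < snd z ->
  Psi t z w = / 2 * ln (1 + (2 * snd w - t) * (2 * snd z - t) / Cmod (w - z)%C ^ 2).
Proof.
  intros hne hw hz. unfold Psi. destruct z as [u v]. cbn [fst snd] in *.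
  pose proof (Cmod_sub_pos _ _ hne) as h1.
  assert (h2 : 0 < Cmod (w - mirror t (u, v))%C).
  { apply Cmod_sub_pos. intros E. rewrite E in hw. simpl in hw. lra. }
  replace (1 + (2 * snd w - t) * (2 * v - t) / Cmod (w - (u, v))%C ^ 2) with
   ((Cmod (w - mirror t (u, v))%C / Cmod (w - (u, v))%C) * (Cmod (w - mirror t (u, v))%C / Cmod (w - (u, v))%C)).
  - rewrite ln_mult by (apply Rdiv_lt_0_compat; auto). rewrite ln_div by auto. field.
  - replace (Cmod (w - mirror t (u, v)) / Cmod (w - (u, v)) * (Cmod (w - mirror t (u, v)) / Cmod (w - (u, v))))
     with (Cmod (w - mirror t (u, v)) ^ 2 / Cmod (w - (u, v)) ^ 2) by (field; lra).
    assert (Cmod (w - (u, v)) ^ 2 <> 0) by (apply pow_nonzero; lra).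
    replace (Cmod (w - mirror t (u, v)) ^ 2) with
      (Cmod (w - (u, v)) ^ 2 + (2 * snd w - t) * (2 * v - t)); [field; lra|].
    unfold mirror. rewrite !Cmod_pair_sqr. cbn [fst snd]. ring.
Qed.

Lemma Psi_le (t : R) (z w : C) :
  w <> z -> 0 < t -> t / 2 <= snd w -> t / 2 < snd z ->
  Psi t z w * Cmod (w - z)%C ^ 2 <= 2 * snd w * snd z.
Proof.
  intros hne ht hw hz. rewrite Psi_formula by auto.
  pose proof (Cmod_sub_pos _ _ hne) as h1.
  assert (h2 : 0 < Cmod (w - z) ^ 2) by now apply pow_lt.
  set (D := Cmod (w - z) ^ 2) in *.
  assert (h3 : 0 <= (2 * snd w - t) * (2 * snd z - t) / D).
  { apply Rmult_le_pos; [nra|left; now apply Rinv_0_lt_compat]. }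
  pose proof (ln_le_sub_1 (1 + (2 * snd w - t) * (2 * snd z - t) / D) ltac:(lra)) as h4.
  apply Rle_trans with (/ 2 * ((2 * snd w - t) * (2 * snd z - t) / D) * D).
  - apply Rmult_le_compat_r; lra.
  - replace (/ 2 * ((2 * snd w - t) * (2 * snd z - t) / D) * D) with
     (/ 2 * ((2 * snd w - t) * (2 * snd z - t))) by (field; lra). nra.
Qed.

(** Used at w = i: a lower bound of Green's function proportional to Im z is what turns the maximum
    principle into a bound for the sum of the Im z. It rests on ln(1 + v) >= v / (1 + v). *)
Lemma Psi_ge (t : R) (z w : C) (D : R) :
  w <> z -> 0 < t <= 1 -> 1 <= snd w -> t <= snd z -> Cmod (w - z)%C ^ 2 <= D ->
  snd z / (2 * (D + snd z)) <= Psi t z w.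
Proof.
  intros hne ht hw hz hD. rewrite Psi_formula by (auto; lra).
  pose proof (Cmod_sub_pos _ _ hne) as h1.
  assert (h2 : 0 < Cmod (w - z) ^ 2) by now apply pow_lt.
  set (d := Cmod (w - z) ^ 2) in *. set (y := snd z) in *.
  assert (hy : 0 < y) by lra.
  set (Z := (2 * snd w - t) * (2 * y - t) / d).
  assert (hZ : y / D <= Z).
  { unfold Z. apply Rle_trans with (y / d).
    - unfold Rdiv. apply Rmult_le_compat_l; [lra|]. apply Rinv_le_contravar; lra.
    - unfold Rdiv. apply Rmult_le_compat_r; [left; now apply Rinv_0_lt_compat|]. nra. }
  assert (hyD : 0 < y / D) by (apply Rdiv_lt_0_compat; lra).
  assert (hl : ln (1 + y / D) <= ln (1 + Z)) by (apply ln_le; lra).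
  pose proof (ln_ge_1_sub_inv (1 + y / D) ltac:(lra)) as h3.
  replace (y / (2 * (D + y))) with (/ 2 * (1 - / (1 + y / D))) by (field; lra).
  lra.
Qed.

(* Half of each multiplicity is left in [g], so that [|g| exp(expo)] tends to [0] at the listed zeros
   and no singularity has to be removed. *)
Definition expo (x0 gam eta t KA : R) (zs : list (C * nat)) (w : C) : R :=
  zsum zs (fun z => / 2 * (Psi t z w - snd z * (eta * Vpot x0 gam w))) + - KA * Vpot x0 gam w.

Lemma sub4_expo (x0 gam eta t KA : R) (zs : list (C * nat)) (w : C) :
  0 < gam < 1 -> 0 < eta -> 0 < t -> 0 < KA -> 0 < snd w -> t / 2 <= snd w ->
  (forall p, In p zs -> t <= snd (fst p) /\ fst p <> w) ->
  exists lam, 0 < lam /\ sub4 (expo x0 gam eta t KA zs) w lam.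
Proof.
  intros hg he ht hK hw hw2 Hz.
  destruct (sub4_neg_Vpot x0 gam w hg hw) as [l0 [hl0 H0]].
  (* Strictness is drawn from -KA V alone; the sum over the zeros is only counted as having
     Laplacian at least 0. *)
  unfold expo. exists (0 + KA * l0). split; [nra|].
  apply sub4_plus.
  - induction zs as [|p zs IH].
    + intros e hep. exists 1. split; [lra|]. intros r hr. unfold four. simpl. nra.
    + destruct (Hz p (or_introl eq_refl)) as [h1 h2].
      assert (hi : 0 <= INR (snd p)) by apply pos_INR.
      set (z := fst p) in *. set (c := INR (snd p) / 2).
      assert (hc : 0 <= c) by (unfold c; lra).
      assert (K : sub4 (fun w => (c * ln (Cmod (w - mirror t z)%C) + - c * ln (Cmod (w - z)%C))
          + (c * snd z * eta) * (- Vpot x0 gam w)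
          + zsum zs (fun z => / 2 * (Psi t z w - snd z * (eta * Vpot x0 gam w)))) w
          (0 + 0 + (c * snd z * eta) * l0 + 0)).
      { repeat apply sub4_plus.
        - apply (sub4_ln_Cmod (fun w => (w - mirror t z)%C)); [apply hol2_sub_const|].
          apply Cmod_gt_0, Cmod_sub_pos. intros E. rewrite E in hw2. simpl in hw2. lra.
        - apply (sub4_ln_Cmod (fun w => (w - z)%C)); [apply hol2_sub_const|].
          apply Cmod_gt_0, Cmod_sub_pos. intros E. now apply h2.
        - apply sub4_scal; [|exact H0]. apply Rmult_le_pos; [apply Rmult_le_pos; lra|lra].
        - apply IH. intros q hq. apply Hz. now right. }
      intros e hep. destruct (K e hep) as [d [hd Kd]]. exists d. split; [easy|].
      intros r hr. specialize (Kd r hr).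
      assert (hpos : 0 <= c * snd z * eta * l0).
      { apply Rmult_le_pos; [|lra]. apply Rmult_le_pos; [apply Rmult_le_pos; lra|lra]. }
      assert (E : forall u, zsum (p :: zs) (fun z => / 2 * (Psi t z u - snd z * (eta * Vpot x0 gam u)))
        = (c * ln (Cmod (u - mirror t z)%C) + - c * ln (Cmod (u - z)%C))
          + (c * snd z * eta) * (- Vpot x0 gam u)
          + zsum zs (fun z => / 2 * (Psi t z u - snd z * (eta * Vpot x0 gam u)))).
      { intros u. unfold zsum at 1. simpl. fold z. unfold Psi at 1. unfold c. unfold zsum. field. }
      unfold four in *. rewrite !E. nra.
  - apply sub4_ext with (fun z => KA * (- Vpot x0 gam z)); [intros; ring|].
    apply sub4_scal; [lra|exact H0].
Qed.

Lemma contR_expo (x0 gam eta t KA : R) (zs : list (C * nat)) (w : C) :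
  0 < t -> t / 2 <= snd w -> (forall p, In p zs -> t <= snd (fst p) /\ fst p <> w) ->
  contR (expo x0 gam eta t KA zs) w.
Proof.
  intros ht hw2 Hz. assert (hw : 0 < snd w) by lra.
  apply contR_plus; [|apply contR_scal; now apply contR_Vpot].
  induction zs as [|p zs IH]; [exact (contR_const 0 w)|].
  destruct (Hz p (or_introl eq_refl)) as [h1 h2].
  assert (K : contR (fun w => INR (snd p) * (/ 2 * (ln (Cmod (w - mirror t (fst p))%C)
      + - 1 * ln (Cmod (w - fst p)%C) + - (snd (fst p) * eta) * Vpot x0 gam w))
    + zsum zs (fun z => / 2 * (Psi t z w - snd z * (eta * Vpot x0 gam w)))) w).
  { apply contR_plus; [|apply IH; intros q hq; apply Hz; now right].
    apply contR_scal, contR_scal. apply contR_plus; [apply contR_plus|].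
    - apply contR_ln_dist. intros E. rewrite E in hw2. simpl in hw2. lra.
    - apply contR_scal, contR_ln_dist. intros E. now apply h2.
    - apply contR_scal. now apply contR_Vpot. }
  intros e he. apply near_imp with (2 := K e he). intros z hz.
  eapply Rle_lt_trans; [|exact hz]. right. f_equal. unfold zsum, Psi; simpl. ring.
Qed.

Lemma contR_dist0 (x0 : R) (w : C) : contR (dist0 x0) w.
Proof. apply (contR_Cmod_hol2 (fun z => (z - RtoC x0)%C)). apply hol2_sub_const. Qed.

(** The two conclusions serve on opposite sides of the scale s: for r > s the first bounds the
    height from below by r^(2-gam), for r < s the second, with y <= r, keeps r from being far below
    s. *)
Lemma Om_outer (x0 gam eta s : R) (w : C) : 0 < gam < 1 -> 0 < eta -> 0 < snd w ->
  (dist0 x0 w ^ 2 + s ^ 2) * (eta * Vpot x0 gam w) <= 10 * snd w ->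
  eta * Rpower (dist0 x0 w) (2 - gam) <= 10 * snd w /\
  eta * s ^ 2 * Rpower (dist0 x0 w) (- gam) <= 10 * snd w.
Proof.
  intros hg he hy H.
  pose proof (dist_R_pos w x0 hy) as hr. fold (dist0 x0 w) in hr.
  destruct (Vpot_bounds x0 gam w hg hy) as [hV _]. fold (dist0 x0 w) in hV.
  set (r := dist0 x0 w) in *.
  assert (hp : 0 < Rpower r (- gam)) by apply exp_pos.
  assert (h2 : Rpower r (2 - gam) = r ^ 2 * Rpower r (- gam)).
  { unfold Rminus. rewrite Rpower_plus. f_equal. rewrite <- (Rpower_pow 2 r hr). reflexivity. }
  rewrite h2.
  assert (k1 : eta * Rpower r (- gam) <= eta * Vpot x0 gam w) by (apply Rmult_le_compat_l; lra).
  assert (k2 : 0 < eta * Rpower r (- gam)) by (apply Rmult_lt_0_compat; lra).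
  assert (0 <= r ^ 2) by apply pow2_ge_0. assert (0 <= s ^ 2) by apply pow2_ge_0.
  assert (r ^ 2 * (eta * Rpower r (- gam)) <= r ^ 2 * (eta * Vpot x0 gam w)) by (apply Rmult_le_compat_l; lra).
  assert (s ^ 2 * (eta * Rpower r (- gam)) <= s ^ 2 * (eta * Vpot x0 gam w)) by (apply Rmult_le_compat_l; lra).
  assert (0 <= r ^ 2 * (eta * Rpower r (- gam))) by (apply Rmult_le_pos; lra).
  assert (0 <= s ^ 2 * (eta * Rpower r (- gam))) by (apply Rmult_le_pos; lra).
  nra.
Qed.

Lemma Rpower_le_compat (x y q : R) : 0 < x <= y -> 0 <= q -> Rpower x q <= Rpower y q.
Proof. intros. apply Rle_Rpower_l; lra. Qed.

(** Since y <= r, the cusp condition eta r^(2-gam) <= 10 y gives r^(1-gam) <= 10 / eta, a bound free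
    of s; this is where gam < 1 is essential. *)
Lemma Om_outer_bounded (x0 gam eta s : R) (w : C) : 0 < gam < 1 -> 0 < eta -> 0 < snd w ->
  (dist0 x0 w ^ 2 + s ^ 2) * (eta * Vpot x0 gam w) <= 10 * snd w ->
  dist0 x0 w <= Rpower (10 / eta) (/ (1 - gam)).
Proof.
  intros hg he hy0 H.
  destruct (Om_outer x0 gam eta s w hg he hy0 H) as [H1 _].
  pose proof (Im_le_dist w x0 hy0) as hyr. fold (dist0 x0 w) in hyr.
  set (r := dist0 x0 w) in *. assert (hr : 0 < r) by lra.
  replace (2 - gam) with ((1 - gam) + 1) in H1 by ring.
  rewrite Rpower_plus, Rpower_1 in H1 by easy.
  assert (H2 : Rpower r (1 - gam) <= 10 / eta).
  { apply Rmult_le_reg_r with (eta * r); [nra|].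
    replace (10 / eta * (eta * r)) with (10 * r) by (field; lra). lra. }
  replace r with (Rpower (Rpower r (1 - gam)) (/ (1 - gam))).
  - apply Rpower_le_compat; [split; [apply exp_pos|easy]|].
    left. apply Rinv_0_lt_compat. lra.
  - rewrite Rpower_mult. replace ((1 - gam) * / (1 - gam)) with 1 by (field; lra). now apply Rpower_1.
Qed.

Lemma Om_bounded (gam eta s : R) : 0 < gam < 1 -> 0 < eta -> 0 < s ->
  exists R0, 0 < R0 /\ forall x0 t w, 0 < t -> Om x0 gam eta s t w -> dist0 x0 w <= R0.
Proof.
  intros hg he hs. exists (Rmax (4 * s) (Rpower (10 / eta) (/ (1 - gam)))).
  split; [eapply Rlt_le_trans; [|apply Rmax_l]; lra|].
  intros x0 t w ht [hy [H|H]]; [|eapply Rle_trans; [apply H | apply Rmax_l]].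
  eapply Rle_trans; [|apply Rmax_r].
  apply (Om_outer_bounded x0 gam eta s w hg he); [lra|exact H].
Qed.

Lemma Om_in_rect (x0 gam eta s : R) : 0 < gam < 1 -> 0 < eta -> 0 < s ->
  exists B, forall t w, 0 < t -> Om x0 gam eta s t w -> in_rect (- B) B (- B) B w.
Proof.
  intros hg he hs. destruct (Om_bounded gam eta s hg he hs) as [R0 [hR0 H]].
  exists (R0 + Rabs x0). intros t w ht hw. specialize (H x0 t w ht hw).
  pose proof (re_le_Cmod (w - RtoC x0)%C) as h1. pose proof (Rmax_Cmod (w - RtoC x0)%C) as h2.
  fold (dist0 x0 w) in h1, h2.
  assert (h3 : Rabs (fst w - x0) <= R0).
  { replace (fst w - x0) with (Re (w - RtoC x0)%C) by (unfold Re; simpl; ring). lra. }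
  assert (h4 : Rabs (snd w) <= R0).
  { eapply Rle_trans; [|exact H]. eapply Rle_trans; [|exact h2].
    replace (snd (w - RtoC x0)%C) with (snd w) by (simpl; ring). apply Rmax_r. }
  apply Rabs_le_between in h3. apply Rabs_le_between in h4.
  pose proof (Rle_abs x0). pose proof (Rle_abs (- x0)) as h5. rewrite Rabs_Ropp in h5.
  unfold in_rect. lra.
Qed.

Lemma contR_gap (x0 gam eta s : R) (w : C) : 0 < snd w ->
  contR (fun z => (dist0 x0 z ^ 2 + s ^ 2) * (eta * Vpot x0 gam z)) w.
Proof.
  intros hy. apply contR_mult.
  - apply contR_plus; [|apply contR_const].
    apply (contR_comp (fun u => u ^ 2) _ w (contR_dist0 x0 w)).
    apply derivable_continuous_pt, derivable_pt_pow.
  - apply contR_scal. now apply contR_Vpot.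
Qed.

Lemma Om_closed (x0 gam eta s t : R) (w : C) :
  0 < t -> ~ Om x0 gam eta s t w -> near w (fun z => ~ Om x0 gam eta s t z).
Proof.
  intros ht hn. destruct (Rlt_or_le (snd w) (t / 2)) as [h|h].
  - apply near_imp with (2 := contR_lt _ _ _ (contR_snd w) (contR_const (t / 2) w) h).
    intros z hz [h1 _]. lra.
  - assert (h1 : 10 * snd w < (dist0 x0 w ^ 2 + s ^ 2) * (eta * Vpot x0 gam w)).
    { apply Rnot_le_lt. intros h1. apply hn. split; auto. }
    assert (hgap := contR_lt _ _ _ (contR_scal 10 _ _ (contR_snd w)) (contR_gap x0 gam eta s w ltac:(lra)) h1).
    destruct (Rlt_or_le (dist0 x0 w) (s / 2)) as [h2|h2].
    + apply near_imp with (2 := near_and _ _ _ hgap (contR_lt _ _ _ (contR_dist0 x0 w) (contR_const (s / 2) w) h2)).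
      intros z [k1 k2] [_ [k|k]]; lra.
    + assert (h3 : 4 * s < dist0 x0 w).
      { apply Rnot_le_lt. intros h3. apply hn. split; auto. }
      apply near_imp with (2 := near_and _ _ _ hgap (contR_lt _ _ _ (contR_const (4 * s) w) (contR_dist0 x0 w) h3)).
      intros z [k1 k2] [_ [k|k]]; lra.
Qed.

Lemma Om_interior (x0 gam eta s t : R) (w : C) :
  0 < t -> t / 2 < snd w ->
  ((dist0 x0 w ^ 2 + s ^ 2) * (eta * Vpot x0 gam w) < 10 * snd w \/ s / 2 < dist0 x0 w < 4 * s) ->
  near w (Om x0 gam eta s t).
Proof.
  intros ht h1 H.
  assert (k1 := contR_lt _ _ _ (contR_const (t / 2) w) (contR_snd w) h1).
  destruct H as [H|[H1 H2]].
  - apply near_imp with (2 := near_and _ _ _ k1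
      (contR_lt _ _ _ (contR_gap x0 gam eta s w ltac:(lra)) (contR_scal 10 _ _ (contR_snd w)) H)).
    intros z [a b]. split; [lra|]. left; lra.
  - apply near_imp with (2 := near_and _ _ _ k1 (near_and _ _ _
      (contR_lt _ _ _ (contR_const (s / 2) w) (contR_dist0 x0 w) H1)
      (contR_lt _ _ _ (contR_dist0 x0 w) (contR_const (4 * s) w) H2))).
    intros z [a [b c]]. split; [lra|]. right; lra.
Qed.

(** If r <= s/2 then |w - z| >= s/2, and if r >= 4s then |w - z| >= r/2; the first case gives the
    constant 5. Together with the 2 of [Psi_le] it explains the 10 in [Om]. *)
Lemma dist_triangle_box (x0 s : R) (z w : C) :
  0 < s -> s <= dist0 x0 z <= 2 * s -> (dist0 x0 w <= s / 2 \/ 4 * s <= dist0 x0 w) ->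
  w <> z /\ dist0 x0 w ^ 2 + s ^ 2 <= 5 * Cmod (w - z)%C ^ 2.
Proof.
  intros hs hz hw.
  pose proof (Cmod_triangle (w - z)%C (z - RtoC x0)%C) as h1.
  replace (w - z + (z - RtoC x0))%C with (w - RtoC x0)%C in h1 by ring.
  pose proof (Cmod_triangle (w - RtoC x0)%C (- (w - z))%C) as h2.
  replace (w - RtoC x0 + - (w - z))%C with (z - RtoC x0)%C in h2 by ring.
  rewrite Cmod_opp in h2. fold (dist0 x0 w) in *. fold (dist0 x0 z) in *.
  pose proof (Cmod_ge_0 (w - RtoC x0)%C) as h3. fold (dist0 x0 w) in h3.
  set (D := Cmod (w - z)%C) in *. set (r := dist0 x0 w) in *.
  split.
  - intros E. assert (D = 0). { unfold D. rewrite E. replace (z - z)%C with (RtoC 0) by ring. apply Cmod_0. }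
    destruct hw; lra.
  - destruct hw as [hw|hw].
    + assert (s / 2 <= D) by lra. assert ((s / 2) ^ 2 <= D ^ 2) by (apply pow_incr; lra).
      assert (r ^ 2 <= (s / 2) ^ 2) by (apply pow_incr; lra). nra.
    + assert (r / 2 <= D) by lra. assert ((r / 2) ^ 2 <= D ^ 2) by (apply pow_incr; lra).
      assert ((4 * s) ^ 2 <= r ^ 2) by (apply pow_incr; lra). nra.
Qed.

(** At a local maximum [four] is at most 0, while [sub4] makes it at least (lam / 2) r^2. Having lam
    > 0 spares any discussion of functions that are locally constant. *)
Lemma four_bound_contra (v : C -> R) (w : C) (lam : R) :
  0 < lam -> sub4 v w lam -> near w (fun z => v z <= v w) -> False.
Proof.
  intros hl H [d [hd K]]. destruct (H (lam / 2) ltac:(lra)) as [d' [hd' K']].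
  set (r := Rmin d d' / 2).
  assert (hr : 0 < r < d /\ r < d').
  { assert (0 < Rmin d d') by now apply Rmin_glb_lt.
    pose proof (Rmin_l d d'). pose proof (Rmin_r d d'). unfold r. lra. }
  specialize (K' r ltac:(lra)).
  assert (hm : Cmod (RtoC r) = r) by (rewrite Cmod_R, Rabs_pos_eq; lra).
  pose proof (K (w + RtoC r)%C ltac:(replace (w + r - w)%C with (RtoC r) by ring; lra)).
  pose proof (K (w + - RtoC r)%C ltac:(replace (w + - r - w)%C with (- RtoC r)%C by ring; rewrite Cmod_opp; lra)).
  pose proof (K (w + Ci * RtoC r)%C ltac:(replace (w + Ci * r - w)%C with (Ci * RtoC r)%C by ring;
     rewrite Cmod_mult, Cmod_Ci; lra)).
  pose proof (K (w + - (Ci * RtoC r))%C ltac:(replace (w + - (Ci * r) - w)%C with (- (Ci * RtoC r))%C by ring;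
     rewrite Cmod_opp, Cmod_mult, Cmod_Ci; lra)).
  unfold four in K'. assert (0 < r ^ 2) by (apply pow_lt; lra). nra.
Qed.

Lemma zero_bd_zero (g : C -> C) (z : C) (m : nat) : (1 <= m)%nat -> zero_bd g z m -> g z = 0%C.
Proof.
  intros hm [B [hB H]]. apply near_self in H.
  replace (z - z)%C with (RtoC 0) in H by ring. rewrite Cmod_0, pow_i in H by lia.
  apply Cmod_eq_0. pose proof (Cmod_ge_0 (g z)). lra.
Qed.

Lemma pow_exp_ln (r : R) (m : nat) : 0 < r -> r ^ m = exp (INR m * ln r).
Proof. intros hr. now rewrite <- Rpower_pow. Qed.

(** |g| is at most B |u - z|^m and the exponential grows like |u - z|^(-m/2), so at least the power
    |u - z|^(1/2) is left. *)
Lemma near_product_small (g : C -> C) (z : C) (m : nat) (Q : C -> R) (e : R) :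
  (1 <= m)%nat -> zero_bd g z m -> contR Q z -> 0 < e ->
  near z (fun u => Cmod (g u) * exp (Q u - INR m / 2 * ln (Cmod (u - z)%C)) < e).
Proof.
  intros hm Hz HQ he. pose proof (zero_bd_zero g z m hm Hz) as hg0.
  destruct Hz as [B [hB HB]].
  set (M := B * exp (Q z + 1) + 1).
  pose proof (exp_pos (Q z + 1)) as hq. assert (hM : 0 < M) by (unfold M; nra).
  destruct (near_and _ _ _ HB (HQ 1 ltac:(lra))) as [d [hd Hd]].
  assert (heM : 0 < e / M) by now apply Rdiv_lt_0_compat.
  (* The square undoes the remaining power 1/2; radius at most 1 lets m / 2 be lowered to 1/2. *)
  exists (Rmin d (Rmin 1 ((e / M) ^ 2))). split.
  { repeat apply Rmin_glb_lt; try lra. now apply pow_lt. }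
  intros u hu. set (r := Cmod (u - z)%C) in *.
  pose proof (Rmin_l d (Rmin 1 ((e / M) ^ 2))). pose proof (Rmin_r d (Rmin 1 ((e / M) ^ 2))).
  pose proof (Rmin_l 1 ((e / M) ^ 2)). pose proof (Rmin_r 1 ((e / M) ^ 2)).
  destruct (Hd u ltac:(fold r; lra)) as [h1 h2]. fold r in h1.
  destruct (Cmod_ge_0 (u - z)%C) as [hr|hr]; fold r in hr.
  - apply Rabs_def2 in h2. rewrite pow_exp_ln in h1 by easy.
    assert (hln : ln r < 0) by (rewrite <- ln_1; apply ln_increasing; lra).
    assert (hln2 : / 2 * ln r < ln (e / M)).
    { assert (ln r < ln ((e / M) ^ 2)) by (apply ln_increasing; lra).
      rewrite ln_pow in H3 by easy. simpl INR in H3. lra. }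
    assert (hi : 1 <= INR m) by (replace 1 with (INR 1) by reflexivity; now apply le_INR).
    apply Rle_lt_trans with (B * exp (INR m * ln r) * exp (Q u - INR m / 2 * ln r)).
    { apply Rmult_le_compat_r; [left; apply exp_pos|exact h1]. }
    rewrite Rmult_assoc, <- exp_plus.
    replace (INR m * ln r + (Q u - INR m / 2 * ln r)) with (Q u + INR m / 2 * ln r) by field.
    assert (hle : exp (Q u + INR m / 2 * ln r) <= exp (Q z + 1) * exp (/ 2 * ln r)).
    { rewrite <- exp_plus. apply exp_le. nra. }
    apply Rle_lt_trans with (B * exp (Q z + 1) * exp (/ 2 * ln r)).
    { rewrite Rmult_assoc. now apply Rmult_le_compat_l. }
    assert (hlt : exp (/ 2 * ln r) < e / M).
    { rewrite <- (exp_ln (e / M)) by easy. now apply exp_increasing. }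
    pose proof (exp_pos (/ 2 * ln r)).
    apply Rlt_le_trans with (M * (e / M)); [|right; field; lra].
    apply Rle_lt_trans with (M * exp (/ 2 * ln r)); [|now apply Rmult_lt_compat_l].
    apply Rmult_le_compat_r; unfold M; lra.
  - assert (E : u = z).
    { replace u with (u - z + z)%C by ring. rewrite (Cmod_eq_0 (u - z)%C) by auto. ring. }
    rewrite E, hg0, Cmod_0. lra.
Qed.

(** At a listed zero the value of the product is 0, whatever the exponential is there, and [NoDup]
    ensures that only one term of [expo] is singular: the rest is the continuous [Q] of
    [near_product_small]. *)
Lemma usc_T (x0 gam eta s t A K : R) U g zs (w : C) :
  0 < t -> datum U g K zs -> (forall p, In p zs -> t <= snd (fst p)) ->
  Om x0 gam eta s t w -> forall e, 0 < e ->
  near w (fun z => Cmod (g z) * exp (expo x0 gam eta t A zs z) <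
                   Cmod (g w) * exp (expo x0 gam eta t A zs w) + e).
Proof.
  intros ht [hK [hhol [hgi [hU [hnd hz]]]]] hzt [hw1 _] e he.
  destruct (classic (In w (map fst zs))) as [hin|hin].
  - apply in_map_iff in hin. destruct hin as [p [hp hin]].
    destruct (hz p hin) as [hup [hm hbd]]. pose proof (hzt p hin) as htp.
    destruct (in_split _ _ hin) as [l1 [l2 El]].
    assert (hnot : forall q, In q (l1 ++ l2) -> t <= snd (fst q) /\ fst q <> w).
    { intros q hq. split.
      - apply hzt. rewrite El. apply in_app_iff. apply in_app_iff in hq. destruct hq; [now left|right; now right].
      - intros E. rewrite El, map_app in hnd. simpl in hnd. apply NoDup_remove_2 in hnd.
        apply hnd. rewrite <- map_app, hp, <- E. now apply in_map. }
    set (Q := fun u => expo x0 gam eta t A (l1 ++ l2) u +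
       INR (snd p) / 2 * (ln (Cmod (u - mirror t (fst p))%C) + - (snd (fst p) * eta) * Vpot x0 gam u)).
    assert (HQ : contR Q w).
    { apply contR_plus; [now apply contR_expo|]. apply contR_scal, contR_plus.
      - apply contR_ln_dist. intros E. rewrite E in hw1. simpl in hw1. lra.
      - apply contR_scal, contR_Vpot. lra. }
    rewrite hp in *.
    apply near_imp with (2 := near_product_small g w (snd p) Q e hm hbd HQ he).
    intros u hu. rewrite (zero_bd_zero g w (snd p) hm hbd), Cmod_0, Rmult_0_l, Rplus_0_l.
    eapply Rle_lt_trans; [|exact hu]. right. f_equal. f_equal.
    unfold Q, expo. rewrite El, !zsum_app. rewrite <- hp. unfold zsum at 2. simpl. unfold Psi at 2.
    unfold zsum. field.
  - assert (hnot : forall q, In q zs -> t <= snd (fst q) /\ fst q <> w).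
    { intros q hq. split; [auto|]. intros E. apply hin. rewrite <- E. now apply in_map. }
    assert (hc : contR (fun z => Cmod (g z) * exp (expo x0 gam eta t A zs z)) w).
    { apply contR_mult.
      - apply contR_Cmod_hol2, hhol. unfold upper, Im. lra.
      - apply (contR_comp exp); [now apply contR_expo|]. apply derivable_continuous_pt, derivable_pt_exp. }
    apply near_imp with (2 := hc e he). intros z h. apply Rabs_def2 in h. lra.
Qed.

(** On the line Im w = t/2 Green's function is 0. Elsewhere w is off the scale s and 10 Im w <= (r^2
    + s^2) eta V <= 5 |w - z|^2 eta V, while Psi <= 2 Im w Im z / |w - z|^2. *)
Lemma Psi_le_on_boundary (x0 gam eta s t : R) (z w : C) :
  0 < gam < 1 -> 0 < eta -> 0 < s -> 0 < t ->
  s <= dist0 x0 z <= 2 * s -> t <= snd z -> Om x0 gam eta s t w ->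
  ~ (t / 2 < snd w /\
     ((dist0 x0 w ^ 2 + s ^ 2) * (eta * Vpot x0 gam w) < 10 * snd w \/ s / 2 < dist0 x0 w < 4 * s)) ->
  Psi t z w <= snd z * (eta * Vpot x0 gam w).
Proof.
  intros hg he hs ht hz1 hz2 [hw _] hn.
  assert (hw0 : 0 < snd w) by lra.
  assert (hV : 0 < eta * Vpot x0 gam w).
  { apply Rmult_lt_0_compat; [easy|]. destruct (Vpot_bounds x0 gam w hg hw0) as [h _].
    eapply Rlt_le_trans; [|exact h]. apply exp_pos. }
  destruct (Rle_lt_or_eq_dec _ _ hw) as [hlt|heq].
  - assert (h1 : 10 * snd w <= (dist0 x0 w ^ 2 + s ^ 2) * (eta * Vpot x0 gam w)).
    { apply Rnot_lt_le. intros h. apply hn. split; auto. }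
    assert (h2 : dist0 x0 w <= s / 2 \/ 4 * s <= dist0 x0 w).
    { destruct (Rle_or_lt (dist0 x0 w) (s / 2)) as [|h]; [now left|right].
      apply Rnot_lt_le. intros h'. apply hn. split; auto. }
    destruct (dist_triangle_box x0 s z w hs hz1 h2) as [hne hD].
    pose proof (Psi_le t z w hne ht hw ltac:(lra)) as hP.
    pose proof (Cmod_sub_pos _ _ hne) as hD0.
    assert (hD2 : 0 < Cmod (w - z)%C ^ 2) by now apply pow_lt.
    set (D := Cmod (w - z)%C ^ 2) in *.
    apply Rmult_le_reg_r with D; [easy|].
    eapply Rle_trans; [exact hP|].
    assert (h3 : 10 * snd w <= 5 * D * (eta * Vpot x0 gam w)).
    { eapply Rle_trans; [exact h1|]. apply Rmult_le_compat_r; lra. }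
    assert (snd z * (2 * snd w) <= snd z * (D * (eta * Vpot x0 gam w))) by (apply Rmult_le_compat_l; lra).
    lra.
  - destruct (classic (w = z)) as [->|hne]; [lra|].
    rewrite Psi_formula by (auto; lra).
    replace (2 * snd w - t) with 0 by lra.
    replace (1 + 0 * (2 * snd z - t) / Cmod (w - z) ^ 2) with 1 by (unfold Rdiv; ring).
    rewrite ln_1. nra.
Qed.

(* Maximum principle: at an interior maximum the strictly subharmonic [ln|g| + expo] would violate
   the four-point inequality, and on the rest of [Om] every Green term is dominated by [Vpot]. *)
Lemma box_max (x0 gam eta s t A K : R) U g zs :
  0 < gam < 1 -> 0 < eta -> 0 < s -> 0 < t -> 0 < A ->
  (forall w, Om x0 gam eta s t w -> U w <= A * Vpot x0 gam w) ->
  datum U g K zs ->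
  (forall p, In p zs -> s <= dist0 x0 (fst p) <= 2 * s /\ t <= snd (fst p)) ->
  Om x0 gam eta s t Ci ->
  expo x0 gam eta t (K * A) zs Ci <= 0.
Proof.
  intros hg he hs ht hA hUA hdat hbox hi.
  assert (hzt : forall p, In p zs -> t <= snd (fst p)) by (intros p hp; now apply hbox).
  set (T := fun z => Cmod (g z) * exp (expo x0 gam eta t (K * A) zs z)).
  destruct (Om_in_rect x0 gam eta s hg he hs) as [B HB].
  destruct (usc_attains (Om x0 gam eta s t) T B) as [w [hw hmax]].
  - intros w hw. now apply (HB t w).
  - intros w hw. now apply Om_closed.
  - intros w hw e hep. apply near_imp with (2 := usc_T x0 gam eta s t (K * A) K U g zs w ht hdat hzt hw e hep).
    intros z hz _. exact hz.
  - now exists Ci.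
  - pose proof (hmax Ci hi) as hTi.
    destruct hdat as [hK [hhol [hgi [hU [hnd hz]]]]].
    assert (E : T Ci = exp (expo x0 gam eta t (K * A) zs Ci)) by (unfold T; rewrite hgi; ring).
    rewrite E in hTi. pose proof (exp_pos (expo x0 gam eta t (K * A) zs Ci)) as hpos.
    assert (hw0 : 0 < snd w) by (destruct hw; lra).
    assert (hup : upper w) by exact hw0.
    (* The maximum is at least T(i) > 0, so it is not attained at a zero of [g]. *)
    assert (hgw : g w <> 0%C).
    { intros E0. unfold T in hTi at 1. rewrite E0, Cmod_0 in hTi. lra. }
    assert (hgw0 : 0 < Cmod (g w)) by now apply Cmod_gt_0.
    assert (hnz : forall p, In p zs -> t <= snd (fst p) /\ fst p <> w).
    { intros p hp. split; [auto|]. intros Ep. apply hgw. destruct (hz p hp) as [_ [hm hb]].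
      rewrite Ep in hb. now apply zero_bd_zero with (snd p). }
    destruct (classic (t / 2 < snd w /\
      ((dist0 x0 w ^ 2 + s ^ 2) * (eta * Vpot x0 gam w) < 10 * snd w \/ s / 2 < dist0 x0 w < 4 * s)))
      as [[hi1 hi2]|hb].
    + exfalso. destruct (sub4_expo x0 gam eta t (K * A) zs w hg he ht ltac:(nra) hw0 ltac:(lra) hnz)
        as [lam [hlam Hs]].
      pose proof (sub4_plus _ _ _ _ _ (sub4_ln_Cmod g w 1 (hhol w hup) hgw) Hs) as Hv.
      rewrite Rplus_0_l in Hv.
      apply (four_bound_contra _ _ _ hlam Hv).
      apply near_imp with (2 := near_and _ _ _ (Om_interior x0 gam eta s t w ht hi1 hi2)
         (hol2_nonzero_near g w (hhol w hup) hgw)).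
      intros z [ho hgz]. specialize (hmax z ho). unfold T in hmax.
      assert (hgz0 : 0 < Cmod (g z)) by now apply Cmod_gt_0.
      apply ln_le in hmax; [|apply Rmult_lt_0_compat; [easy|apply exp_pos]].
      rewrite !ln_mult, !ln_exp in hmax by (auto using exp_pos). lra.
    (* Maximum on the frontier: the Green terms are at most 0 and -K A V cancels the majorant of
       ln|g|, so T <= 1. *)
    + assert (h1 : expo x0 gam eta t (K * A) zs w <= - (K * A) * Vpot x0 gam w).
      { unfold expo. apply Rle_trans with (0 + - (K * A) * Vpot x0 gam w); [|lra].
        apply Rplus_le_compat_r. rewrite <- (zsum_zero zs). apply zsum_le. intros p hp.
        destruct (hbox p hp) as [b1 b2].
        pose proof (Psi_le_on_boundary x0 gam eta s t (fst p) w hg he hs ht b1 b2 hw hb). lra. }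
      pose proof (hU w hup hgw) as h2. pose proof (hUA w hw) as h3.
      assert (h4 : ln (Cmod (g w)) <= K * (A * Vpot x0 gam w)).
      { eapply Rle_trans; [exact h2|]. apply Rmult_le_compat_l; lra. }
      assert (h5 : T w <= 1).
      { unfold T. rewrite <- (exp_ln (Cmod (g w))) by easy. rewrite <- exp_plus, <- exp_0.
        apply exp_le. lra. }
      apply Rnot_lt_le. intros hc. apply exp_increasing in hc. rewrite exp_0 in hc. lra.
Qed.

Lemma zsum_Im_Psi (x0 gam eta t c0 : R) (zs : list (C * nat)) :
  (forall p, In p zs -> c0 * snd (fst p) <= Psi t (fst p) Ci - snd (fst p) * (eta * Vpot x0 gam Ci)) ->
  c0 / 2 * zsum zs Im <= zsum zs (fun z => / 2 * (Psi t z Ci - snd z * (eta * Vpot x0 gam Ci))).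
Proof.
  intros H. rewrite <- zsum_scal. apply zsum_le. intros p hp. specialize (H p hp). unfold Im. lra.
Qed.

(** The constants depend on x0, gam and S only; being uniform in s and t, they can be used for all
    dyadic boxes at once. *)
Lemma box_bound (x0 gam S : R) : 0 < gam < 1 -> 0 < S ->
  exists eta c, 0 < eta /\ 0 < c /\
  forall s t A U g K zs, 0 < s <= S -> 0 < t <= 1 -> 0 < A ->
  (forall w, Om x0 gam eta s t w -> U w <= A * Vpot x0 gam w) ->
  datum U g K zs ->
  (forall p, In p zs -> s <= dist0 x0 (fst p) <= 2 * s /\ t <= snd (fst p)) ->
  zsum zs Im <= c * A * K.
Proof.
  intros hg hS.
  assert (hV : 0 < Vpot x0 gam Ci).
  { destruct (Vpot_bounds x0 gam Ci hg ltac:(simpl; lra)) as [h _].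
    eapply Rlt_le_trans; [|exact h]. apply exp_pos. }
  set (V := Vpot x0 gam Ci) in *.
  set (D := (dist0 x0 Ci + 2 * S) ^ 2).
  assert (hd0 : 0 < dist0 x0 Ci) by (apply dist_R_pos; simpl; lra).
  assert (hD : 0 < D) by (unfold D; apply pow_lt; lra).
  set (c0 := / (2 * (D + 2 * S))). assert (hc0 : 0 < c0) by (unfold c0; apply Rinv_0_lt_compat; lra).
  set (Q := dist0 x0 Ci ^ 2 + S ^ 2).
  assert (hQ : 0 < Q) by (unfold Q; pose proof (pow_lt _ 2 hd0); pose proof (pow_lt _ 2 hS); lra).
  (* The first bound lets the correction Im z eta V(i) use up at most half of the lower bound c0 Im
     z of Green's function at i; the second puts i into [Om] for every s <= S. *)
  set (eta := Rmin (c0 / (2 * V)) (10 / (Q * V))).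
  assert (heta : 0 < eta).
  { unfold eta. apply Rmin_glb_lt; apply Rdiv_lt_0_compat; nra. }
  assert (h1 : eta * V <= c0 / 2).
  { apply Rle_trans with (c0 / (2 * V) * V); [|right; field; lra].
    apply Rmult_le_compat_r; [lra|apply Rmin_l]. }
  assert (h2 : Q * (eta * V) <= 10).
  { apply Rle_trans with (Q * (10 / (Q * V) * V)); [|right; field; lra].
    apply Rmult_le_compat_l; [lra|]. apply Rmult_le_compat_r; [lra|apply Rmin_r]. }
  exists eta, (4 / c0 * V). split; [easy|]. split.
  { apply Rmult_lt_0_compat; [apply Rdiv_lt_0_compat; lra|easy]. }
  intros s t A U g K zs hs ht hA hUA hdat hbox.
  assert (hCi : snd Ci = 1) by reflexivity.
  assert (hOi : Om x0 gam eta s t Ci).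
  { split; [rewrite hCi; lra|]. left. rewrite hCi. fold V.
    apply Rle_trans with (Q * (eta * V)); [|lra].
    apply Rmult_le_compat_r; [apply Rmult_le_pos; lra|]. unfold Q.
    apply Rplus_le_compat_l. apply pow_incr. lra. }
  pose proof (box_max x0 gam eta s t A K U g zs hg heta ltac:(lra) ltac:(lra) hA hUA hdat hbox hOi) as hm.
  unfold expo in hm. fold V in hm.
  pose proof hdat as hdat'.
  destruct hdat' as [hK [hhol [hgi [hU [hnd hz]]]]].
  assert (hpt : forall p, In p zs -> c0 / 2 * snd (fst p) <= Psi t (fst p) Ci - snd (fst p) * (eta * Vpot x0 gam Ci)).
  { intros p hp. fold V. destruct (hbox p hp) as [b1 b2]. destruct (hz p hp) as [bu [bm bz]].
    set (z := fst p) in *.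
    (* The normalisation |g(i)| = 1 keeps the zeros away from i. *)
    assert (hzi : Ci <> z).
    { intros E. rewrite <- E in bz. rewrite (zero_bd_zero g Ci (snd p) bm bz), Cmod_0 in hgi. lra. }
    pose proof (Im_le_dist z x0 bu) as hyz. fold (dist0 x0 z) in hyz.
    assert (hDz : Cmod (Ci - z)%C ^ 2 <= D).
    { unfold D. apply pow_incr. split; [apply Cmod_ge_0|].
      replace (Ci - z)%C with ((Ci - RtoC x0) + - (z - RtoC x0))%C by ring.
      eapply Rle_trans; [apply Cmod_triangle|]. rewrite Cmod_opp.
      fold (dist0 x0 Ci). fold (dist0 x0 z). lra. }
    pose proof (Psi_ge t z Ci D hzi ht ltac:(rewrite hCi; lra) b2 hDz) as hP.
    assert (hyp : 0 < snd z) by exact bu.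
    assert (hc : c0 * snd z <= snd z / (2 * (D + snd z))).
    { unfold Rdiv. rewrite Rmult_comm. apply Rmult_le_compat_l; [lra|].
      unfold c0. apply Rinv_le_contravar; lra. }
    assert (snd z * (eta * V) <= snd z * (c0 / 2)) by (apply Rmult_le_compat_l; lra).
    lra. }
  pose proof (zsum_Im_Psi x0 gam eta t (c0 / 2) zs hpt) as hf. fold V in hf.
  apply Rmult_le_reg_l with (c0 / 2 / 2); [lra|].
  replace (c0 / 2 / 2 * (4 / c0 * V * A * K)) with (K * A * V) by (field; lra). lra.
Qed.

(** * Local Blaschke bounds *)

Definition decb (P : Prop) : bool := if excluded_middle_informative P then true else false.

Lemma decb_true (P : Prop) : decb P = true <-> P.
Proof. unfold decb. destruct (excluded_middle_informative P); split; intros; auto; try easy. Qed.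

Lemma NoDup_map_filter (zs : list (C * nat)) f : NoDup (map fst zs) -> NoDup (map fst (filter f zs)).
Proof.
  induction zs as [|p zs IH]; intros H; [constructor|]. simpl in *. inversion H; subst.
  destruct (f p); simpl; [|auto]. constructor; [|auto].
  intros hin. apply in_map_iff in hin. destruct hin as [q [hq hin]].
  apply filter_In in hin. apply H2. rewrite <- hq. apply in_map. tauto.
Qed.

Lemma datum_filter U g K zs (f : C * nat -> bool) :
  datum U g K zs -> datum U g K (filter f zs).
Proof.
  intros [hK [h1 [h2 [h3 [h4 h5]]]]]. repeat (split; [assumption|]). split.
  - now apply NoDup_map_filter.
  - intros p hp. apply filter_In in hp. now apply h5.
Qed.

Lemma zsum_filter_split (f : C * nat -> bool) (zs : list (C * nat)) (F : C -> R) :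
  zsum zs F = zsum (filter f zs) F + zsum (filter (fun p => negb (f p)) zs) F.
Proof.
  unfold zsum. induction zs as [|p zs IH]; simpl; [ring|].
  destruct (f p); simpl; rewrite IH; ring.
Qed.

(** The bound is uniform in [g], [K] and the list, so finitely many of them can be added over a
    cover. *)
Definition bounded_sum (U : C -> R) (S : C -> Prop) (F : C -> R) : Prop :=
  exists B, 0 <= B /\ forall g K zs, datum U g K zs ->
    (forall p, In p zs -> S (fst p)) -> zsum zs F <= B * K.

Lemma bounded_sum_union U S1 S2 (S : C -> Prop) F :
  bounded_sum U S1 F -> bounded_sum U S2 F ->
  (forall z, upper z -> S z -> S1 z \/ S2 z) -> bounded_sum U S F.
Proof.
  intros [B1 [h1 K1]] [B2 [h2 K2]] hS. exists (B1 + B2). split; [lra|].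
  intros g K zs hd hz.
  rewrite (zsum_filter_split (fun p => decb (S1 (fst p)))).
  pose proof (K1 g K _ (datum_filter U g K zs (fun p => decb (S1 (fst p))) hd)) as k1.
  pose proof (K2 g K _ (datum_filter U g K zs (fun p => negb (decb (S1 (fst p)))) hd)) as k2.
  rewrite Rmult_plus_distr_r. apply Rplus_le_compat.
  - apply k1. intros p hp. apply filter_In in hp. now apply decb_true.
  - apply k2. intros p hp. apply filter_In in hp. destruct hp as [hp hb].
    destruct hd as [_ [_ [_ [_ [_ h5]]]]].
    destruct (hS (fst p) (proj1 (h5 p hp)) (hz p hp)) as [h|h]; [|easy].
    apply decb_true in h. rewrite h in hb. discriminate.
Qed.

Lemma bounded_sum_le U (S S' : C -> Prop) F F' (c : R) :
  0 <= c -> (forall z, upper z -> S z -> S' z /\ F z <= c * F' z) ->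
  bounded_sum U S' F' -> bounded_sum U S F.
Proof.
  intros hc hS [B [hB H]]. exists (c * B). split; [nra|]. intros g K zs hd hz.
  pose proof hd as [hK [_ [_ [_ [_ h5]]]]].
  apply Rle_trans with (zsum zs (fun z => c * F' z)).
  - apply zsum_le. intros p hp. apply hS; [now apply h5|auto].
  - rewrite zsum_scal, Rmult_assoc. apply Rmult_le_compat_l; [easy|]. apply (H g K zs hd).
    intros p hp. apply hS; [now apply h5|auto].
Qed.

(** Scales s1 2^-k contribute a geometric series of ratio q = 2^-delta, bounded by 1 / (1 - q) for
    any number of scales. The function [rho] is left free: it will be the height first, then the
    distance to a boundary point. *)
Lemma dyadic_sum (delta : R) : 0 < delta -> exists c, 0 < c /\
  forall (U : C -> R) (S : C -> Prop) (F rho : C -> R) (s1 B : R),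
  0 < s1 -> 0 <= B -> (forall z, upper z -> 0 < rho z) ->
  (forall s g K zs, 0 < s <= s1 -> datum U g K zs ->
     (forall p, In p zs -> S (fst p) /\ s <= rho (fst p) <= 2 * s) ->
     zsum zs F <= B * Rpower s delta * K) ->
  forall g K zs, datum U g K zs ->
   (forall p, In p zs -> S (fst p) /\ rho (fst p) < 2 * s1) ->
   zsum zs F <= B * Rpower s1 delta * c * K.
Proof.
  intros hd. set (q := Rpower (/ 2) delta).
  assert (hq : 0 < q < 1).
  { split; [apply exp_pos|]. unfold q, Rpower. rewrite <- exp_0. apply exp_increasing.
    rewrite ln_Rinv by lra. pose proof ln_lt_2. nra. }
  exists (/ (1 - q)). split; [apply Rinv_0_lt_compat; lra|].
  intros U S F rho s1 B hs1 hB hrho H g K.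
  assert (HN : forall N zs, datum U g K zs ->
     (forall p, In p zs -> S (fst p) /\ 2 * s1 * (/ 2) ^ N <= rho (fst p) < 2 * s1) ->
     zsum zs F <= B * Rpower s1 delta * ((1 - q ^ N) / (1 - q)) * K).
  { induction N as [|N IH]; intros zs hdat hz.
    - destruct zs as [|p zs].
      + simpl. unfold zsum. simpl. right. field. lra.
      + exfalso. destruct (hz p (or_introl eq_refl)) as [_ h]. simpl in h. lra.
    - pose (f := fun p : C * nat => decb (2 * s1 * (/ 2) ^ N <= rho (fst p))).
      rewrite (zsum_filter_split f).
      pose proof (IH _ (datum_filter U g K zs f hdat)) as k1.
      assert (hh : 0 < (/ 2) ^ N) by (apply pow_lt; lra).
      assert (hh1 : (/ 2) ^ N <= 1) by (rewrite <- (pow1 N); apply pow_incr; lra).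
      assert (hs2 : 0 < s1 * (/ 2) ^ N <= s1).
      { split; [now apply Rmult_lt_0_compat|]. rewrite <- (Rmult_1_r s1) at 2. apply Rmult_le_compat_l; lra. }
      pose proof (H (s1 * (/ 2) ^ N) g K _ hs2 (datum_filter U g K zs (fun p => negb (f p)) hdat)) as k2.
      assert (k1' : zsum (filter f zs) F <= B * Rpower s1 delta * ((1 - q ^ N) / (1 - q)) * K).
      { apply k1. intros p hp. apply filter_In in hp. destruct hp as [hp hf].
        apply (proj1 (decb_true (2 * s1 * (/ 2) ^ N <= rho (fst p)))) in hf.
        destruct (hz p hp) as [z1 z2]. split; [easy|]. lra. }
      assert (k2' : zsum (filter (fun p => negb (f p)) zs) F <= B * Rpower (s1 * (/ 2) ^ N) delta * K).
      { apply k2. intros p hp. apply filter_In in hp. destruct hp as [hp hf].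
        destruct (hz p hp) as [z1 z2]. split; [easy|]. simpl in z2.
        assert (~ 2 * s1 * (/ 2) ^ N <= rho (fst p)).
        { intros hc. apply decb_true in hc. unfold f in hf. rewrite hc in hf. discriminate. }
        lra. }
      assert (E : Rpower (s1 * (/ 2) ^ N) delta = Rpower s1 delta * q ^ N).
      { rewrite <- Rpower_mult_distr by lra. f_equal. unfold q.
        rewrite <- !Rpower_pow by (try apply exp_pos; lra). rewrite !Rpower_mult. f_equal. ring. }
      rewrite E in k2'.
      replace (B * Rpower s1 delta * ((1 - q ^ Datatypes.S N) / (1 - q)) * K) with
        (B * Rpower s1 delta * ((1 - q ^ N) / (1 - q)) * K + B * (Rpower s1 delta * q ^ N) * K)
        by (simpl; field; lra).
      lra. }
  intros zs hdat hz.
  (* A finite list meets finitely many scales; [N] depends on it, the constant does not. *)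
  assert (hex : exists N, forall p, In p zs -> 2 * s1 * (/ 2) ^ N <= rho (fst p)).
  { destruct hdat as [_ [_ [_ [_ [_ h5]]]]]. clear hz HN H.
    induction zs as [|p zs IH]; [exists 0%nat; easy|].
    destruct IH as [N HN]; [intros; apply h5; now right|].
    destruct (h5 p (or_introl eq_refl)) as [hu _]. pose proof (hrho _ hu) as hr.
    destruct (pow_lt_1_zero (/ 2) ltac:(rewrite Rabs_pos_eq; lra) (rho (fst p) / (2 * s1))
       ltac:(apply Rdiv_lt_0_compat; lra)) as [M HM].
    exists (Nat.max N M). intros q0 [<-|hin].
    - specialize (HM (Nat.max N M) ltac:(lia)).
      rewrite Rabs_pos_eq in HM by (apply pow_le; lra).
      apply Rmult_lt_compat_l with (r := 2 * s1) in HM; [|lra].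
      replace (2 * s1 * (rho (fst p) / (2 * s1))) with (rho (fst p)) in HM by (field; lra). lra.
    - specialize (HN q0 hin). apply Rle_trans with (2 * s1 * (/ 2) ^ N); [|easy].
      apply Rmult_le_compat_l; [lra|].
      replace (Nat.max N M) with (N + (Nat.max N M - N))%nat by lia. rewrite pow_add.
      assert (0 < (/ 2) ^ N) by (apply pow_lt; lra).
      assert ((/ 2) ^ (Nat.max N M - N) <= 1) by (rewrite <- (pow1 (Nat.max N M - N)); apply pow_incr; lra).
      nra. }
  destruct hex as [N hN].
  pose proof (HN N zs hdat ltac:(intros p hp; destruct (hz p hp); split; auto)) as h.
  pose proof hdat as [hK _].
  eapply Rle_trans; [exact h|]. apply Rmult_le_compat_r; [lra|]. apply Rmult_le_compat_l.
  - apply Rmult_le_pos; [easy|left; apply exp_pos].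
  - unfold Rdiv. assert (0 < q ^ N) by (apply pow_lt; lra).
    assert (0 < / (1 - q)) by (apply Rinv_0_lt_compat; lra). nra.
Qed.

(* The three alternatives are, in logarithms, the parts [|w - x0| ~ s], [|w - x0| < s] and
   [|w - x0| > s] of the region [Om]. *)
Lemma log_box (a sig gam nu k ls lt lr ly : R) :
  0 <= a -> - a <= sig -> 0 < gam < 1 -> (1 - gam) * (a + Rabs sig) <= nu -> 0 <= k ->
  ls <= 0 -> lr <= 0 -> lt <= ls + k ->
  (lt - k <= ly /\ ls - k <= lr <= ls + k) \/
  (lt - k <= ly /\ lr <= ls /\ 2 * ls - k <= (1 + gam) * lr) \/
  (ls <= lr /\ (2 - gam) * lr - k <= ly) ->
  - a * ly - sig * lr <= - a * lt - (sig + nu) * ls + 2 * (a + Rabs sig) * k.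
Proof.
  intros ha hs hg hnu hk hls hlr hlt H.
  pose proof (Rabs_pos sig) as hp.
  assert (hnu0 : 0 <= nu) by nra.
  assert (hak : 0 <= a * k) by nra. assert (hsk : 0 <= Rabs sig * k) by nra.
  assert (hnl : nu * ls <= 0) by nra.
  pose proof (Rle_abs sig) as q1. pose proof (Rle_abs (- sig)) as q2. rewrite Rabs_Ropp in q2.
  destruct H as [[h1 h2]|[[h1 [h2 h3]]|[h1 h2]]].
  - assert (- a * ly <= - a * lt + a * k) by nra.
    assert (- sig * lr <= - sig * ls + Rabs sig * k).
    { destruct (Rle_or_lt 0 sig); [rewrite Rabs_pos_eq by lra|rewrite Rabs_left by lra]; nra. }
    lra.
  - assert (- a * ly <= - a * lt + a * k) by nra.
    destruct (Rle_or_lt 0 sig) as [h|h].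
    + rewrite Rabs_pos_eq in * by lra.
      (* r is at least s^(2-gam) up to a constant, because 2 <= (2 - gam)(1 + gam); the surplus
         s^(1-gam) is paid for by nu. *)
      assert (hlr2 : ls + (1 - gam) * ls - k <= lr).
      { apply Rmult_le_reg_l with (1 + gam); [lra|]. nra. }
      assert (- sig * lr <= - sig * (ls + (1 - gam) * ls - k)) by nra.
      assert (h9 : (1 - gam) * sig <= nu) by nra.
      assert (nu * ls <= (1 - gam) * sig * ls) by nra. nra.
    + rewrite Rabs_left in * by lra. assert (- sig * lr <= - sig * ls) by nra. nra.
  - assert (e1 : - a * ly <= - a * ((2 - gam) * lr - k)) by nra.
    (* Here sig >= -a is decisive: once y is replaced by r^(2-gam), the main power r^-(a+sig) is
       largest at r = s. *)
    assert (e2 : - (a + sig) * lr <= - (a + sig) * ls) by nra.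
    assert (e3 : - (a * (1 - gam)) * lr <= - nu * ls).
    { assert (0 <= a * (1 - gam)) by nra. assert (a * (1 - gam) <= nu) by nra. nra. }
    assert (e4 : - a * ls <= - a * lt + a * k) by nra. nra.
Qed.

Definition loc_bdd (U : C -> R) : Prop :=
  forall d R0, 0 < d -> exists M, forall w : C, d <= snd w -> Cmod w <= R0 -> U w <= M.

Lemma Cmod_le_dist0 (x0 : R) (w : C) : Cmod w <= dist0 x0 w + Rabs x0.
Proof.
  replace w with ((w - RtoC x0) + RtoC x0)%C at 1 by ring.
  eapply Rle_trans; [apply Cmod_triangle|]. rewrite Cmod_R. apply Rle_refl.
Qed.

Lemma loc_bdd_Vpot (U : C -> R) (x0 gam d R0 : R) : loc_bdd U -> 0 < gam < 1 -> 0 < d -> 0 < R0 ->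
  exists M, 0 < M /\ forall w, d <= snd w -> dist0 x0 w <= R0 -> U w <= M * Vpot x0 gam w.
Proof.
  intros hU hg hd hR. destruct (hU d (R0 + Rabs x0) hd) as [M HM].
  exists ((Rabs M + 1) * Rpower R0 gam). pose proof (Rabs_pos M) as h0.
  assert (hp : 0 < Rpower R0 gam) by apply exp_pos.
  split; [nra|]. intros w hw hr.
  assert (hw0 : 0 < snd w) by lra.
  assert (h1 : U w <= Rabs M + 1).
  { pose proof (Cmod_le_dist0 x0 w). specialize (HM w hw ltac:(lra)). pose proof (Rle_abs M). lra. }
  destruct (Vpot_bounds x0 gam w hg hw0) as [h2 _]. fold (dist0 x0 w) in h2.
  pose proof (dist_R_pos w x0 hw0) as h3. fold (dist0 x0 w) in h3.
  assert (h4 : 1 <= Rpower R0 gam * Vpot x0 gam w).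
  { apply Rle_trans with (Rpower R0 gam * Rpower R0 (- gam)).
    - rewrite <- Rpower_plus. replace (gam + - gam) with 0 by ring. rewrite Rpower_O; lra.
    - apply Rmult_le_compat_l; [lra|]. apply Rle_trans with (Rpower (dist0 x0 w) (- gam)); [|easy].
      rewrite !Rpower_Ropp. apply Rinv_le_contravar; [apply exp_pos|].
      apply Rpower_le_compat; lra. }
  rewrite Rmult_assoc. nra.
Qed.

(** Two regimes: at distance at least r0 the cusp keeps [Om] in a bounded set at height at least d,
    uniformly in s and t, where U is bounded; closer to x0 the local bound and [log_box] apply. *)
Lemma local_majorant (U : C -> R) (x0 gam eta a sig nu r0 C0 : R) :
  loc_bdd U -> 0 <= a -> - a <= sig -> 0 < gam < 1 -> 0 < eta ->
  (1 - gam) * (a + Rabs sig) <= nu -> 0 < r0 <= 1 -> 0 < C0 ->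
  (forall w, 0 < snd w -> dist0 x0 w < r0 ->
     U w <= C0 * (Rpower (snd w) (- a) * Rpower (dist0 x0 w) (- (sig + gam)))) ->
  exists C1, 0 < C1 /\ forall s t w, 0 < s -> 4 * s < r0 -> 0 < t <= 2 * s ->
    Om x0 gam eta s t w ->
    U w <= C1 * (Rpower t (- a) * Rpower s (- (sig + nu))) * Vpot x0 gam w.
Proof.
  intros hU ha hs hg he hnu hr0 hC0 hloc.
  (* Absorbs the factors 2, 4 and 10 / eta from the definition of [Om]. *)
  set (k := ln 4 + Rabs (ln (10 / eta))).
  assert (hln2 : 0 < ln 2) by (rewrite <- ln_1; apply ln_increasing; lra).
  assert (hln4 : ln 4 = 2 * ln 2).
  { replace 4 with (2 * 2) by ring. rewrite ln_mult; lra. }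
  pose proof (Rabs_pos (ln (10 / eta))) as hk0. pose proof (Rle_abs (ln (10 / eta))) as hk1.
  assert (hlne : ln (10 / eta) = ln 10 - ln eta) by (rewrite ln_div; lra).
  pose proof (Rabs_pos sig) as hsa.
  assert (hnu0 : 0 <= nu) by nra.
  assert (hsn : 0 <= a + sig + nu) by lra.
  set (R0 := Rpower (10 / eta) (/ (1 - gam))).
  set (d := eta * Rpower r0 (2 - gam) / 10).
  assert (hd : 0 < d).
  { unfold d. apply Rdiv_lt_0_compat; [|lra]. apply Rmult_lt_0_compat; [lra|apply exp_pos]. }
  destruct (loc_bdd_Vpot U x0 gam d R0 hU hg hd ltac:(apply exp_pos)) as [M [hM HM]].
  set (C2 := M * Rpower 2 a). set (C3 := C0 * exp (2 * (a + Rabs sig) * k)).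
  assert (hC2 : 0 < C2) by (apply Rmult_lt_0_compat; [easy|apply exp_pos]).
  assert (hC3 : 0 < C3) by (apply Rmult_lt_0_compat; [easy|apply exp_pos]).
  exists (C2 + C3). split; [lra|].
  intros s t w hs0 hs4 ht hw.
  assert (hw0 : 0 < snd w) by (destruct hw; lra).
  pose proof (dist_R_pos w x0 hw0) as hrp. fold (dist0 x0 w) in hrp.
  pose proof (Im_le_dist w x0 hw0) as hyr. fold (dist0 x0 w) in hyr.
  destruct (Vpot_bounds x0 gam w hg hw0) as [hV _]. fold (dist0 x0 w) in hV.
  assert (hV0 : 0 < Vpot x0 gam w) by (eapply Rlt_le_trans; [apply exp_pos|exact hV]).
  set (r := dist0 x0 w) in *. set (V := Vpot x0 gam w) in *.
  assert (hls : ln s <= 0).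
  { rewrite <- ln_1. apply ln_le; lra. }
  assert (hlt : ln t <= ln s + ln 2).
  { rewrite <- ln_mult by lra. apply ln_le; lra. }
  set (W := Rpower t (- a) * Rpower s (- (sig + nu))).
  assert (hW : 0 < W) by (apply Rmult_lt_0_compat; apply exp_pos).
  assert (hWe : W = exp (- a * ln t - (sig + nu) * ln s)).
  { unfold W, Rpower. rewrite <- exp_plus. f_equal. ring. }
  assert (hsplit : (C2 + C3) * W * V = C2 * W * V + C3 * W * V) by ring.
  assert (hWV : 0 < W * V) by now apply Rmult_lt_0_compat.
  rewrite hsplit.
  destruct (Rle_or_lt r0 r) as [hrr|hrr].
  - destruct hw as [hwt [hwo|hwo]]; [|fold r in hwo; lra].
    pose proof (Om_outer_bounded x0 gam eta s w hg he hw0 hwo) as hb. fold r in hb.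
    destruct (Om_outer x0 gam eta s w hg he hw0 hwo) as [ho _]. fold r in ho.
    assert (hdw : d <= snd w).
    { unfold d. assert (Rpower r0 (2 - gam) <= Rpower r (2 - gam)) by (apply Rpower_le_compat; lra). nra. }
    pose proof (HM w hdw hb) as h1. fold V in h1.
    (* As t <= 2s, W is at least 2^-a s^-(a+sig+nu), and a + sig + nu >= 0 with s <= 1. *)
    assert (h2 : 1 <= Rpower 2 a * W).
    { rewrite hWe. unfold Rpower. rewrite <- exp_plus, <- exp_0. apply exp_le. nra. }
    assert (h3 : M * V * 1 <= M * V * (Rpower 2 a * W)) by (apply Rmult_le_compat_l; nra).
    assert (C2 * W * V = M * V * (Rpower 2 a * W)) by (unfold C2; ring).
    assert (0 < C3 * (W * V)) by now apply Rmult_lt_0_compat. lra.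
  - pose proof (hloc w hw0 hrr) as h1. fold r in h1.
    assert (hlr : ln r <= 0) by (rewrite <- ln_1; apply ln_le; lra).
    assert (hlog : - a * ln (snd w) - sig * ln r <=
        - a * ln t - (sig + nu) * ln s + 2 * (a + Rabs sig) * k).
    { apply (log_box a sig gam nu k); auto; [unfold k; lra|unfold k; lra|].
      destruct hw as [hwt hwo].
      assert (hly : ln t - k <= ln (snd w)).
      { assert (ln (t / 2) <= ln (snd w)) by (apply ln_le; lra). rewrite ln_div in H by lra. unfold k; lra. }
      destruct (classic (s / 2 <= r <= 4 * s)) as [hmid|hmid].
      - left. split; [easy|].
        assert (q1 : ln (s / 2) <= ln r) by (apply ln_le; lra).
        assert (q2 : ln r <= ln (4 * s)) by (apply ln_le; lra).
        rewrite ln_div in q1 by lra. rewrite ln_mult in q2 by lra. unfold k. lra.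
      - right. fold r in hwo. destruct hwo as [hwo|hwo]; [|contradiction].
        destruct (Om_outer x0 gam eta s w hg he hw0 hwo) as [ho1 ho2]. fold r in ho1, ho2.
        apply ln_le in ho1; [|apply Rmult_lt_0_compat; [easy|apply exp_pos]].
        assert (hs2 : 0 < s ^ 2) by now apply pow_lt.
        assert (hes : 0 < eta * s ^ 2) by now apply Rmult_lt_0_compat.
        apply ln_le in ho2; [|apply Rmult_lt_0_compat; [easy|apply exp_pos]].
        rewrite !ln_mult in ho1 by (try apply exp_pos; lra).
        rewrite !ln_mult in ho2 by (try apply exp_pos; lra).
        rewrite ln_pow in ho2 by lra. unfold Rpower in ho1, ho2. rewrite ln_exp in ho1, ho2.
        simpl INR in ho2.
        assert (hlyr : ln (snd w) <= ln r) by (apply ln_le; lra).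
        destruct (Rlt_or_le r s) as [hrs|hrs].
        + left. split; [easy|]. split; [apply ln_le; lra|]. unfold k. lra.
        + right. split; [apply ln_le; lra|]. unfold k. lra. }
    assert (h2 : Rpower (snd w) (- a) * Rpower r (- sig) <= exp (2 * (a + Rabs sig) * k) * W).
    { rewrite hWe. unfold Rpower. rewrite <- !exp_plus. apply exp_le. lra. }
    assert (h3 : Rpower r (- (sig + gam)) = Rpower r (- sig) * Rpower r (- gam)).
    { rewrite <- Rpower_plus. f_equal. ring. }
    rewrite h3, <- (Rmult_assoc (Rpower (snd w) (- a))) in h1.
    set (P := Rpower (snd w) (- a) * Rpower r (- sig)) in *.
    assert (hP : 0 < P) by (apply Rmult_lt_0_compat; apply exp_pos).
    set (Q := exp (2 * (a + Rabs sig) * k) * W) in *.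
    assert (h4 : P * Rpower r (- gam) <= Q * V).
    { apply Rmult_le_compat; auto; [lra|left; apply exp_pos]. }
    apply Rmult_le_compat_l with (r := C0) in h4; [|lra].
    assert (C3 * W * V = C0 * (Q * V)) by (unfold C3, Q; ring).
    assert (0 < C2 * (W * V)) by now apply Rmult_lt_0_compat. lra.
Qed.

Lemma Rpower_two_sided (s r q : R) : 0 < s -> s <= r <= 2 * s ->
  Rpower r q <= Rpower 2 (Rabs q) * Rpower s q.
Proof.
  intros hs hr. unfold Rpower. rewrite <- exp_plus. apply exp_le.
  assert (h1 : ln s <= ln r) by (apply ln_le; lra).
  assert (h2 : ln r <= ln 2 + ln s) by (rewrite <- ln_mult by lra; apply ln_le; lra).
  destruct (Rle_or_lt 0 q); [rewrite Rabs_pos_eq by lra|rewrite Rabs_left by lra]; nra.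
Qed.

Lemma upper_Im_pos (z : C) : upper z -> 0 < Im z.
Proof. auto. Qed.

(** Two nested dyadic sums, over the height t at fixed s and then over s; half of [eps] pays for the
    loss nu, the rest makes both series converge. *)
Lemma local_bounded_sum (U : C -> R) (x0 gam a sig eps r0 C0 : R) :
  loc_bdd U -> 0 <= a -> - a <= sig -> 0 < gam < 1 -> 0 < eps ->
  (1 - gam) * (a + Rabs sig) <= eps / 2 -> 0 < r0 <= 1 -> 0 < C0 ->
  (forall w, 0 < snd w -> dist0 x0 w < r0 ->
     U w <= C0 * (Rpower (snd w) (- a) * Rpower (dist0 x0 w) (- (sig + gam)))) ->
  exists rho, 0 < rho /\ bounded_sum U (fun z => dist0 x0 z < rho)
    (fun z => Rpower (Im z) (a + 1 + eps) * Rpower (dist0 x0 z) sig).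
Proof.
  intros hU ha hs hg he hnu hr0 hC0 hloc.
  destruct (box_bound x0 gam 1 hg ltac:(lra)) as [eta [c [heta [hc hbox]]]].
  destruct (local_majorant U x0 gam eta a sig (eps / 2) r0 C0 hU ha hs hg heta hnu hr0 hC0 hloc)
    as [C1 [hC1 hmaj]].
  destruct (dyadic_sum (eps / 4) ltac:(lra)) as [cd [hcd hdy]].
  set (F := fun z : C => Rpower (Im z) (a + 1 + eps) * Rpower (dist0 x0 z) sig).
  (* Ensures 4s < r0 and t <= 2s <= 1 for all boxes considered. *)
  set (s1 := r0 / 8).
  set (C2 := Rpower 2 (a + eps) * Rpower 2 (Rabs sig) * c * C1 * Rpower 2 (3 / 4 * eps)).
  assert (hC2 : 0 < C2) by (unfold C2; repeat apply Rmult_lt_0_compat; auto; apply exp_pos).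
  assert (hrho : forall z, upper z -> 0 < dist0 x0 z) by (intros z hz; now apply dist_R_pos).
  assert (Hs : forall s g K zs, 0 < s <= s1 -> datum U g K zs ->
     (forall p, In p zs -> True /\ s <= dist0 x0 (fst p) <= 2 * s) ->
     zsum zs F <= (C2 * cd) * Rpower s (eps / 4) * K).
  { intros s g K zs hsr hdat hz. unfold s1 in hsr.
    assert (hp : 0 < Rpower s (eps / 4)) by apply exp_pos.
    assert (Hin : zsum zs F <= C2 * Rpower s (eps / 4) * Rpower (2 * s) (eps / 4) * cd * K).
    { apply (hdy U (fun z => s <= dist0 x0 z <= 2 * s) F Im (2 * s) (C2 * Rpower s (eps / 4)) ltac:(lra)
         ltac:(apply Rmult_le_pos; lra) upper_Im_pos) with (g := g); [|exact hdat|].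
      - clear zs hdat hz. intros t g' K' zs ht hdat hz.
        pose proof hdat as [hK [_ [_ [_ [_ h5]]]]].
        set (A := C1 * (Rpower t (- a) * Rpower s (- (sig + eps / 2)))).
        assert (hA : 0 < A) by (unfold A; repeat apply Rmult_lt_0_compat; auto; apply exp_pos).
        pose proof (hbox s t A U g' K' zs ltac:(lra) ltac:(lra) hA
           (fun w hw => hmaj s t w ltac:(lra) ltac:(lra) ltac:(lra) hw) hdat) as hb.
        assert (hb' : zsum zs Im <= c * A * K').
        { apply hb. intros p hp'. destruct (hz p hp') as [z1 z2]. split; [easy|]. apply z2. }
        set (cc := Rpower (2 * t) (a + eps) * (Rpower 2 (Rabs sig) * Rpower s sig)).
        assert (hcc : 0 < cc) by (unfold cc; repeat apply Rmult_lt_0_compat; apply exp_pos).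
        apply Rle_trans with (zsum zs (fun z => cc * Im z)).
        { apply zsum_le. intros p hp'. destruct (hz p hp') as [z1 z2].
          pose proof (proj1 (h5 p hp')) as hup. apply upper_Im_pos in hup.
          unfold F, cc. replace (a + 1 + eps) with ((a + eps) + 1) by ring.
          rewrite Rpower_plus, Rpower_1 by easy.
          rewrite (Rmult_comm (Rpower (Im (fst p)) (a + eps))), Rmult_assoc, Rmult_comm.
          apply Rmult_le_compat_r; [lra|].
          apply Rmult_le_compat; [left; apply exp_pos|left; apply exp_pos| |].
          - apply Rpower_le_compat; lra.
          - apply Rpower_two_sided; lra. }
        rewrite zsum_scal.
        apply Rle_trans with (cc * (c * A * K')); [apply Rmult_le_compat_l; lra|].
        (* Weight times majorant leaves t^eps s^(-eps/2); bounding t^(3 eps/4) by (2s)^(3 eps/4)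
           gives a positive power of each scale. *)
        assert (E : cc * (c * A) <= C2 * Rpower s (eps / 4) * Rpower t (eps / 4)).
        { unfold cc, A, C2.
          replace (Rpower (2 * t) (a + eps) * (Rpower 2 (Rabs sig) * Rpower s sig) *
            (c * (C1 * (Rpower t (- a) * Rpower s (- (sig + eps / 2))))))
          with (c * C1 * Rpower 2 (Rabs sig) *
             (Rpower (2 * t) (a + eps) * Rpower s sig * Rpower t (- a) * Rpower s (- (sig + eps / 2)))) by ring.
          replace (Rpower 2 (a + eps) * Rpower 2 (Rabs sig) * c * C1 * Rpower 2 (3 / 4 * eps) *
            Rpower s (eps / 4) * Rpower t (eps / 4))
          with (c * C1 * Rpower 2 (Rabs sig) *
             (Rpower 2 (a + eps) * Rpower 2 (3 / 4 * eps) * Rpower s (eps / 4) * Rpower t (eps / 4))) by ring.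
          apply Rmult_le_compat_l; [left; repeat apply Rmult_lt_0_compat; auto; apply exp_pos|].
          unfold Rpower. rewrite <- !exp_plus. apply exp_le.
          rewrite ln_mult by lra.
          assert (hlt : ln t <= ln 2 + ln s) by (rewrite <- ln_mult by lra; apply ln_le; lra).
          nra. }
        apply Rmult_le_compat_r with (r := K') in E; lra.
      - intros p hp'. destruct (hz p hp') as [_ z2]. split; [easy|].
        destruct hdat as [_ [_ [_ [_ [_ h5]]]]]. pose proof (proj1 (h5 p hp')) as hup.
        pose proof (Im_le_dist (fst p) x0 hup) as hi. fold (dist0 x0 (fst p)) in hi.
        unfold Im. lra. }
    pose proof hdat as [hK _].
    eapply Rle_trans; [exact Hin|]. apply Rmult_le_compat_r; [lra|].
    assert (h1 : Rpower (2 * s) (eps / 4) <= 1).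
    { unfold Rpower. rewrite <- exp_0. apply exp_le.
      assert (ln (2 * s) <= 0) by (rewrite <- ln_1; apply ln_le; lra). nra. }
    assert (0 < C2 * Rpower s (eps / 4) * cd)
      by (apply Rmult_lt_0_compat; [apply Rmult_lt_0_compat|]; assumption).
    replace (C2 * cd * Rpower s (eps / 4)) with (C2 * Rpower s (eps / 4) * cd) by ring.
    replace (C2 * Rpower s (eps / 4) * Rpower (2 * s) (eps / 4) * cd) with
      (C2 * Rpower s (eps / 4) * cd * Rpower (2 * s) (eps / 4)) by ring.
    nra. }
  exists (2 * s1). split; [unfold s1; lra|].
  exists (C2 * cd * Rpower s1 (eps / 4) * cd). split.
  { left. apply Rmult_lt_0_compat; [apply Rmult_lt_0_compat; [nra|apply exp_pos]|easy]. }
  intros g K zs hdat hz.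
  apply (hdy U (fun _ => True) F (dist0 x0) s1 (C2 * cd) ltac:(unfold s1; lra) ltac:(nra) hrho Hs g K zs hdat).
  intros p hp'. split; [easy|]. now apply hz.
Qed.

Lemma interior_bounded_sum (U : C -> R) (w0 : C) : loc_bdd U -> upper w0 ->
  exists rho, 0 < rho /\ bounded_sum U (fun z => Cmod (z - w0)%C < rho) Im.
Proof.
  intros hU hw0. unfold upper, Im in hw0. set (y0 := snd w0) in *. set (x0 := fst w0).
  (* The disc of radius y0/4 about w0 has distances to x0 between 3/4 y0 and 5/4 y0, hence lies in
     the single box from s to 2s; any gam would do, and 1/2 is taken. *)
  set (s := 2 / 3 * y0). set (t := Rmin 1 (y0 / 2)).
  assert (ht : 0 < t <= 1 /\ t <= y0 / 2).
  { unfold t. split; [split; [apply Rmin_glb_lt; lra|apply Rmin_l]|apply Rmin_r]. }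
  destruct (box_bound x0 (/ 2) s ltac:(lra) ltac:(unfold s; lra)) as [eta [c [heta [hc hbox]]]].
  destruct (Om_bounded (/ 2) eta s ltac:(lra) heta ltac:(unfold s; lra)) as [R0 [hR0 HR]].
  destruct (loc_bdd_Vpot U x0 (/ 2) (t / 2) R0 hU ltac:(lra) ltac:(lra) hR0) as [M [hM HM]].
  exists (y0 / 4). split; [lra|]. exists (c * M). split; [nra|].
  intros g K zs hdat hz.
  apply (hbox s t M U g K zs); auto; [unfold s; lra| lra | |].
  - intros w hw. apply HM; [apply hw|]. apply (HR x0 t w); [lra|exact hw].
  - intros p hp'. specialize (hz p hp'). set (z := fst p) in *.
    assert (hi : Rabs (snd z - y0) < y0 / 4).
    { eapply Rle_lt_trans; [|exact hz]. pose proof (Rmax_Cmod (z - w0)%C) as h.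
      eapply Rle_trans; [|exact h]. eapply Rle_trans; [|apply Rmax_r].
      right. unfold y0. simpl. f_equal. }
    apply Rabs_def2 in hi.
    assert (hw : Cmod (w0 - RtoC x0)%C = y0).
    { replace (w0 - RtoC x0)%C with (Ci * RtoC y0)%C.
      - rewrite Cmod_mult, Cmod_Ci, Cmod_R, Rabs_pos_eq; lra.
      - unfold x0, y0. apply injective_projections; simpl; ring. }
    pose proof (Cmod_triangle (z - w0)%C (w0 - RtoC x0)%C) as h1.
    replace (z - w0 + (w0 - RtoC x0))%C with (z - RtoC x0)%C in h1 by ring.
    pose proof (Cmod_triangle (z - RtoC x0)%C (- (z - w0))%C) as h2.
    replace (z - RtoC x0 + - (z - w0))%C with (w0 - RtoC x0)%C in h2 by ring.
    rewrite Cmod_opp in h2. unfold dist0, s. lra.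
Qed.

(** * The point at infinity and patching *)

Definition neg_inv (z : C) : C := (- / z)%C.

Lemma upper_neq_0 (z : C) : upper z -> z <> 0%C.
Proof. intros h E. rewrite E in h. unfold upper in h. simpl in h. lra. Qed.

Lemma Im_neg_inv (z : C) : upper z -> Im (neg_inv z) = Im z / Cmod z ^ 2.
Proof.
  intros h. rewrite Cmod2_alt. destruct z as [x y]. unfold upper, Im, Re in *. simpl in *.
  field. nra.
Qed.

Lemma upper_neg_inv (z : C) : upper z -> upper (neg_inv z).
Proof.
  intros h. unfold upper. rewrite Im_neg_inv by easy. apply Rdiv_lt_0_compat; [exact h|].
  apply pow_lt, Cmod_gt_0. now apply upper_neq_0.
Qed.

Lemma neg_inv_inv (z : C) : z <> 0%C -> neg_inv (neg_inv z) = z.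
Proof. intros h. unfold neg_inv. field. auto. Qed.

Lemma Cmod_neg_inv (z : C) : z <> 0%C -> Cmod (neg_inv z) = / Cmod z.
Proof. intros h. unfold neg_inv. rewrite Cmod_opp. now apply Cmod_inv. Qed.

Lemma neg_inv_Ci : neg_inv Ci = Ci.
Proof. apply injective_projections; simpl; field. Qed.

(** The remainder after the second-order terms is exactly h^3 / (w^3 (w + h)). *)
Lemma hol2_neg_inv (w : C) : w <> 0%C -> hol2 neg_inv w.
Proof.
  intros hw. assert (hw0 : 0 < Cmod w) by now apply Cmod_gt_0.
  exists (/ w ^ 2)%C, (- / w ^ 3)%C. intros eta he.
  set (P := Cmod w ^ 4). assert (hP : 0 < P) by now apply pow_lt.
  exists (Rmin (Cmod w / 2) (eta * P / 2)). split.
  { apply Rmin_glb_lt; [lra|]. nra. }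
  intros h hh. pose proof (Rmin_l (Cmod w / 2) (eta * P / 2)). pose proof (Rmin_r (Cmod w / 2) (eta * P / 2)).
  pose proof (Cmod_ge_0 h) as h0.
  assert (hwh : Cmod w / 2 <= Cmod (w + h)%C).
  { pose proof (Cmod_triangle (w + h)%C (- h)%C) as ht.
    replace (w + h + - h)%C with w in ht by ring. rewrite Cmod_opp in ht. lra. }
  assert (hne : (w + h)%C <> 0%C) by (apply Cmod_gt_0; lra).
  replace (neg_inv (w + h) - neg_inv w - / w ^ 2 * h - - / w ^ 3 * h ^ 2)%C with
    (h ^ 3 / (w ^ 3 * (w + h)))%C by (unfold neg_inv; field; auto).
  assert (hw3 : (w ^ 3)%C <> 0%C) by (apply Cmod_gt_0; rewrite Cmod_pow; now apply pow_lt).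
  rewrite Cmod_div by now apply Cmult_neq_0.
  rewrite Cmod_mult, !Cmod_pow.
  assert (hd : P / 2 <= Cmod w ^ 3 * Cmod (w + h)%C).
  { unfold P. replace (Cmod w ^ 4 / 2) with (Cmod w ^ 3 * (Cmod w / 2)) by field.
    apply Rmult_le_compat_l; [apply pow_le; lra|easy]. }
  set (Q := Cmod w ^ 3 * Cmod (w + h)%C) in *.
  apply Rmult_le_reg_r with Q; [lra|]. unfold Rdiv. rewrite Rmult_assoc, Rinv_l by lra.
  assert (h2 : 0 <= Cmod h ^ 2) by (apply pow_le; lra).
  replace (Cmod h ^ 3 * 1) with (Cmod h ^ 2 * Cmod h) by ring.
  replace (eta * Cmod h ^ 2 * Q) with (Cmod h ^ 2 * (eta * Q)) by ring.
  apply Rmult_le_compat_l; [easy|]. nra.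
Qed.

(** With k = f(w+h) - f(w), the error splits into that of g at k, c1 times that of f, and c2 (k^2 -
    (d1 h)^2) = c2 (k - d1 h)(k + d1 h), of order h^3; each gets a third of eta. *)
Lemma hol2_comp (g f : C -> C) (w : C) :
  hol2 f w -> hol2 g (f w) -> hol2 (fun z => g (f z)) w.
Proof.
  intros [d1 [d2 Hf]] [c1 [c2 Hg]].
  exists (c1 * d1)%C, (c1 * d2 + c2 * d1 ^ 2)%C. intros eta he.
  pose proof (Cmod_ge_0 c1). pose proof (Cmod_ge_0 c2). pose proof (Cmod_ge_0 d1). pose proof (Cmod_ge_0 d2).
  set (D := Cmod d1 + Cmod d2 + 1). assert (hD : 1 <= D) by (unfold D; lra).
  set (e1 := Rmin 1 (eta / (3 * (Cmod c1 + 1)))).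
  set (e2 := eta / (3 * D ^ 2)).
  assert (hD2 : 1 <= D ^ 2) by nra.
  assert (he1 : 0 < e1) by (apply Rmin_glb_lt; [lra|apply Rdiv_lt_0_compat; lra]).
  assert (he2 : 0 < e2) by (apply Rdiv_lt_0_compat; lra).
  destruct (Hf e1 he1) as [r1 [hr1 K1]]. destruct (Hg e2 he2) as [r2 [hr2 K2]].
  set (r3 := eta / (6 * (Cmod c2 + 1) * D ^ 2)).
  assert (hr3 : 0 < r3) by (apply Rdiv_lt_0_compat; nra).
  exists (Rmin (Rmin r1 1) (Rmin (r2 / D) r3)). split.
  { repeat apply Rmin_glb_lt; try lra. apply Rdiv_lt_0_compat; lra. }
  intros h hh.
  pose proof (Rmin_l (Rmin r1 1) (Rmin (r2 / D) r3)). pose proof (Rmin_r (Rmin r1 1) (Rmin (r2 / D) r3)).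
  pose proof (Rmin_l r1 1). pose proof (Rmin_r r1 1). pose proof (Rmin_l (r2 / D) r3). pose proof (Rmin_r (r2 / D) r3).
  pose proof (Cmod_ge_0 h) as h0.
  specialize (K1 h ltac:(lra)).
  set (k := (f (w + h) - f w)%C).
  set (rho := (f (w + h) - f w - d1 * h - d2 * h ^ 2)%C) in *.
  assert (hh2 : Cmod h ^ 2 <= Cmod h) by nra.
  assert (hh20 : 0 <= Cmod h ^ 2) by nra.
  assert (he11 : e1 <= 1) by apply Rmin_l.
  assert (hkd : Cmod (k - d1 * h)%C <= (Cmod d2 + 1) * Cmod h ^ 2).
  { replace (k - d1 * h)%C with (d2 * h ^ 2 + rho)%C by (unfold k, rho; ring).
    eapply Rle_trans; [apply Cmod_triangle|]. rewrite Cmod_mult, Cmod_pow. nra. }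
  assert (hk : Cmod k <= D * Cmod h).
  { replace k with (d1 * h + (k - d1 * h))%C by ring.
    eapply Rle_trans; [apply Cmod_triangle|]. rewrite Cmod_mult. unfold D. nra. }
  assert (hkp : Cmod (k + d1 * h)%C <= 2 * D * Cmod h).
  { eapply Rle_trans; [apply Cmod_triangle|]. rewrite Cmod_mult.
    assert (Cmod d1 * Cmod h <= D * Cmod h) by (apply Rmult_le_compat_r; unfold D; lra). lra. }
  assert (hkr : Cmod k < r2).
  { eapply Rle_lt_trans; [exact hk|]. apply Rlt_le_trans with (D * (r2 / D)); [|right; field; lra].
    apply Rmult_lt_compat_l; lra. }
  specialize (K2 k hkr). replace (f w + k)%C with (f (w + h)%C) in K2 by (unfold k; ring).
  set (sg := (g (f (w + h)) - g (f w) - c1 * k - c2 * k ^ 2)%C) in *.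
  replace (g (f (w + h)) - g (f w) - c1 * d1 * h - (c1 * d2 + c2 * d1 ^ 2) * h ^ 2)%C with
    (sg + c1 * rho + c2 * ((k - d1 * h) * (k + d1 * h)))%C by (unfold sg, rho, k; ring).
  eapply Rle_trans; [apply Cmod_three_le|]. rewrite !Cmod_mult.
  assert (q1 : Cmod sg <= eta / 3 * Cmod h ^ 2).
  { eapply Rle_trans; [exact K2|]. apply Rle_trans with (e2 * (D * Cmod h) ^ 2).
    - apply Rmult_le_compat_l; [lra|]. apply pow_incr. split; [apply Cmod_ge_0|easy].
    - right. unfold e2. field. lra. }
  assert (q2 : Cmod c1 * Cmod rho <= eta / 3 * Cmod h ^ 2).
  { assert (he1' : (Cmod c1 + 1) * e1 <= eta / 3).
    { apply Rle_trans with ((Cmod c1 + 1) * (eta / (3 * (Cmod c1 + 1)))); [|right; field; lra].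
      apply Rmult_le_compat_l; [lra|apply Rmin_r]. }
    apply Rle_trans with (Cmod c1 * (e1 * Cmod h ^ 2)); [apply Rmult_le_compat_l; lra|].
    rewrite <- Rmult_assoc. apply Rmult_le_compat_r; [easy|]. lra. }
  assert (q3 : Cmod c2 * (Cmod (k - d1 * h) * Cmod (k + d1 * h)) <= eta / 3 * Cmod h ^ 2).
  { apply Rle_trans with (Cmod c2 * ((D * Cmod h ^ 2) * (2 * D * r3))).
    - apply Rmult_le_compat_l; [easy|]. apply Rmult_le_compat; try apply Cmod_ge_0.
      + eapply Rle_trans; [exact hkd|]. apply Rmult_le_compat_r; [easy|]. unfold D; lra.
      + eapply Rle_trans; [exact hkp|]. apply Rmult_le_compat_l; lra.
    - replace (Cmod c2 * (D * Cmod h ^ 2 * (2 * D * r3))) with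
        (Cmod c2 * (2 * D ^ 2 * r3) * Cmod h ^ 2) by ring.
      apply Rmult_le_compat_r; [easy|].
      apply Rle_trans with ((Cmod c2 + 1) * (2 * D ^ 2 * r3)).
      + apply Rmult_le_compat_r; [nra|lra].
      + right. unfold r3. field. lra. }
  lra.
Qed.

(** Since only an upper bound is transported, the local Lipschitz constant 2 / |p|^2 of w |-> -1/w
    suffices. *)
Lemma zero_bd_neg_inv (g : C -> C) (z : C) (m : nat) :
  upper z -> zero_bd g z m -> zero_bd (fun w => g (neg_inv w)) (neg_inv z) m.
Proof.
  intros hz [B [hB [r [hr H]]]].
  pose proof (upper_neq_0 _ hz) as hz0.
  set (p := neg_inv z). assert (hp : upper p) by now apply upper_neg_inv.
  pose proof (upper_neq_0 _ hp) as hp0. assert (hpm : 0 < Cmod p) by now apply Cmod_gt_0.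
  set (L := 2 / Cmod p ^ 2).
  assert (hp2 : 0 < Cmod p ^ 2) by now apply pow_lt.
  assert (hL : 0 < L) by (apply Rdiv_lt_0_compat; lra).
  exists (B * L ^ m). split; [apply Rmult_le_pos; [easy|apply pow_le; lra]|].
  exists (Rmin (Cmod p / 2) (r / L)). split.
  { apply Rmin_glb_lt; [lra|]. now apply Rdiv_lt_0_compat. }
  intros w hw. pose proof (Rmin_l (Cmod p / 2) (r / L)). pose proof (Rmin_r (Cmod p / 2) (r / L)).
  assert (hwm : Cmod p / 2 <= Cmod w).
  { pose proof (Cmod_triangle w (- (w - p))%C) as ht.
    replace (w + - (w - p))%C with p in ht by ring. rewrite Cmod_opp in ht. lra. }
  assert (hw0 : w <> 0%C) by (apply Cmod_gt_0; lra).
  assert (hd : Cmod (neg_inv w - z)%C <= L * Cmod (w - p)%C).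
  { rewrite <- (neg_inv_inv z hz0). fold p.
    replace (neg_inv w - neg_inv p)%C with ((w - p) / (w * p))%C by (unfold neg_inv; field; auto).
    rewrite Cmod_div by now apply Cmult_neq_0. rewrite Cmod_mult.
    unfold Rdiv. rewrite Rmult_comm. apply Rmult_le_compat_r; [apply Cmod_ge_0|].
    unfold L, Rdiv. replace (2 * / Cmod p ^ 2) with (/ (Cmod p / 2 * Cmod p)) by (field; lra).
    apply Rinv_le_contravar; nra. }
  assert (hlt : Cmod (neg_inv w - z)%C < r).
  { eapply Rle_lt_trans; [exact hd|]. apply Rlt_le_trans with (L * (r / L)); [|right; field; lra].
    apply Rmult_lt_compat_l; lra. }
  eapply Rle_trans; [apply (H _ hlt)|]. rewrite Rmult_assoc, <- Rpow_mult_distr.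
  apply Rmult_le_compat_l; [easy|]. apply pow_incr. split; [apply Cmod_ge_0|easy].
Qed.

Definition neg_inv_fst (p : C * nat) : C * nat := (neg_inv (fst p), snd p).

Lemma datum_neg_inv U g K zs : datum U g K zs ->
  datum (fun w => U (neg_inv w)) (fun w => g (neg_inv w)) K (map neg_inv_fst zs).
Proof.
  intros [hK [h1 [h2 [h3 [h4 h5]]]]]. split; [easy|]. split; [|split; [|split; [|split]]].
  - intros w hw. apply hol2_comp; [apply hol2_neg_inv; now apply upper_neq_0|].
    apply h1. now apply upper_neg_inv.
  - now rewrite neg_inv_Ci.
  - intros w hw hg. apply h3; [now apply upper_neg_inv|easy].
  - rewrite map_map. simpl. rewrite <- (map_map fst neg_inv).
    assert (hup : forall z, In z (map fst zs) -> upper z).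
    { intros z hz. apply in_map_iff in hz. destruct hz as [p [<- hp]]. now apply h5. }
    clear - h4 hup. induction (map fst zs) as [|z l IH]; [constructor|].
    inversion h4; subst. simpl. constructor.
    + intros hin. apply in_map_iff in hin. destruct hin as [u [hu hin]].
      apply H1. rewrite <- (neg_inv_inv z), <- hu, neg_inv_inv; auto;
        apply upper_neq_0, hup; simpl; auto.
    + apply IH; auto. intros u hu. apply hup. now right.
  - intros p hp. apply in_map_iff in hp. destruct hp as [q [<- hq]]. simpl.
    destruct (h5 q hq) as [k1 [k2 k3]].
    split; [now apply upper_neg_inv|]. split; [easy|now apply zero_bd_neg_inv].
Qed.

Lemma bounded_sum_neg_inv (U : C -> R) (F : C -> R) (rho : R) : 0 < rho ->
  bounded_sum (fun w => U (neg_inv w)) (fun z => Cmod z < rho) (fun z => F (neg_inv z)) ->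
  bounded_sum U (fun z => / rho < Cmod z) F.
Proof.
  intros hr [B [hB H]]. exists B. split; [easy|]. intros g K zs hd hz.
  pose proof hd as [_ [_ [_ [_ [_ h5]]]]].
  assert (E : zsum zs F = zsum (map neg_inv_fst zs) (fun z => F (neg_inv z))).
  { assert (hup : forall p, In p zs -> upper (fst p)) by (intros p hp; now apply h5).
    clear - hup. unfold zsum. induction zs as [|p zs IH]; [reflexivity|]. simpl.
    rewrite neg_inv_inv, IH; auto; [intros; apply hup; now right|].
    apply upper_neq_0, hup. now left. }
  rewrite E. apply (H _ K _ (datum_neg_inv U g K zs hd)).
  intros p hp. apply in_map_iff in hp. destruct hp as [q [<- hq]]. simpl.
  specialize (hz q hq). rewrite Cmod_neg_inv by (apply upper_neq_0; now apply h5).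
  rewrite <- (Rinv_inv rho). apply Rinv_lt_contravar; [|easy].
  apply Rmult_lt_0_compat; [now apply Rinv_0_lt_compat|].
  apply Cmod_gt_0, upper_neq_0. now apply h5.
Qed.

(** The rectangle to be covered includes its bottom edge on the real line; this compactness is why
    bounds at all real points are required, not only at the marked ones. *)
Lemma bounded_sum_cover (U F : C -> R) (R1 : R) :
  (forall x0, exists rho, 0 < rho /\ bounded_sum U (fun z => dist0 x0 z < rho) F) ->
  (forall w0, upper w0 -> exists rho, 0 < rho /\ bounded_sum U (fun z => Cmod (z - w0)%C < rho) F) ->
  bounded_sum U (fun z => R1 < Cmod z) F ->
  bounded_sum U upper F.
Proof.
  intros hb hi hinf.
  (* The guard 0 <= Im w makes the radius a total function, as [choice] demands. *)
  assert (hpt : forall w, exists rho, 0 < rho /\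
     (0 <= snd w -> bounded_sum U (fun z => Cmod (z - w)%C < rho) F)).
  { intros w. destruct (Rlt_or_le 0 (snd w)) as [h|h].
    - destruct (hi w h) as [rho [h1 h2]]. exists rho. auto.
    - destruct (hb (fst w)) as [rho [h1 h2]]. exists rho. split; [easy|]. intros h0.
      unfold dist0 in h2. replace (RtoC (fst w)) with w in h2; [exact h2|].
      apply injective_projections; simpl; lra. }
  destruct (choice _ hpt) as [rho hrho].
  set (R2 := Rmax R1 0).
  destruct (rect_finite_cover (- R2) R2 0 R2 (fun w z => Cmod (z - w)%C < rho w)) as [l [hl1 hl2]].
  { intros w _. exists (rho w). split; [apply hrho|auto]. }
  assert (hl : bounded_sum U (fun z => exists w, In w l /\ Cmod (z - w)%C < rho w) F).
  { clear hl2. induction l as [|w l IH].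
    - exists 0. split; [lra|]. intros g K zs hd hz. destruct zs as [|p zs].
      + unfold zsum; simpl. lra.
      + destruct (hz p (or_introl eq_refl)) as [w [[] _]].
    - apply bounded_sum_union with (fun z => Cmod (z - w)%C < rho w)
        (fun z => exists w, In w l /\ Cmod (z - w)%C < rho w).
      + apply hrho. apply (hl1 w). now left.
      + apply IH. intros u hu. apply hl1. now right.
      + intros z _ [u [[<-|hu] hz]]; [now left|right; eauto]. }
  apply bounded_sum_union with (1 := hinf) (2 := hl).
  intros z hz _. destruct (Rlt_or_le R1 (Cmod z)) as [h|h]; [now left|right].
  apply hl2. pose proof (Rmax_Cmod z) as hm.
  assert (hR : R1 <= R2) by apply Rmax_l.
  pose proof (Rmax_l (Rabs (fst z)) (Rabs (snd z))). pose proof (Rmax_r (Rabs (fst z)) (Rabs (snd z))).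
  assert (h1 : Rabs (fst z) <= R2) by lra. assert (h2 : Rabs (snd z) <= R2) by lra.
  apply Rabs_le_between in h1. apply Rabs_le_between in h2.
  unfold upper, Im in hz. unfold in_rect. lra.
Qed.

(** * Product majorants *)

Lemma local_bounded_sum_exponents (U : C -> R) (x0 a e sig eps r0 C0 : R) :
  loc_bdd U -> 0 <= a -> - a <= sig -> e < sig + 1 -> 0 < eps -> 0 < r0 -> 0 < C0 ->
  (forall w, 0 < snd w -> dist0 x0 w < r0 ->
     U w <= C0 * (Rpower (snd w) (- a) * Rpower (dist0 x0 w) (- e))) ->
  exists rho, 0 < rho /\ bounded_sum U (fun z => dist0 x0 z < rho)
    (fun z => Rpower (Im z) (a + 1 + eps) * Rpower (dist0 x0 z) sig).
Proof.
  intros hU ha hs he hep hr0 hC0 H.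
  pose proof (Rabs_pos sig) as h0.
  set (M := 2 * (a + Rabs sig + 1)). assert (hM : 2 <= M) by (unfold M; lra).
  (* With gam = 1 - del the three bounds give e <= sig + gam, 0 < gam < 1 and (1 - gam)(a + |sig|)
     <= eps / 2. *)
  set (del := Rmin (sig + 1 - e) (Rmin (/ 2) (eps / M))).
  assert (hepM : 0 < eps / M) by (apply Rdiv_lt_0_compat; lra).
  assert (hd0 : 0 < del) by (repeat apply Rmin_glb_lt; lra).
  assert (hd1 : del <= sig + 1 - e) by apply Rmin_l.
  assert (hd2 : del <= / 2) by (eapply Rle_trans; [apply Rmin_r|apply Rmin_l]).
  assert (hd3 : del <= eps / M) by (eapply Rle_trans; [apply Rmin_r|apply Rmin_r]).
  assert (hd4 : del * M <= eps).
  { apply Rmult_le_compat_r with (r := M) in hd3; [|lra].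
    unfold Rdiv in hd3. rewrite Rmult_assoc, Rinv_l in hd3; lra. }
  apply (local_bounded_sum U x0 (1 - del) a sig eps (Rmin r0 1) C0); auto.
  - lra.
  - unfold M in hd4. nra.
  - split; [apply Rmin_glb_lt; lra|apply Rmin_r].
  - intros w hw hr. pose proof (Rmin_l r0 1). pose proof (Rmin_r r0 1).
    eapply Rle_trans; [apply H; [easy|lra]|].
    apply Rmult_le_compat_l; [lra|]. apply Rmult_le_compat_l; [left; apply exp_pos|].
    pose proof (dist_R_pos w x0 hw) as hp. fold (dist0 x0 w) in hp.
    assert (hln : ln (dist0 x0 w) <= 0) by (rewrite <- ln_1; apply ln_le; lra).
    unfold Rpower. apply exp_le. nra.
Qed.

(** Common shape of the majorant (be = 2b, al = -a) and of the weight (be = -l1, al = a + 1 + eps),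
    so that local exponents are computed once for both. *)
Definition gprod (n m : nat) (x xp : nat -> R) (be al : R) (q1 q2 : nat -> R) (w : C) : R :=
  Rpower (1 + Cmod w) be * Rpower (Im w) al
  * rprod n (fun j => Rpower (Cmod (w - RtoC (x j))%C) (q1 j))
  * rprod m (fun k => Rpower (Cmod (w - RtoC (xp k))%C) (q2 k)).

(** f = O(h) along the sets P r as r shrinks; positivity of f is included so that such bounds can be
    multiplied. *)
Definition dom (P : R -> C -> Prop) (f h : C -> R) : Prop :=
  exists B r, 0 < B /\ 0 < r /\ forall w, P r w -> 0 < f w <= B * h w.

Definition shrinking (P : R -> C -> Prop) : Prop :=
  forall r r' w, r <= r' -> P r w -> P r' w.

Lemma dom_mult P f1 f2 h1 h2 : shrinking P ->
  dom P f1 h1 -> dom P f2 h2 -> dom P (fun w => f1 w * f2 w) (fun w => h1 w * h2 w).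
Proof.
  intros hP [B1 [r1 [hB1 [hr1 H1]]]] [B2 [r2 [hB2 [hr2 H2]]]].
  exists (B1 * B2), (Rmin r1 r2). split; [now apply Rmult_lt_0_compat|].
  split; [now apply Rmin_glb_lt|]. intros w hw.
  specialize (H1 w (hP _ _ _ (Rmin_l _ _) hw)). specialize (H2 w (hP _ _ _ (Rmin_r _ _) hw)).
  split; [apply Rmult_lt_0_compat; lra|].
  replace (B1 * B2 * (h1 w * h2 w)) with ((B1 * h1 w) * (B2 * h2 w)) by ring.
  apply Rmult_le_compat; lra.
Qed.

Lemma dom_rprod P (b : C -> R) (n : nat) (f : nat -> C -> R) (e : nat -> R) : shrinking P ->
  (forall j, (j < n)%nat -> dom P (f j) (fun w => Rpower (b w) (e j))) ->
  dom P (fun w => rprod n (fun j => f j w)) (fun w => Rpower (b w) (rsum n e)).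
Proof.
  intros hP. induction n as [|n IH]; intros H; simpl.
  - exists 1, 1. split; [lra|]. split; [lra|]. intros w _. unfold Rpower.
    rewrite Rmult_0_l, exp_0. lra.
  - destruct (dom_mult P _ _ _ _ hP (IH (fun j hj => H j (Nat.lt_lt_succ_r _ _ hj))) (H n (Nat.lt_succ_diag_r n)))
      as [B [r [hB [hr K]]]].
    exists B, r. split; [easy|]. split; [easy|]. intros w hw. rewrite Rpower_plus. now apply K.
Qed.

(** A factor bounded away from 0 and infinity counts as the power 0 of the base [b], so exponents
    can be summed over all factors. *)
Lemma dom_Rpower_between P (f b : C -> R) (q lo hi r : R) : 0 < lo -> 0 < r ->
  (forall w, P r w -> lo <= f w <= hi) ->
  dom P (fun w => Rpower (f w) q) (fun w => Rpower (b w) 0).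
Proof.
  intros hlo hr H. exists (Rpower lo q + Rpower hi q), r.
  assert (h1 : 0 < Rpower lo q) by apply exp_pos. assert (h2 : 0 < Rpower hi q) by apply exp_pos.
  split; [lra|]. split; [easy|]. intros w hw. split; [apply exp_pos|].
  assert (E : Rpower (b w) 0 = 1) by (unfold Rpower; now rewrite Rmult_0_l, exp_0).
  rewrite E, Rmult_1_r. specialize (H w hw).
  assert (hl : ln lo <= ln (f w)) by (apply ln_le; lra).
  assert (hh : ln (f w) <= ln hi) by (apply ln_le; lra).
  destruct (Rle_or_lt 0 q) as [h|h].
  - apply Rle_trans with (Rpower hi q); [|lra]. unfold Rpower. apply exp_le. nra.
  - apply Rle_trans with (Rpower lo q); [|lra]. unfold Rpower. apply exp_le. nra.
Qed.

Lemma dom_ext P f f' h h' r0 : shrinking P -> 0 < r0 ->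
  (forall w, P r0 w -> f w = f' w /\ h w = h' w) -> dom P f h -> dom P f' h'.
Proof.
  intros hP hr0 E [B [r [hB [hr H]]]]. exists B, (Rmin r r0). split; [easy|].
  split; [now apply Rmin_glb_lt|]. intros w hw.
  destruct (E w (hP _ _ _ (Rmin_r _ _) hw)) as [<- <-]. apply H. exact (hP _ _ _ (Rmin_l _ _) hw).
Qed.

Lemma dom_refl P (f : C -> R) (q : R) : dom P (fun w => Rpower (f w) q) (fun w => Rpower (f w) q).
Proof.
  exists 1, 1. split; [lra|]. split; [lra|]. intros w _. rewrite Rmult_1_l.
  split; [apply exp_pos|apply Rle_refl].
Qed.

Lemma dist0_between (x0 p r : R) (w : C) : dist0 x0 w < r ->
  Rabs (x0 - p) - r <= Cmod (w - RtoC p)%C <= Rabs (x0 - p) + r.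
Proof.
  intros hr. unfold dist0 in hr.
  pose proof (Cmod_triangle (w - RtoC x0)%C (RtoC (x0 - p))) as h1.
  pose proof (Cmod_triangle (- (w - RtoC x0))%C (w - RtoC p)%C) as h2.
  rewrite Cmod_R in h1. rewrite Cmod_opp in h2.
  replace (w - RtoC x0 + RtoC (x0 - p))%C with (w - RtoC p)%C in h1 by (rewrite RtoC_minus; ring).
  replace (- (w - RtoC x0) + (w - RtoC p))%C with (RtoC (x0 - p)) in h2 by (rewrite RtoC_minus; ring).
  rewrite Cmod_R in h2. lra.
Qed.

Lemma gprod_loc_bdd n m x xp be al q1 q2 : loc_bdd (gprod n m x xp be al q1 q2).
Proof.
  intros d R0 hd.
  set (P := fun (_ : R) (w : C) => d <= snd w /\ Cmod w <= R0).
  assert (hP : shrinking P) by (intros r r' w _ h; exact h).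
  (* With a constant base, and sets [P] independent of r, [dom] reduces to boundedness. *)
  set (b := fun _ : C => 1).
  assert (hfac : forall p q, dom P (fun w => Rpower (Cmod (w - RtoC p)%C) q) (fun w => Rpower (b w) 0)).
  { intros p q. apply dom_Rpower_between with d (R0 + Rabs p) 1; [lra|lra|].
    intros w [h1 h2]. split.
    - pose proof (Im_le_dist w p ltac:(lra)). lra.
    - eapply Rle_trans; [apply (Cmod_triangle w (- RtoC p)%C)|]. rewrite Cmod_opp, Cmod_R. lra. }
  assert (h1 : dom P (fun w => Rpower (1 + Cmod w) be) (fun w => Rpower (b w) 0)).
  { apply dom_Rpower_between with 1 (1 + R0) 1; [lra|lra|].
    intros w [h1 h2]. pose proof (Cmod_ge_0 w). lra. }
  assert (h2 : dom P (fun w => Rpower (Im w) al) (fun w => Rpower (b w) 0)).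
  { apply dom_Rpower_between with d R0 1; [lra|lra|].
    intros w [h2 h3]. split; [exact h2|]. eapply Rle_trans; [|exact h3].
    eapply Rle_trans; [apply Rle_abs|]. eapply Rle_trans; [|apply Rmax_Cmod]. apply Rmax_r. }
  pose proof (dom_rprod P b n (fun j w => Rpower (Cmod (w - RtoC (x j))%C) (q1 j)) (fun _ => 0) hP
    (fun j _ => hfac (x j) (q1 j))) as h3.
  pose proof (dom_rprod P b m (fun j w => Rpower (Cmod (w - RtoC (xp j))%C) (q2 j)) (fun _ => 0) hP
    (fun j _ => hfac (xp j) (q2 j))) as h4.
  destruct (dom_mult _ _ _ _ _ hP (dom_mult _ _ _ _ _ hP (dom_mult _ _ _ _ _ hP h1 h2) h3) h4)
    as [B [r [hB [hr H]]]].
  exists B. intros w hw1 hw2. destruct (H w (conj hw1 hw2)) as [_ h].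
  unfold gprod. eapply Rle_trans; [exact h|].
  unfold b, Rpower. rewrite ln_1, !Rmult_0_r, exp_0. lra.
Qed.

(** The order at x0 of the factor number j; summed over j it gives the order of the product
    there. *)
Definition at_pt (x : nat -> R) (x0 : R) (q : nat -> R) (j : nat) : R :=
  if Req_EM_T (x j) x0 then q j else 0.

Lemma gprod_near n m x xp be al q1 q2 x0 :
  dom (fun r w => 0 < snd w /\ dist0 x0 w < r) (gprod n m x xp be al q1 q2)
    (fun w => Rpower (Im w) al *
       Rpower (dist0 x0 w) (rsum n (at_pt x x0 q1) + rsum m (at_pt xp x0 q2))).
Proof.
  set (P := fun r w => 0 < snd w /\ dist0 x0 w < r).
  assert (hP : shrinking P) by (intros r r' w hr [h1 h2]; split; [easy|lra]).
  assert (hfac : forall y q j, dom P (fun w => Rpower (Cmod (w - RtoC (y j))%C) (q j))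
      (fun w => Rpower (dist0 x0 w) (at_pt y x0 q j))).
  { intros y q j. unfold at_pt. destruct (Req_EM_T (y j) x0) as [->|hne]; [apply dom_refl|].
    assert (hd : 0 < Rabs (x0 - y j)) by (apply Rabs_pos_lt; lra).
    apply dom_Rpower_between with (Rabs (x0 - y j) / 2) (2 * Rabs (x0 - y j)) (Rabs (x0 - y j) / 2);
      [lra|lra|].
    intros w [_ hw]. apply (dist0_between x0 (y j)) in hw. lra. }
  assert (h1 : dom P (fun w => Rpower (1 + Cmod w) be) (fun w => Rpower (dist0 x0 w) 0)).
  { apply dom_Rpower_between with 1 (2 + Rabs x0) 1; [lra|lra|].
    intros w [_ h]. pose proof (Cmod_ge_0 w). pose proof (Cmod_le_dist0 x0 w). lra. }
  pose proof (dom_rprod P (dist0 x0) n _ (at_pt x x0 q1) hP (fun j _ => hfac x q1 j)) as h3.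
  pose proof (dom_rprod P (dist0 x0) m _ (at_pt xp x0 q2) hP (fun j _ => hfac xp q2 j)) as h4.
  refine (dom_ext P _ _ _ _ 1 hP Rlt_0_1 _
    (dom_mult _ _ _ _ _ hP (dom_mult _ _ _ _ _ hP (dom_mult _ _ _ _ _ hP h1 (dom_refl P Im al)) h3) h4)).
  intros w _. split; [reflexivity|]. rewrite Rpower_plus.
  replace (Rpower (dist0 x0 w) 0) with 1 by (unfold Rpower; now rewrite Rmult_0_l, exp_0). ring.
Qed.

Lemma rsum_opp n q : rsum n (fun j => - q j) = - rsum n q.
Proof. induction n as [|n IH]; simpl; [ring|]. rewrite IH. ring. Qed.

(** Under w |-> -1/w each |w - p| and 1 + |w| becomes comparable to 1/|w|, while Im w becomes Im w /
    |w|^2, which accounts for the term 2 al. *)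
Lemma gprod_infinity n m x xp be al q1 q2 :
  dom (fun r w => 0 < snd w /\ dist0 0 w < r) (fun w => gprod n m x xp be al q1 q2 (neg_inv w))
    (fun w => Rpower (Im w) al *
       Rpower (dist0 0 w) (- (2 * al + be + rsum n q1 + rsum m q2))).
Proof.
  set (P := fun r w => 0 < snd w /\ dist0 0 w < r).
  assert (hP : shrinking P) by (intros r r' w hr [h1 h2]; split; [easy|lra]).
  assert (hdist : forall w, dist0 0 w = Cmod w).
  { intros w. unfold dist0. f_equal. ring. }
  assert (hfac : forall p q, dom P (fun w => Rpower (Cmod (neg_inv w - RtoC p)%C) q)
      (fun w => Rpower (dist0 0 w) (- q))).
  { intros p q. pose proof (Rabs_pos p) as hp.
    set (r := / (2 * (Rabs p + 1))). assert (hr : 0 < r) by (apply Rinv_0_lt_compat; lra).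
    assert (hb : dom P (fun w => Rpower (Cmod (1 + RtoC p * w)%C) q) (fun w => Rpower (dist0 0 w) 0)).
    { apply dom_Rpower_between with (/ 2) (3 / 2) r; [lra|easy|].
      intros w [_ hw]. rewrite hdist in hw.
      assert (hs : Cmod (RtoC p * w)%C <= / 2).
      { rewrite Cmod_mult, Cmod_R. apply Rle_trans with (Rabs p * r).
        - apply Rmult_le_compat_l; lra.
        - unfold r. apply Rmult_le_reg_r with (2 * (Rabs p + 1)); [lra|].
          rewrite Rmult_assoc, Rinv_l; lra. }
      pose proof (Cmod_triangle 1 (RtoC p * w)%C) as k1. rewrite Cmod_1 in k1.
      pose proof (Cmod_triangle (1 + RtoC p * w)%C (- (RtoC p * w))%C) as k2.
      replace (1 + RtoC p * w + - (RtoC p * w))%C with (RtoC 1) in k2 by ring.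
      rewrite Cmod_1, Cmod_opp in k2. lra. }
    refine (dom_ext P _ _ _ _ 1 hP Rlt_0_1 _ (dom_mult _ _ _ _ _ hP hb (dom_refl P (dist0 0) (- q)))).
    intros w [hw _]. rewrite hdist. pose proof (upper_neq_0 w hw) as hw0.
    assert (hm : 0 < Cmod w) by now apply Cmod_gt_0. split.
    - replace (neg_inv w - RtoC p)%C with (- ((1 + RtoC p * w) / w))%C by (unfold neg_inv; field; auto).
      rewrite Cmod_opp, Cmod_div by easy.
      assert (hne : 0 < Cmod (1 + RtoC p * w)%C).
      { apply Cmod_gt_0. intros E0. assert (E := f_equal snd E0). unfold upper, Im in *. simpl in E.
        assert (E2 : p = 0 \/ snd w = 0).
        { apply Rmult_integral. rewrite <- E. ring. }
        destruct E2 as [->|E2]; [|lra].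
        apply (f_equal fst) in E0. simpl in E0. lra. }
      unfold Rdiv. rewrite <- Rpower_mult_distr by (try apply Rinv_0_lt_compat; easy).
      f_equal. unfold Rpower. rewrite ln_Rinv by easy. f_equal. ring.
    - unfold Rpower at 1. rewrite Rmult_0_l, exp_0. ring. }
  assert (h1 : dom P (fun w => Rpower (1 + Cmod (neg_inv w)) be) (fun w => Rpower (dist0 0 w) (- be))).
  { assert (hb : dom P (fun w => Rpower (1 + Cmod w) be) (fun w => Rpower (dist0 0 w) 0)).
    { apply dom_Rpower_between with 1 2 1; [lra|lra|].
      intros w [_ h]. rewrite hdist in h. pose proof (Cmod_ge_0 w). lra. }
    refine (dom_ext P _ _ _ _ 1 hP Rlt_0_1 _ (dom_mult _ _ _ _ _ hP hb (dom_refl P (dist0 0) (- be)))).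
    intros w [hw _]. rewrite hdist. pose proof (upper_neq_0 w hw) as hw0.
    assert (hm : 0 < Cmod w) by now apply Cmod_gt_0. split.
    - rewrite Cmod_neg_inv by easy.
      replace (1 + / Cmod w) with ((1 + Cmod w) * / Cmod w) by (field; lra).
      rewrite <- Rpower_mult_distr by (try apply Rinv_0_lt_compat; lra).
      f_equal. unfold Rpower. rewrite ln_Rinv by easy. f_equal. ring.
    - unfold Rpower at 1. rewrite Rmult_0_l, exp_0. ring. }
  assert (h2 : dom P (fun w => Rpower (Im (neg_inv w)) al)
      (fun w => Rpower (Im w) al * Rpower (dist0 0 w) (- (2 * al)))).
  { refine (dom_ext P _ _ _ _ 1 hP Rlt_0_1 _
      (dom_mult _ _ _ _ _ hP (dom_refl P Im al) (dom_refl P (dist0 0) (- (2 * al))))).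
    intros w [hw _]. split; [|reflexivity]. rewrite hdist, Im_neg_inv by exact hw.
    pose proof (upper_neq_0 w hw) as hw0.
    assert (hm : 0 < Cmod w) by now apply Cmod_gt_0.
    assert (hm2 : 0 < Cmod w ^ 2) by now apply pow_lt.
    unfold Rdiv. rewrite <- Rpower_mult_distr by (try apply Rinv_0_lt_compat; easy).
    f_equal. unfold Rpower. rewrite ln_Rinv, ln_pow by easy. f_equal. simpl INR. ring. }
  pose proof (dom_rprod P (dist0 0) n _ (fun j => - q1 j) hP (fun j _ => hfac (x j) (q1 j))) as h3.
  pose proof (dom_rprod P (dist0 0) m _ (fun j => - q2 j) hP (fun j _ => hfac (xp j) (q2 j))) as h4.
  refine (dom_ext P _ _ _ _ 1 hP Rlt_0_1 _
    (dom_mult _ _ _ _ _ hP (dom_mult _ _ _ _ _ hP (dom_mult _ _ _ _ _ hP h1 h2) h3) h4)).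
  intros w _. split; [reflexivity|]. rewrite !rsum_opp.
  replace (- (2 * al + be + rsum n q1 + rsum m q2)) with
    (- be + - (2 * al) + - rsum n q1 + - rsum m q2) by ring.
  rewrite !Rpower_plus. ring.
Qed.

Lemma rsum_at_pt_none n x x0 q : (forall j, (j < n)%nat -> x j <> x0) -> rsum n (at_pt x x0 q) = 0.
Proof.
  induction n as [|n IH]; intros H; simpl; [reflexivity|].
  rewrite IH by (intros; apply H; lia). unfold at_pt.
  destruct (Req_EM_T (x n) x0) as [E|_]; [|ring]. exfalso. now apply (H n (Nat.lt_succ_diag_r n)).
Qed.

Lemma rsum_at_pt_one n x x0 q i :
  (forall i j, (i < n)%nat -> (j < n)%nat -> i <> j -> x i <> x j) ->
  (i < n)%nat -> x i = x0 -> rsum n (at_pt x x0 q) = q i.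
Proof.
  induction n as [|n IH]; intros hd hi E; [lia|]. simpl.
  destruct (Nat.eq_dec i n) as [->|hne].
  - rewrite rsum_at_pt_none.
    + unfold at_pt. destruct (Req_EM_T (x n) x0); [ring|contradiction].
    + intros j hj. rewrite <- E. apply hd; lia.
  - rewrite IH by (auto; lia). unfold at_pt.
    destruct (Req_EM_T (x n) x0) as [E2|_]; [|ring].
    exfalso. apply (hd i n); try lia. congruence.
Qed.

Lemma rprod_inv n x q w : / rprod n (fun j => Rpower (Cmod (w - RtoC (x j))%C) (q j)) =
  rprod n (fun j => Rpower (Cmod (w - RtoC (x j))%C) (- q j)).
Proof.
  induction n as [|n IH]; simpl; [field|]. rewrite Rinv_mult, IH, Rpower_Ropp. reflexivity.
Qed.

(** The hypotheses are sigma >= -a and e < sigma + 1 at every real point and then at infinity, sigma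
    being the order of the weight and -e that of the majorant without its power of Im w. *)
Lemma gprod_bounded_sum n m x xp be al be' q1 q2 q1' q2' (a eps : R) :
  0 <= a -> 0 < eps -> al = a + 1 + eps ->
  (forall x0, - a <= rsum n (at_pt x x0 q1) + rsum m (at_pt xp x0 q2) /\
    - (rsum n (at_pt x x0 q1') + rsum m (at_pt xp x0 q2'))
      < rsum n (at_pt x x0 q1) + rsum m (at_pt xp x0 q2) + 1) ->
  - a <= - (2 * al + be + rsum n q1 + rsum m q2) ->
  (2 * (- a) + be' + rsum n q1' + rsum m q2') < - (2 * al + be + rsum n q1 + rsum m q2) + 1 ->
  bounded_sum (gprod n m x xp be' (- a) q1' q2') upper (gprod n m x xp be al q1 q2).
Proof.
  intros ha he -> hloc hinf1 hinf2.
  set (U := gprod n m x xp be' (- a) q1' q2').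
  set (F := gprod n m x xp be (a + 1 + eps) q1 q2).
  pose proof (gprod_loc_bdd n m x xp be' (- a) q1' q2') as hU. fold U in hU.
  (* Height at least d and |w| <= R0 turn into height at least d / R0^2 and modulus at most 1/d; for
     R0 <= 0 there is no such w. *)
  assert (hUinv : loc_bdd (fun w => U (neg_inv w))).
  { intros d R0 hd. destruct (Rle_or_lt R0 0) as [hR|hR].
    - exists 0. intros w h1 h2. pose proof (Im_le_dist w 0 ltac:(lra)) as h3.
      replace (w - 0)%C with w in h3 by ring. lra.
    - destruct (hU (d / R0 ^ 2) (/ d)) as [M HM].
      { apply Rdiv_lt_0_compat; [easy|]. now apply pow_lt. }
      exists M. intros w h1 h2. assert (hw : upper w) by (unfold upper, Im; lra).
      pose proof (Im_le_dist w 0 hw) as h3. replace (w - 0)%C with w in h3 by ring.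
      assert (hm : 0 < Cmod w) by lra.
      apply HM.
      + change (d / R0 ^ 2 <= Im (neg_inv w)). rewrite Im_neg_inv by easy. unfold Rdiv.
        apply Rmult_le_compat; [lra| |exact h1|].
        * left. apply Rinv_0_lt_compat. now apply pow_lt.
        * apply Rinv_le_contravar; [now apply pow_lt|]. apply pow_incr. lra.
      + rewrite Cmod_neg_inv by now apply upper_neq_0. apply Rinv_le_contravar; lra. }
  assert (Hinf : exists R1, bounded_sum U (fun z => R1 < Cmod z) F).
  { destruct (gprod_infinity n m x xp be' (- a) q1' q2') as [B [r [hB [hr H]]]].
    destruct (gprod_infinity n m x xp be (a + 1 + eps) q1 q2) as [B' [r' [hB' [hr' H']]]].
    destruct (local_bounded_sum_exponents (fun w => U (neg_inv w)) 0 a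
      (2 * (- a) + be' + rsum n q1' + rsum m q2')
      (- (2 * (a + 1 + eps) + be + rsum n q1 + rsum m q2)) eps r B hUinv ha hinf1 hinf2 he hr hB)
      as [rho [hrho Hb]].
    { intros w hw hd. apply (H w (conj hw hd)). }
    exists (/ Rmin rho r'). apply bounded_sum_neg_inv; [now apply Rmin_glb_lt|].
    apply bounded_sum_le with (3 := Hb) (c := B'); [lra|].
    intros z hz hzr.
    assert (E : dist0 0 z = Cmod z) by (unfold dist0; f_equal; ring).
    pose proof (Rmin_l rho r'). pose proof (Rmin_r rho r').
    split; [rewrite E; lra|]. apply (H' z). split; [exact hz|rewrite E; lra]. }
  destruct Hinf as [R1 Hinf].
  apply bounded_sum_cover with R1; [| |exact Hinf].
  - intros x0. destruct (hloc x0) as [k1 k2].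
    destruct (gprod_near n m x xp be' (- a) q1' q2' x0) as [B [r [hB [hr H]]]].
    destruct (gprod_near n m x xp be (a + 1 + eps) q1 q2 x0) as [B' [r' [hB' [hr' H']]]].
    destruct (local_bounded_sum_exponents U x0 a
      (- (rsum n (at_pt x x0 q1') + rsum m (at_pt xp x0 q2')))
      (rsum n (at_pt x x0 q1) + rsum m (at_pt xp x0 q2)) eps r B hU ha k1 k2 he hr hB)
      as [rho [hrho Hb]].
    { intros w hw hd. rewrite Ropp_involutive. apply (H w (conj hw hd)). }
    exists (Rmin rho r'). split; [now apply Rmin_glb_lt|].
    apply bounded_sum_le with (3 := Hb) (c := B'); [lra|].
    intros z hz hzr. pose proof (Rmin_l rho r'). pose proof (Rmin_r rho r').
    split; [lra|]. apply (H' z). split; [exact hz|lra].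
  - intros w0 hw0. destruct (interior_bounded_sum U w0 hU hw0) as [rho [hrho Hb]].
    set (y0 := Im w0). assert (hy0 : 0 < y0) by exact hw0.
    destruct (gprod_loc_bdd n m x xp be (a + 1 + eps) q1 q2 (y0 / 2) (Cmod w0 + y0) ltac:(lra)) as [M HM].
    fold F in HM.
    exists (Rmin rho (y0 / 2)). split; [apply Rmin_glb_lt; lra|].
    pose proof (Rabs_pos M) as hM0.
    (* On this disc F <= |M| and Im z >= y0 / 2, so F is at most a multiple of Im z. *)
    apply bounded_sum_le with (3 := Hb) (c := Rabs M * (2 / y0)).
    { apply Rmult_le_pos; [easy|]. left. apply Rdiv_lt_0_compat; lra. }
    intros z hz hzr. pose proof (Rmin_l rho (y0 / 2)). pose proof (Rmin_r rho (y0 / 2)).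
    split; [lra|].
    assert (hi : y0 / 2 <= Im z).
    { pose proof (Rmax_Cmod (z - w0)%C) as hm.
      pose proof (Rmax_r (Rabs (fst (z - w0)%C)) (Rabs (snd (z - w0)%C))) as hm2.
      assert (hm3 : Rabs (snd (z - w0)%C) <= y0 / 2) by lra.
      apply Rabs_le_between in hm3. unfold y0, Im in *. simpl in hm3. lra. }
    assert (hc : Cmod z <= Cmod w0 + y0).
    { replace z with (w0 + (z - w0))%C by ring. eapply Rle_trans; [apply Cmod_triangle|]. lra. }
    apply Rle_trans with (Rabs M); [eapply Rle_trans; [apply (HM z hi hc)|apply Rle_abs]|].
    rewrite Rmult_assoc. rewrite <- (Rmult_1_r (Rabs M)) at 1. apply Rmult_le_compat_l; [easy|].
    apply Rmult_le_reg_r with y0; [easy|].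
    replace (2 / y0 * Im z * y0) with (2 * Im z) by (field; lra). lra.
Qed.

(** Entries of multiplicity 0 may lie where [g] does not vanish; they contribute nothing and are
    removed, since [datum] asks for multiplicity at least 1. *)
Lemma zsum_positive_multiplicity (zs : list (C * nat)) (F : C -> R) :
  zsum zs F = zsum (filter (fun p => Nat.leb 1 (snd p)) zs) F.
Proof.
  unfold zsum. induction zs as [|[z k] zs IH]; [reflexivity|]. cbn [filter fold_right snd fst].
  destruct k as [|k].
  - change (1 <=? 0)%nat with false. cbn iota. rewrite <- IH. simpl INR. ring.
  - change (1 <=? S k)%nat with true. cbn iota. cbn [fold_right snd fst]. now rewrite IH.
Qed.

Lemma zsum_ext (zs : list (C * nat)) (F G : C -> R) : (forall z, F z = G z) -> zsum zs F = zsum zs G.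
Proof. intros H. unfold zsum. induction zs as [|p zs IH]; simpl; [easy|]. now rewrite IH, H. Qed.

Theorem theorem4p4
  (n m : nat) (x xp : nat -> R) (a b : R) (c d : nat -> R) (eps : R) :
  (forall i j, (i < n)%nat -> (j < n)%nat -> i <> j -> x i <> x j) ->
  (forall i j, (i < m)%nat -> (j < m)%nat -> i <> j -> xp i <> xp j) ->
  (forall j k, (j < n)%nat -> (k < m)%nat -> x j <> xp k) ->
  0 <= a -> 0 <= b ->
  (forall j, (j < n)%nat -> 0 <= c j) ->
  (forall k, (k < m)%nat -> 0 <= d k) ->
  0 < eps ->
  let l := 2 * a - 2 * b - rsum n c + rsum m d in
  let l1 := 2 * (a + 1 + eps) + brace l a eps
            - rsum n (fun j => Rmin a (c j))
            + rsum m (fun k => pos_part (d k - 1 + eps)) in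
  exists C9 : R, 0 < C9 /\
    forall (g : C -> C) (K : R),
      0 < K ->
      analytic_upper g ->
      Cmod (g Ci) = 1 ->
      (forall w : C, upper w -> g w <> 0%C ->
         ln (Cmod (g w)) <=
           K * Rpower (1 + Cmod w) (2 * b) / Rpower (Im w) a
             * rprod n (fun j => Rpower (Cmod (w - RtoC (x j))) (c j))
             / rprod m (fun k => Rpower (Cmod (w - RtoC (xp k))) (d k))) ->
      forall zs : list (C * nat),
        NoDup (map fst zs) ->
        (forall p, In p zs -> zero_order_ge g (fst p) (snd p)) ->
        zsum zs (fun z =>
            Rpower (Im z) (a + 1 + eps) / Rpower (1 + Cmod z) l1
            * rprod m (fun k => Rpower (Cmod (z - RtoC (xp k)))
                                       (pos_part (d k - 1 + eps)))
            / rprod n (fun j => Rpower (Cmod (z - RtoC (x j))) (Rmin a (c j))))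
        <= C9 * K.
Proof.
  intros hx hxp hdis ha hb hc hd he l l1.
  set (q1 := fun j => - Rmin a (c j)). set (q2 := fun k => pos_part (d k - 1 + eps)).
  (* The origin of [l1]: it gives the weight the order {l}_{a,eps} at infinity, in the coordinate
     -1/w. *)
  assert (Hl1 : - (2 * (a + 1 + eps) + - l1 + rsum n q1 + rsum m q2) = brace l a eps).
  { unfold q1. rewrite rsum_opp. unfold l1, q2. ring. }
  assert (Hl : 2 * - a + 2 * b + rsum n c + rsum m (fun k => - d k) = - l).
  { rewrite rsum_opp. unfold l. ring. }
  assert (Hpp : forall u, 0 <= pos_part u /\ u <= pos_part u).
  { intros u. unfold pos_part. split; [apply Rmax_r|apply Rmax_l]. }
  destruct (gprod_bounded_sum n m x xp (- l1) (a + 1 + eps) (2 * b) q1 q2 c (fun k => - d k) a eps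
     ha he eq_refl) as [B [hB H]].
  (* Disjointness and distinctness leave at most one factor singular at x0: an x_j with sigma =
     -min(a, c_j) >= -c_j, an x'_k with sigma >= d_k - 1 + eps, or none. *)
  - intros x0.
    destruct (classic (exists i, (i < n)%nat /\ x i = x0)) as [[i [hi Ei]]|hn].
    + assert (hno : forall k, (k < m)%nat -> xp k <> x0).
      { intros k hk E. apply (hdis i k hi hk). congruence. }
      rewrite !(rsum_at_pt_one n x x0 _ i hx hi Ei), !rsum_at_pt_none by easy. unfold q1.
      pose proof (Rmin_l a (c i)). pose proof (Rmin_r a (c i)). lra.
    + assert (hno : forall j, (j < n)%nat -> x j <> x0) by (intros j hj E; apply hn; eauto).
      rewrite !(rsum_at_pt_none n) by easy.
      destruct (classic (exists k, (k < m)%nat /\ xp k = x0)) as [[k [hk Ek]]|hn'].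
      * rewrite !(rsum_at_pt_one m xp x0 _ k hxp hk Ek). unfold q2.
        destruct (Hpp (d k - 1 + eps)). lra.
      * assert (hno' : forall k, (k < m)%nat -> xp k <> x0) by (intros k hk E; apply hn'; eauto).
        rewrite !(rsum_at_pt_none m) by easy. lra.
  - rewrite Hl1. unfold brace. destruct (Hpp (neg_part l - 1 + eps)).
    pose proof (Rmin_l a (pos_part l)). lra.
  (* At infinity e = -l. For l >= 0 the brace is at least -min(a, l) >= -l; for l < 0 it is at least
     -l - 1 + eps, where [eps] makes the inequality strict. *)
  - rewrite Hl1, Hl. unfold brace. destruct (Hpp (neg_part l - 1 + eps)).
    pose proof (Rmin_r a (pos_part l)). unfold neg_part, pos_part in *.
    destruct (Rle_or_lt 0 l) as [h|h].
    + rewrite (Rmax_left l 0), (Rmax_right (- l) 0) in * by lra. lra.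
    + rewrite (Rmax_right l 0), (Rmax_left (- l) 0) in * by lra. lra.
  (* [B] is only known to be nonnegative, whereas the constant has to be positive. *)
  - exists (B + 1). split; [lra|]. intros g K hK hg hgi hU zs hnd hz.
    rewrite zsum_positive_multiplicity.
    set (zs' := filter (fun p => Nat.leb 1 (snd p)) zs).
    assert (hdat : datum (gprod n m x xp (2 * b) (- a) c (fun k => - d k)) g K zs').
    { split; [easy|]. split; [intros w hw; now apply analytic_upper_hol2|]. split; [easy|].
      split; [|split; [now apply NoDup_map_filter|]].
      - intros w hw hgw. eapply Rle_trans; [now apply hU|]. right. unfold gprod.
        rewrite Rpower_Ropp. rewrite <- rprod_inv. unfold Rdiv. ring.
      - intros p hp. apply filter_In in hp. destruct hp as [hp hk].
        pose proof (hz p hp) as hzo. split; [apply hzo|]. split; [now apply Nat.leb_le|].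
        now apply zero_order_zero_bd. }
    pose proof (H g K zs' hdat (fun p hp => proj1 (proj2 (proj2 (proj2 (proj2 (proj2 hdat)))) p hp))) as hf.
    apply Rle_trans with (B * K); [|nra].
    eapply Rle_trans; [|exact hf]. right. apply zsum_ext. intros z. unfold gprod, q1, q2.
    rewrite Rpower_Ropp, <- rprod_inv. unfold Rdiv. ring.
Qed.
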